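(* Consider the correlated Erdős–Rényi subsampling model with parameters $p=p_n$, $s=s_n$, and set $$p_{11}=ps^2,\qquad p_{10}=p_{01}=ps(1-s),\qquad p_{00}=1-2ps+ps^2 .$$ Let $\epsilon>0$ be an arbitrarily small fixed constant. (i) If $n\left(\sqrt{p_{00}p_{11}}-\sqrt{p_{01}p_{10}}\right)^2\ge(1+\epsilon)\log n$, then $\mathbb{P}\{\mathrm{overlap}(\hat\pi_{\mathrm{ML}},\pi)=1\}=1-o(1)$. (ii) Conversely, if $n\left(\sqrt{p_{00}p_{11}}-\sqrt{p_{01}p_{10}}\right)^2\le(1-\epsilon)\log n$, then for any estimator $\hat\pi=\hat\pi(A,B)$, $\mathbb{P}\{\mathrm{overlap}(\hat\pi,\pi)=1\}=o(1)$.
   Context: Let $\mathcal S_n$ be the set of permutations of $[n]=\{1,\dots,n\}$ and let the latent permutation $\pi$ be uniform on $\mathcal S_n$. The observations are two $\{0,1\}$-valued vectors $A=(A_{ij})_{1\le i<j\le n}$ and $B=(B_{ij})_{1\le i<j\le n}$ indexed by unordered pairs (so $A_{ij}=A_{ji}$, $B_{ij}=B_{ji}$) such that, conditionally on $\pi$, the pairs $(A_{\pi(i)\pi(j)},B_{ij})$, $1\le i<j\le n$, are i.i.d. with $\mathbb{P}\{A_{\pi(i)\pi(j)}=a,B_{ij}=b\}=p_{ab}$ for $a,b\in\{0,1\}$. In the subsampling model the $p_{ab}$ are given by the formulas in the statement, with $p,s\in(0,1]$ possibly depending on $n$; equivalently, the graph with adjacency vector $(A_{\pi(i)\pi(j)})$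 and the graph with adjacency vector $B$ are independently edge-subsampled with probability $s$ from a common parent graph $\mathcal G(n,p)$. For $\pi'\in\mathcal S_n$ write $A^{\pi'}_{ij}=A_{\pi'(i)\pi'(j)}$ and $\langle A^{\pi'},B\rangle=\sum_{i<j}A_{\pi'(i)\pi'(j)}B_{ij}$. The maximum likelihood estimator is $\hat\pi_{\mathrm{ML}}\in\arg\max_{\pi'\in\mathcal S_n}\langle A^{\pi'},B\rangle$. For $\pi,\hat\pi\in\mathcal S_n$, $\mathrm{overlap}(\pi,\hat\pi)=\frac1n|\{i\in[n]:\pi(i)=\hat\pi(i)\}|$. An estimator is a function of $(A,B)$ with values in $\mathcal S_n$. Asymptotics are as $n\to\infty$; $\log$ is the natural logarithm. *)

(* Defs.v *)
From HB Require Import structures.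
From mathcomp Require Import all_boot all_order all_fingroup all_algebra.
From mathcomp Require Import all_classical all_reals all_analysis.

Set Implicit Arguments.
Unset Strict Implicit.
Unset Printing Implicit Defensive.

Import Order.TTheory GRing.Theory Num.Theory.
Import numFieldNormedType.Exports.

Local Open Scope classical_set_scope.
Local Open Scope ring_scope.

(* An unordered pair of distinct vertices is encoded by its increasing
   representative; the vertex set is 'I_n = {0, ..., n-1}. *)
Definition vpair (n : nat) := {ij : 'I_n * 'I_n | (ij.1 < ij.2)%N}.

Definition adjvec (n : nat) := {ffun vpair n -> bool}.

(* The symmetric reading A_ij = A_ji of a vector indexed by the pairs i < j.
   The diagonal value [false] is never used below, since a permutation maps
   distinct vertices to distinct vertices. *)
Definition adj (n : nat) (a : adjvec n) (i j : 'I_n) : bool :=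
  if insub (i, j) is Some e then a e
  else if insub (j, i) is Some e then a e
  else false.

Lemma adjC (n : nat) (a : adjvec n) (i j : 'I_n) : adj a i j = adj a j i.
Proof.
rewrite /adj; case: insubP => [e lt_ij _|_]; case: insubP => [f lt_ji _|_] //.
by have := ltn_trans lt_ij lt_ji; rewrite /= ltnn.
Qed.

Lemma adjE (n : nat) (a : adjvec n) (e : vpair n) :
  adj a (val e).1 (val e).2 = a e.
Proof. by rewrite /adj -surjective_pairing valK. Qed.

(* A^sigma, with (A^sigma)_ij = A_{sigma(i) sigma(j)} *)
Definition relabel (n : nat) (sigma : 'S_n) (a : adjvec n) : adjvec n :=
  [ffun e : vpair n => adj a (sigma (val e).1) (sigma (val e).2)].

Definition inner (n : nat) (a b : adjvec n) : nat :=
  (\sum_(e : vpair n) a e * b e)%N.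

Definition estimator (n : nat) := adjvec n -> adjvec n -> 'S_n.

(* Any rule for breaking ties in the argmax is allowed. *)
Definition is_MLE (n : nat) (hatpi : estimator n) : Prop :=
  forall (a b : adjvec n) (sigma : 'S_n),
    (inner (relabel sigma a) b <= inner (relabel (hatpi a b) a) b)%N.

Definition overlap (R : realType) (n : nat) (sigma tau : 'S_n) : R :=
  #|[set i : 'I_n | sigma i == tau i]%SET|%:R / n%:R.

(* [subsampling p s a b] is p_ab. *)
Definition subsampling (R : realType) (p s : R) (a b : bool) : R :=
  match a, b with
  | true, true => p * s ^+ 2
  | true, false => p * s * (1 - s)
  | false, true => p * s * (1 - s)
  | false, false => 1 - 2 * p * s + p * s ^+ 2
  end.

(* All three variables take values in finite types, so they are random
   variables as soon as their fibres are measurable, and the conditional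
   i.i.d. property given pi is the product formula for the joint conditional
   probability mass function of the pairs (A_{pi(i)pi(j)}, B_ij), i < j
   (written multiplied out by the probability of {pi = sigma}). *)
Record correlated_graphs (R : realType) (d : measure_display)
    (Omega : measurableType d) (P : probability Omega R) (n : nat)
    (pab : bool -> bool -> R)
    (pi : Omega -> 'S_n) (A B : Omega -> adjvec n) : Prop := {
  measurable_latent : forall sigma : 'S_n, measurable (pi @^-1` [set sigma]);
  measurable_left : forall a : adjvec n, measurable (A @^-1` [set a]);
  measurable_right : forall b : adjvec n, measurable (B @^-1` [set b]);
  latent_uniform : forall sigma : 'S_n,
    P [set w | pi w = sigma] = ((n`!%:R)^-1)%:E;
  pairs_cond_iid : forall (sigma : 'S_n) (x y : adjvec n),
    P [set w | [/\ pi w = sigma, relabel (pi w) (A w) = x & B w = y]] =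
    (P [set w | pi w = sigma] * (\prod_(e : vpair n) pab (x e) (y e))%:E)%E
}.

(* Main.v *)
Require Import Defs.
From HB Require Import structures.
From mathcomp Require Import all_boot all_order all_fingroup all_algebra.
From mathcomp Require Import all_classical all_reals all_analysis.
From mathcomp Require Import ring lra zify.

Set Implicit Arguments.
Unset Strict Implicit.
Unset Printing Implicit Defensive.

Import Order.TTheory GRing.Theory Num.Theory.
Import numFieldNormedType.Exports.

Local Open Scope classical_set_scope.
Local Open Scope ring_scope.

(** Write [x] for the left graph aligned by the latent permutation and [y] for
    the right graph: the pairs of bits [(x e, y e)] are i.i.d. over the edges
    [e]. Put [A = sqrt (p00 p11)], [b = p01 = p10] and [Q = (A - b) ^ 2], so that
    the threshold compares [n Q] with [ln n]. Everything is computed with finite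
    sums over pairs of edge vectors ([mean]); [prob_recovered] translates the
    probability space into such sums.

    Achievability. The maximum likelihood estimator errs only if some nontrivial
    relabelling [tau] satisfies [inner x y <= inner (relabel tau x) y]
    ([success_ge]). Exponential moments of such comparisons are sums over bits of
    cyclic products along the permutation of the edges induced by [tau], hence
    products over its orbits of traces of powers of a two-state matrix
    ([permuted_product_le]). With positive eigenvalues, an orbit of length
    [k >= 2] contributes at most the [k / 2]-th power of the trace of the square.

    For [tau] moving [k] points, about [k n (1 - k / 2n)] edges are moved, and the
    optimal Chernoff base gives the matrix trace [1] and determinant [Q], so each
    moved edge contributes [sqrt (1 - 2 Q) <= exp (- Q)]. As long as [k] is a small
    fraction of [n], the total cost [k n Q] beats the [n ^ k] choices of [tau].
    For larger [k] this is too weak by a factor up to two, since all the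
    comparisons share the fluctuations of the true alignment. These are removed
    by a threshold on a log-likelihood score: a low score of the truth has
    probability [exp (- c n ln n)], which beats the [2 ^ n] moved sets, and a high
    score of [tau] has a rate per edge equal to the mutual information [I] of a
    pair of bits minus the small cost of the cyclic dependence. The point is
    that [I] is nearly at least [2 Q] when [Q] is small ([entropy_ge]). To keep
    scores bounded and the cyclic cost negligible for all parameters, including
    sparse graphs and their complements, the score is the likelihood ratio of a
    possibly smaller correlation ([entropy_rate]).

    Converse. If the likelihood of the truth is matched, up to a factor [C], by
    [K] other permutations, then every estimator succeeds with probability at
    most [C / K] ([success_le]). The matching permutations are transpositions.
    Exchanging [i] and [j] multiplies the likelihood by at least the square of a
    product of independent weights, one for each other vertex
    ([mass_tperm_ge]); each weight has mean [1 - 2 Q], and tilting by the weights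
    makes their logarithms centred with second moment of order [Q]. A given
    transposition therefore loses at most [exp (O (sqrt (ln n)))] with probability
    [exp (- 2 n Q - O (sqrt (ln n)))], while two that share a vertex do so jointly
    with probability at most about [exp (- 3 n Q)]. Chebyshev's inequality
    ([few_cheap_le]) over the pairs formed by [2 m] vertices, [m] slightly below
    [n], gives polynomially many cheap transpositions. The weights of the [2 m]
    vertices themselves would create dependence; they are close to [1] because
    [m Q] is small, and are treated separately by Markov's inequality. *)

(** * Expectations over independent pairs of bits *)

Definition mass (R : realType) (E : finType) (p : bool -> bool -> R)
    (x y : {ffun E -> bool}) : R := \prod_e p (x e) (y e).

Definition mean (R : realType) (E : finType) (p : bool -> bool -> R)
    (f : {ffun E -> bool} -> {ffun E -> bool} -> R) : R :=
  \sum_x \sum_y mass p x y * f x y.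

Definition law (R : realType) (p : bool -> bool -> R) : Prop :=
  (forall a b, 0 <= p a b) /\ \sum_a \sum_b p a b = 1.

Definition depends_on (R : realType) (E : finType) (C : {pred E})
    (f : {ffun E -> bool} -> {ffun E -> bool} -> R) : Prop :=
  forall x y x' y' : {ffun E -> bool}, (forall e, e \in C -> x e = x' e /\ y e = y' e) ->
    f x y = f x' y'.

Lemma mass_ge0 (R : realType) (E : finType) (p : bool -> bool -> R)
    (x y : {ffun E -> bool}) : (forall a b, 0 <= p a b) -> 0 <= mass p x y.
Proof. by move=> p0; apply: prodr_ge0 => e _. Qed.

Lemma mean_prod (R : realType) (E : finType) (p : bool -> bool -> R)
    (k : E -> bool -> bool -> R) :
  mean p (fun x y => \prod_e k e (x e) (y e)) =
  \prod_e \sum_a \sum_b p a b * k e a b.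
Proof.
rewrite bigA_distr_bigA /mean /=; apply: eq_bigr => x _.
rewrite bigA_distr_bigA /=; apply: eq_bigr => y _.
by rewrite /mass -big_split.
Qed.

Lemma mean_cst (R : realType) (E : finType) (p : bool -> bool -> R) (c : R) :
  law p -> mean (E := E) p (fun _ _ => c) = c.
Proof.
move=> [_ p1]; rewrite -[RHS]mulr1.
have -> : (1 : R) = \prod_(e : E) \sum_a \sum_b p a b * 1.
  rewrite big1 // => e _; rewrite -[RHS]p1.
  by apply: eq_bigr => a _; apply: eq_bigr => b _; rewrite mulr1.
rewrite -(mean_prod p (fun _ _ _ => 1)) /mean mulr_sumr.
apply: eq_bigr => x _; rewrite mulr_sumr; apply: eq_bigr => y _.
by rewrite big1 // mulr1 mulrC.
Qed.

Lemma eq_mean (R : realType) (E : finType) (p : bool -> bool -> R) f g :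
  (forall x y : {ffun E -> bool}, f x y = g x y) -> mean p f = mean p g.
Proof.
by move=> fg; apply: eq_bigr => x _; apply: eq_bigr => y _; rewrite fg.
Qed.

Lemma ler_mean (R : realType) (E : finType) (p : bool -> bool -> R) f g :
  law p -> (forall x y : {ffun E -> bool}, f x y <= g x y) ->
  mean p f <= mean p g.
Proof.
move=> [p0 _] fg; apply: ler_sum => x _; apply: ler_sum => y _.
by rewrite ler_wpM2l ?mass_ge0.
Qed.

Lemma mean_ge0 (R : realType) (E : finType) (p : bool -> bool -> R) f :
  law p -> (forall x y : {ffun E -> bool}, 0 <= f x y) -> 0 <= mean p f.
Proof. by move=> lp f0; rewrite -(mean_cst E 0 lp); exact: ler_mean. Qed.

Lemma mean_sum (R : realType) (E I : finType) (p : bool -> bool -> R)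
    (P : pred I) (f : I -> {ffun E -> bool} -> {ffun E -> bool} -> R) :
  mean p (fun x y => \sum_(i | P i) f i x y) = \sum_(i | P i) mean p (f i).
Proof.
rewrite /mean [RHS]exchange_big; apply: eq_bigr => x _ /=.
rewrite [RHS]exchange_big; apply: eq_bigr => y _ /=.
by rewrite mulr_sumr.
Qed.

Lemma meanD (R : realType) (E : finType) (p : bool -> bool -> R) f g :
  mean p (fun x y : {ffun E -> bool} => f x y + g x y) = mean p f + mean p g.
Proof.
rewrite /mean -big_split; apply: eq_bigr => x _ /=.
by rewrite -big_split; apply: eq_bigr => y _ /=; rewrite mulrDr.
Qed.

Lemma meanZ (R : realType) (E : finType) (p : bool -> bool -> R) c f :
  mean p (fun x y : {ffun E -> bool} => c * f x y) = c * mean p f.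
Proof.
rewrite /mean mulr_sumr; apply: eq_bigr => x _ /=.
by rewrite mulr_sumr; apply: eq_bigr => y _ /=; rewrite mulrCA.
Qed.

Definition mix (E : finType) (C : {pred E}) (x x' : {ffun E -> bool}) :
  {ffun E -> bool} := [ffun e => if e \in C then x e else x' e].

(** Swapping the coordinates outside [C] between two independent copies
    preserves the joint mass and turns the product of two means into the
    mean of the product. *)
Lemma mean_indep (R : realType) (E : finType) (p : bool -> bool -> R)
    (C D : {pred E}) f g :
  law p -> depends_on C f -> depends_on D g ->
  (forall e, e \in C -> e \notin D) ->
  mean p (fun x y => f x y * g x y) = mean p f * mean p g.
Proof.
move=> lp fC gD CD.
pose T : finType := {ffun E -> bool}.
pose h (t : (T * T) * (T * T)) : (T * T) * (T * T) :=
  ((mix C t.1.1 t.2.1, mix C t.1.2 t.2.2), (mix C t.2.1 t.1.1, mix C t.2.2 t.1.2)).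
have hK : involutive h.
  by case=> [[x y] [x' y']]; rewrite /h /=; congr (pair (pair _ _) (pair _ _));
    apply/ffunP => e; rewrite !ffunE; case: (e \in C).
have pairE F : mean p F = \sum_(t : T * T) mass p t.1 t.2 * F t.1 t.2.
  by rewrite /mean pair_bigA.
transitivity (\sum_(t : (T * T) * (T * T))
   (mass p t.1.1 t.1.2 * (f t.1.1 t.1.2 * g t.1.1 t.1.2)) * mass p t.2.1 t.2.2).
  rewrite -(pair_bigA _ (fun a b : T * T =>
    (mass p a.1 a.2 * (f a.1 a.2 * g a.1 a.2)) * mass p b.1 b.2)) /=.
  rewrite pairE; apply: eq_bigr => a _; rewrite -mulr_sumr.
  have := mean_cst E 1 lp; rewrite pairE /= => m1.
  by rewrite (_ : \sum_i _ = 1) ?mulr1 // -[RHS]m1; apply: eq_bigr => t _; rewrite mulr1.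
rewrite (reindex_inj (inv_inj hK)) /= !pairE.
rewrite big_distrlr /= pair_bigA /=; apply: eq_bigr => -[[x y] [x' y']] _ /=.
have -> : f (mix C x x') (mix C y y') = f x y.
  by apply: fC => e eC; rewrite !ffunE eC.
have -> : g (mix C x x') (mix C y y') = g x' y'.
  by apply: gD => e eD; rewrite !ffunE; case: ifP => // /CD; rewrite eD.
have : mass p (mix C x x') (mix C y y') * mass p (mix C x' x) (mix C y' y) =
       mass p x y * mass p x' y'.
  rewrite /mass -!big_split; apply: eq_bigr => e _ /=; rewrite !ffunE.
  by case: ifP => // _; rewrite mulrC.
move=> mE; transitivity (mass p (mix C x x') (mix C y y') * mass p (mix C x' x) (mix C y' y) * (f x y * g x' y')); first by ring.
by rewrite mE; ring.
Qed.

Lemma mean_prod_blocks (R : realType) (E : finType) (I : eqType) (p : bool -> bool -> R)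
    (s : seq I) (C : I -> {pred E}) (h : I -> _) :
  law p -> uniq s -> {in s, forall i, depends_on (C i) (h i)} ->
  {in s &, forall i j, i != j -> forall e, e \in C i -> e \notin C j} ->
  mean p (fun x y => \prod_(i <- s) h i x y) = \prod_(i <- s) mean p (h i).
Proof.
move=> lp; elim: s => [|i s IH] /=.
  by move=> *; rewrite big_nil -[RHS](mean_cst E 1 lp); apply: eq_mean => x y; rewrite big_nil.
move=> /andP[si us] hC CC; rewrite big_cons -IH //; first last.
- by move=> j k js ks; apply: CC; rewrite inE (js, ks) orbT.
- by move=> j js; apply: hC; rewrite inE js orbT.
rewrite -(@mean_indep _ _ _ (C i) [pred e | has (fun j => e \in C j) s] (h i)) //.
- by apply: eq_mean => x y; rewrite big_cons.
- by apply: hC; rewrite inE eqxx.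
- move=> x y x' y' xx; apply: eq_big_seq => j js; apply: hC; first by rewrite inE js orbT.
  by move=> e ej; apply: xx; rewrite inE; apply/hasP; exists j.
- move=> e ei; rewrite inE; apply/hasPn => j js; apply: (CC i j) => //.
  + by rewrite inE eqxx.
  + by rewrite inE js orbT.
  + by apply: contraNneq si => ->.
Qed.

Lemma mean_coord (R : realType) (E : finType) (p : bool -> bool -> R) (e : E) k :
  law p -> mean p (fun x y : {ffun E -> bool} => k (x e) (y e)) =
  \sum_a \sum_b p a b * k a b.
Proof.
move=> [_ p1]; pose k' e' a b := if e' == e then k a b else 1 : R.
transitivity (mean p (fun x y : {ffun E -> bool} => \prod_e' k' e' (x e') (y e'))).
  apply: eq_mean => x y; rewrite (bigD1 e) //= /k' eqxx big1 ?mulr1 // => i.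
  by case: ifP.
rewrite mean_prod (bigD1 e) //= [X in _ * X]big1 ?mulr1.
  by apply: eq_bigr => a _; apply: eq_bigr => b _; rewrite /k' eqxx.
move=> i ie; rewrite -[RHS]p1; apply: eq_bigr => a _; apply: eq_bigr => b _.
by rewrite /k' (negPf ie) mulr1.
Qed.

Lemma mean_coord2 (R : realType) (E : finType) (p : bool -> bool -> R) (e e' : E) k :
  law p -> e != e' ->
  mean p (fun x y : {ffun E -> bool} => k (x e) (y e) (x e') (y e')) =
  \sum_a \sum_b p a b * (\sum_a' \sum_b' p a' b' * k a b a' b').
Proof.
move=> lp ee.
have dl (i : E) (c : bool) (d : bool) : @depends_on R E (pred1 i)
    (fun x y => ((x i == c) && (y i == d))%:R).
  by move=> x y x' y' /(_ i); rewrite inE eqxx => -[] // -> ->.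
transitivity (mean p (fun x y : {ffun E -> bool} => \sum_a \sum_b
   ((x e == a) && (y e == b))%:R * k a b (x e') (y e'))).
  apply: eq_mean => x y; rewrite (bigD1 (x e)) //= (bigD1 (y e)) //= !eqxx mul1r.
  rewrite big1 => [|b /negPf]; last by rewrite eq_sym => ->; rewrite mul0r.
  rewrite big1 ?addr0 // => a /negPf; rewrite eq_sym => ->.
  by rewrite big1 // => b _; rewrite mul0r.
rewrite mean_sum; apply: eq_bigr => a _; rewrite mean_sum; apply: eq_bigr => b _.
rewrite (@mean_indep _ _ _ (pred1 e) (pred1 e')) //.
- rewrite (mean_coord e' (k a b)) // (mean_coord e (fun c d => ((c == a) && (d == b))%:R)) //.
  congr (_ * _); rewrite (bigD1 a) //= (bigD1 b) //= !eqxx mulr1.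
  rewrite big1 => [|c /negPf ->]; last by rewrite mulr0.
  rewrite big1 ?addr0 // => c /negPf ->; by rewrite big1 // => d _; rewrite mulr0.
- by move=> x y x' y' /(_ e'); rewrite inE eqxx => -[] // -> ->.
- by move=> i; rewrite !inE => /eqP ->.
Qed.

Lemma mean_coord3 (R : realType) (E : finType) (p : bool -> bool -> R)
    (e e' e'' : E) k :
  law p -> e != e' -> e != e'' -> e' != e'' ->
  mean p (fun x y : {ffun E -> bool} =>
    k (x e) (y e) (x e') (y e') (x e'') (y e'')) =
  \sum_a \sum_b p a b * (\sum_a' \sum_b' p a' b' *
    (\sum_a'' \sum_b'' p a'' b'' * k a b a' b' a'' b'')).
Proof.
move=> lp e1 e2 e3.
have dl (i : E) (c : bool) (d : bool) : @depends_on R E (pred1 i)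
    (fun x y => ((x i == c) && (y i == d))%:R).
  by move=> x y x' y' /(_ i); rewrite inE eqxx => -[] // -> ->.
transitivity (mean p (fun x y : {ffun E -> bool} => \sum_a \sum_b
   ((x e == a) && (y e == b))%:R * k a b (x e') (y e') (x e'') (y e''))).
  apply: eq_mean => x y; rewrite (bigD1 (x e)) //= (bigD1 (y e)) //= !eqxx mul1r.
  rewrite big1 => [|b /negPf]; last by rewrite eq_sym => ->; rewrite mul0r.
  rewrite big1 ?addr0 // => a /negPf; rewrite eq_sym => ->.
  by rewrite big1 // => b _; rewrite mul0r.
rewrite mean_sum; apply: eq_bigr => a _; rewrite mean_sum; apply: eq_bigr => b _.
rewrite (@mean_indep _ _ _ (pred1 e) (pred2 e' e'')) //.
- rewrite (mean_coord2 (k a b)) // (mean_coord e (fun c d => ((c == a) && (d == b))%:R)) //.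
  congr (_ * _); rewrite (bigD1 a) //= (bigD1 b) //= !eqxx mulr1.
  rewrite big1 => [|c /negPf ->]; last by rewrite mulr0.
  rewrite big1 ?addr0 // => c /negPf ->; by rewrite big1 // => d _; rewrite mulr0.
- move=> x y x' y' xx; have [|-> ->] := xx e'; first by rewrite !inE eqxx.
  by have [|-> ->] := xx e''; first by rewrite !inE eqxx orbT.
- by move=> i; rewrite !inE => /eqP ->; rewrite negb_or e1.
Qed.

(** * Cyclic products along a permutation *)

(** Two factors are combined by the Cauchy-Schwarz inequality, each remaining
    entry being at most the norm of its pair. *)
Lemma prodD_le_prod_norm (R : realType) (E : finType) (O : {set E})
    (a b : E -> R) (e e' : E) :
  (forall i, 0 <= a i) -> (forall i, 0 <= b i) ->
  e \in O -> e' \in O -> e != e' ->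
  \prod_(i in O) a i + \prod_(i in O) b i <=
  \prod_(i in O) Num.sqrt (a i ^+ 2 + b i ^+ 2).
Proof.
move=> a0 b0 eO eO' ee.
have sa i : a i <= Num.sqrt (a i ^+ 2 + b i ^+ 2).
  by rewrite -[leLHS]ger0_norm // -sqrtr_sqr ler_wsqrtr // lerDl sqr_ge0.
have sb i : b i <= Num.sqrt (a i ^+ 2 + b i ^+ 2).
  by rewrite -[leLHS]ger0_norm // -sqrtr_sqr ler_wsqrtr // lerDr sqr_ge0.
have split F : \prod_(i in O) F i =
    F e * F e' * \prod_(i in O | (i != e) && (i != e')) F i :> R.
  rewrite (bigD1 e) //= (bigD1 e') /= ?eO' 1?eq_sym // mulrA; congr (_ * _).
  by apply: eq_bigl => i; rewrite andbA.
rewrite !split.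
set s := Num.sqrt (a e ^+ 2 + b e ^+ 2); set s' := Num.sqrt (a e' ^+ 2 + b e' ^+ 2).
set S := \prod_(i in O | _) Num.sqrt _.
have CS : a e * a e' + b e * b e' <= s * s'.
  rewrite -sqrtrM ?addr_ge0 ?sqr_ge0 //.
  rewrite -[leLHS]ger0_norm ?addr_ge0 ?mulr_ge0 // -sqrtr_sqr ler_wsqrtr //.
  have := sqr_ge0 (a e * b e' - b e * a e'); nra.
have S0 : 0 <= S by apply: prodr_ge0 => i _; exact: sqrtr_ge0.
apply: le_trans (ler_wpM2r S0 CS); rewrite mulrDl lerD // ler_wpM2l ?mulr_ge0 //.
  by apply: ler_prod => i _; rewrite a0 sa.
by apply: ler_prod => i _; rewrite b0 sb.
Qed.

(** An invariant colouring is constant on each orbit, so the sum factorizes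
    over the orbits; an orbit of length at least two is bounded by the
    Cauchy-Schwarz inequality. *)
Lemma sum_invariant_colourings (R : realType) (E : finType) (tau : {perm E})
    (mu : bool -> E -> R) :
  (forall b e, 0 <= mu b e) ->
  \sum_(c : {ffun E -> bool} | [forall e, c (tau e) == c e]) \prod_e mu (c e) e <=
  \prod_e (if tau e == e then mu false e + mu true e
           else Num.sqrt (mu false e ^+ 2 + mu true e ^+ 2)).
Proof.
move=> mu0; pose P := porbits tau.
have pP : finset.partition P [set: E]%SET.
  have -> : P = preim_partition (porbit tau) [set: E]%SET.
    apply/setP => O; apply/imsetP/imsetP => -[x _ ->]; exists x; rewrite ?inE //.
      by apply/setP => y; rewrite !inE eq_porbit_mem porbit_sym.
    by apply/setP => y; rewrite !inE eq_porbit_mem porbit_sym.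
  exact: preim_partitionP.
have prodP F : \prod_e F e = \prod_(O in P) \prod_(e in O) F e :> R.
  rewrite -(set_partition_big _ pP) /=; apply: eq_bigl => e; by rewrite inE.
have memP O e : O \in P -> e \in O -> O = porbit tau e.
  by case/imsetP => x _ -> ex; apply/esym/eqP; rewrite eq_porbit_mem // porbit_sym.
rewrite prodP.
apply: (@le_trans _ _ (\prod_(O in P) \sum_b \prod_(e in O) mu b e)); last first.
  apply: ler_prod => O OP; apply/andP; split.
    by apply: sumr_ge0 => b _; apply: prodr_ge0.
  case/imsetP: (OP) => x _ Ox.
  have xO : x \in O by rewrite Ox porbit_id.
  have txO : tau x \in O by rewrite Ox -{1}(expg1 tau) mem_porbit.
  rewrite big_bool /= addrC.
  have [tx|tx] := eqVneq (tau x) x.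
    have -> : O = [set x]%SET.
      apply/setP => e; rewrite inE Ox; apply/porbitP/eqP => [[i ->]|->].
        elim: i => [|i IH]; first by rewrite expg0 perm1.
        by rewrite expgSr permM IH.
      by exists 0%N; rewrite expg0 perm1.
    by rewrite !big_set1 tx eqxx.
  apply: le_trans (@prodD_le_prod_norm _ _ O (mu false) (mu true) _ _ (mu0 _) (mu0 _) xO txO _) _.
    by rewrite eq_sym.
  apply: ler_prod => e eO; rewrite sqrtr_ge0 /= ifF //.
  apply/negP => /eqP te; case/negP: tx.
  move: eO; rewrite Ox => /porbitP[i ei]; apply/eqP.
  have : tau ((tau ^+ i)%g x) = (tau ^+ i)%g x by rewrite -ei.
  rewrite -permM -expgSr expgS permM => /perm_inj; exact.
rewrite (big_distr_big false) /=.
pose d (c : {ffun E -> bool}) : {ffun {set E} -> bool} :=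
  [ffun O => (O \in P) && [exists e in O, c e]].
pose inv := [set c : {ffun E -> bool} | [forall e, c (tau e) == c e]]%SET.
have invP c O e : c \in inv -> O \in P -> e \in O -> d c O = c e.
  rewrite inE => /forallP ci OP eO; rewrite ffunE OP /=.
  have oE := memP _ _ OP eO.
  have cE i : c ((tau ^+ i)%g e) = c e.
    elim: i => [|i IH]; first by rewrite expg0 perm1.
    by rewrite expgSr permM (eqP (ci _)).
  apply/existsP/idP => [[e' /andP[]]|ce]; last by exists e; rewrite eO.
  by rewrite oE => /porbitP[i ->]; rewrite cE.
have dinj : {in inv &, injective d}.
  move=> c c' ci ci' dd; apply/ffunP => e.
  have OP : porbit tau e \in P by apply: imset_f.
  by rewrite -(invP c _ _ ci OP (porbit_id _ _)) dd (invP c' _ _ ci' OP (porbit_id _ _)).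
rewrite [leLHS](_ : _ = \sum_(c in inv) \prod_(O in P) \prod_(e in O) mu (d c O) e); last first.
  apply: eq_big => [c|c ci]; first by rewrite inE.
  rewrite prodP; apply: eq_bigr => O OP; apply: eq_bigr => e eO.
  by rewrite (invP c O e) // inE.
rewrite -(big_imset (fun d : {ffun {set E} -> bool} => \prod_(O in P) \prod_(e in O) mu (d O) e) dinj) /=.
rewrite [leRHS](bigID (mem (d @: inv))) /= -[leLHS]addr0 lerD //.
  rewrite le_eqVlt; apply/orP; left; apply/eqP; apply: eq_bigl => f.
  apply/idP/andP => [fi|[]//]; split=> //; case/imsetP: fi => c _ ->.
  apply/pfamilyP; split => //; apply/fintype.subsetP => O; rewrite !inE ffunE.
  by case: (O \in P).
by apply: sumr_ge0 => f _; apply: prodr_ge0 => O _; apply: prodr_ge0.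
Qed.

(** The left-hand side is the trace of a tensor power composed with the
    permutation operator: expanding every kernel in the biorthonormal system,
    only the colourings that are constant along [tau] survive. *)
Lemma permuted_product_le (R : realType) (E : finType) (tau : {perm E})
    (mu : bool -> E -> R) (f g : bool -> bool -> R) (G : E -> bool -> bool -> R) :
  (forall b e, 0 <= mu b e) ->
  (forall i j, \sum_a g i a * f j a = (i == j)%:R) ->
  (forall e a a', G e a a' = \sum_i mu i e * (g i a * f i a')) ->
  \sum_(x : {ffun E -> bool}) \prod_e G e (x e) (x (tau e)) <=
  \prod_e (if tau e == e then mu false e + mu true e
           else Num.sqrt (mu false e ^+ 2 + mu true e ^+ 2)).
Proof.
move=> mu0 fg GE; apply: le_trans (sum_invariant_colourings tau mu0).
rewrite le_eqVlt; apply/orP; left; apply/eqP.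
under eq_bigr => x _.
  under eq_bigr => e _ do rewrite GE.
  rewrite bigA_distr_bigA /=.
  over.
rewrite exchange_big /= [RHS]big_mkcond; apply: eq_bigr => c _.
under eq_bigr => x _.
  rewrite big_split /=; under [X in _ * X]eq_bigr => e _ do idtac.
  rewrite big_split /= [X in _ * (_ * X)](reindex_inj (@perm_inj _ (tau^-1)%g)) /=.
  under [X in _ * (_ * X)]eq_bigr => e _ do rewrite permKV.
  rewrite -big_split /=.
  over.
rewrite -mulr_sumr.
rewrite -(bigA_distr_bigA (fun e a => g (c e) a * f (c ((tau^-1)%g e)) a)) /=.
under [X in _ * X]eq_bigr => e _ do rewrite fg.
case: ifPn => [/forallP ci|].
  rewrite [X in _ * X]big1 ?mulr1 // => e _.
  by have := ci ((tau^-1)%g e); rewrite permKV => /eqP ->; rewrite eqxx.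
case/forallPn => e ne; rewrite [X in _ * X](bigD1 (tau e)) //= permK (negPf ne).
by rewrite mul0r mulr0.
Qed.

(** * Relabelled edges *)

Definition oedge (n : nat) (i j : 'I_n) : option (vpair n) :=
  if insub (i, j) is Some e then Some e else insub (j, i).

Lemma adj_oedge (n : nat) (a : adjvec n) (i j : 'I_n) :
  adj a i j = oapp a false (oedge i j).
Proof. by rewrite /adj /oedge; case: (insub (i, j)) => // ; case: insub. Qed.

Lemma oedge_ltn (n : nat) (i j : 'I_n) (h : (i < j)%N) :
  oedge i j = Some (Sub (i, j) h).
Proof. by rewrite /oedge insubT. Qed.

Lemma oedgeC (n : nat) (i j : 'I_n) : oedge i j = oedge j i.
Proof.
have [lt|lt|/val_inj -> //] := ltngtP i j.
  by rewrite (oedge_ltn lt) /oedge insubF ?insubT //= ltnNge (ltnW lt).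
by rewrite (oedge_ltn lt) /oedge insubF ?insubT //= ltnNge (ltnW lt).
Qed.

Lemma oedgeP (n : nat) (i j : 'I_n) : i != j ->
  exists2 e : vpair n, oedge i j = Some e & val e = (i, j) \/ val e = (j, i).
Proof.
rewrite neq_ltn => /orP[lt|lt].
  by rewrite (oedge_ltn lt); eexists; first by []; left.
by rewrite oedgeC (oedge_ltn lt); eexists; first by []; right.
Qed.

Lemma oedge_eq (n : nat) (i j : 'I_n) (e : vpair n) :
  oedge i j = Some e -> val e = (i, j) \/ val e = (j, i).
Proof.
rewrite /oedge; case: insubP => [f _ vf [<-]|_]; first by left.
by case: insubP => [f _ vf [<-]|//]; right.
Qed.

Definition eperm_fun (n : nat) (s : 'S_n) (e : vpair n) : vpair n :=
  odflt e (oedge (s (val e).1) (s (val e).2)).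

Lemma vpair_neq (n : nat) (e : vpair n) : (val e).1 != (val e).2.
Proof. by rewrite neq_ltn (valP e). Qed.

Lemma eperm_fun_val (n : nat) (s : 'S_n) (e : vpair n) :
  val (eperm_fun s e) = (s (val e).1, s (val e).2) \/
  val (eperm_fun s e) = (s (val e).2, s (val e).1).
Proof.
have ne : s (val e).1 != s (val e).2 by rewrite (inj_eq perm_inj) vpair_neq.
by rewrite /eperm_fun; have [f -> /=] := oedgeP ne.
Qed.

Lemma eperm_inj (n : nat) (s : 'S_n) : injective (eperm_fun s).
Proof.
move=> e f ef; have := eperm_fun_val s e; have := eperm_fun_val s f; rewrite ef.
have le := valP e; have lf := valP f.
move=> h1 h2; apply: val_inj; move: le lf h1 h2; case: (val e) (val f) => a b [c d] /= ab cd.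
case=> -> [] [/perm_inj h /perm_inj h'] //; subst => //; first by rewrite ltnNge ltnW in cd.
by rewrite ltnNge ltnW in cd.
Qed.

Definition eperm (n : nat) (s : 'S_n) : {perm vpair n} := perm (@eperm_inj n s).

Lemma relabelE (n : nat) (s : 'S_n) (x : adjvec n) (e : vpair n) :
  relabel s x e = x (eperm s e).
Proof.
rewrite ffunE permE adj_oedge /eperm_fun.
have ne : s (val e).1 != s (val e).2 by rewrite (inj_eq perm_inj) vpair_neq.
by have [f -> _] := oedgeP ne.
Qed.

Lemma adj_relabel (n : nat) (s : 'S_n) (x : adjvec n) (i j : 'I_n) : i != j ->
  adj (relabel s x) i j = adj x (s i) (s j).
Proof.
move=> ij; rewrite [LHS]adj_oedge; have [e -> [ev|ev]] := oedgeP ij; rewrite /= ffunE ev //=.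
by rewrite adjC.
Qed.

Lemma relabelM (n : nat) (s t : 'S_n) (x : adjvec n) :
  relabel s (relabel t x) = relabel (s * t)%g x.
Proof.
by apply/ffunP => e; rewrite ffunE adj_relabel ?(inj_eq perm_inj) ?vpair_neq // !ffunE !permM.
Qed.

Lemma relabel1 (n : nat) (x : adjvec n) : relabel 1%g x = x.
Proof. by apply/ffunP => e; rewrite ffunE !perm1 adjE. Qed.

Lemma relabelK (n : nat) (s : 'S_n) : cancel (@relabel n s) (relabel s^-1%g).
Proof. by move=> x; rewrite relabelM mulVg relabel1. Qed.

Lemma relabelVK (n : nat) (s : 'S_n) : cancel (relabel s^-1%g) (@relabel n s).
Proof. by move=> x; rewrite relabelM mulgV relabel1. Qed.

(** An edge is fixed when its endpoints are both fixed or exchanged. Only the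
    second case creates fixed edges among those touching a moved vertex. *)
Lemma eperm_fixed (n : nat) (s : 'S_n) (e : vpair n) :
  (eperm s e == e) =
  ((s (val e).1 == (val e).1) && (s (val e).2 == (val e).2)) ||
  ((s (val e).1 == (val e).2) && (s (val e).2 == (val e).1)).
Proof.
case: e => -[a b] /= ab; rewrite permE -(inj_eq val_inj).
have := valP (eperm_fun s (exist _ (a, b) ab)).
have [] := eperm_fun_val s (exist _ (a, b) ab) => /= -> /=; rewrite xpair_eqE => lt.
  case: (_ && _) => //=; apply/esym/negP => /andP[/eqP sa /eqP sb].
  by move: lt; rewrite sa sb ltnNge ltnW.
rewrite andbC orbC; case: (_ && _) => //=; apply/esym/negP => /andP[/eqP sa /eqP sb].
by move: lt; rewrite sa sb ltnNge ltnW.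
Qed.

Lemma big_ordered_pairs (T : Type) (idx : T) (op : Monoid.com_law idx) (n : nat)
    (f : 'I_n -> 'I_n -> T) : (forall i j, f i j = f j i) ->
  \big[op/idx]_i \big[op/idx]_(j | j != i) f i j =
  op (\big[op/idx]_(e : vpair n) f (val e).1 (val e).2)
     (\big[op/idx]_(e : vpair n) f (val e).1 (val e).2).
Proof.
move=> fC; rewrite pair_big_dep /= (bigID (fun ij : 'I_n * 'I_n => (ij.1 < ij.2)%N)) /=.
have lt : \big[op/idx]_(ij : 'I_n * 'I_n | (ij.1 < ij.2)%N) f ij.1 ij.2 =
    \big[op/idx]_(e : vpair n) f (val e).1 (val e).2.
  rewrite (reindex_omap (val : vpair n -> 'I_n * 'I_n) insub) => [|ij hij]; last by rewrite insubT.
  by apply: eq_bigl => e; rewrite valK eqxx (valP e).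
congr (op _ _).
  rewrite -lt; apply: eq_bigl => -[i j] /=.
  by case: ltnP; rewrite ?andbF ?andbT // => ij; rewrite -val_eqE gtn_eqF.
pose sw (ij : 'I_n * 'I_n) := (ij.2, ij.1).
have swK : involutive sw by case.
rewrite -lt (reindex_inj (inv_inj swK)) /=.
apply: eq_big => [[i j]|[i j] _] /=; last exact: fC.
by rewrite -leqNgt -val_eqE ltn_neqAle.
Qed.

Definition touches (n : nat) (M : {set 'I_n}) : {set vpair n} :=
  [set e | ((val e).1 \in M) || ((val e).2 \in M)]%SET.

Definition moved (n : nat) (s : 'S_n) : {set 'I_n} := [set i | s i != i]%SET.

Definition moved_edges (n : nat) (s : 'S_n) : {set vpair n} :=
  [set e | eperm s e != e]%SET.

Lemma moved_edges_touch (n : nat) (s : 'S_n) : moved_edges s \subset touches (moved s).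
Proof.
apply/fintype.subsetP => e; rewrite !inE eperm_fixed negb_or => /andP[+ _].
by rewrite negb_and.
Qed.

Lemma sum_vpair (n : nat) (Q : 'I_n -> 'I_n -> bool) : (forall i j, Q i j = Q j i) ->
  (2 * #|[set e : vpair n | Q (val e).1 (val e).2]%SET| =
   \sum_i #|[set j | (j != i) && Q i j]%SET|)%N.
Proof.
move=> QC; pose f i j := nat_of_bool (Q i j).
have fC i j : f i j = f j i by rewrite /f QC.
rewrite mul2n -addnn -sum1dep_card big_mkcond /= -(big_ordered_pairs addn fC).
by apply: eq_bigr => i _; rewrite -sum1dep_card big_mkcondr; apply: eq_bigr => j _; rewrite /f; case: (Q i j).
Qed.

(** Counting ordered pairs: a vertex of [M] has [n.-1] neighbours, a vertex
    outside [M] has [#|M|] neighbours in [M]. *)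
Lemma card_touches (n : nat) (M : {set 'I_n}) :
  (2 * #|touches M| = #|M| * (2 * n - 1 - #|M|))%N.
Proof.
rewrite /touches (sum_vpair (Q := fun i j => (i \in M) || (j \in M))) => [|i j]; last exact: orbC.
rewrite (bigID (mem M)) /=.
rewrite (eq_bigr (fun _ => n.-1)) => [|i iM]; last first.
  rewrite -[n in RHS]card_ord -(cardC1 i).
  by apply: eq_card => j; rewrite !inE (iM : i \in M) andbT.
rewrite [X in (_ + X)%N](eq_bigr (fun _ => #|M|)) => [|i iM]; last first.
  apply: eq_card => j; rewrite !inE (negPf iM) /=.
  by case: (boolP (j \in M)) => jM; rewrite ?andbF ?andbT //; apply: contraNneq iM => <-.
rewrite !sum_nat_const.
have -> : #|[predC M]| = (n - #|M|)%N.
  by rewrite -(addKn #|M| #|[predC M]|) (cardC (mem M)) card_ord.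
have : (#|M| <= n)%N by have := max_card (mem M); rewrite card_ord.
by move: #|M| => k; nia.
Qed.

(** A moved vertex [i] forms an edge fixed by [eperm s] with [s i] at most. *)
Lemma card_moved_edges (n : nat) (s : 'S_n) :
  (#|moved s| * (2 * n - 2 - #|moved s|) <= 2 * #|moved_edges s|)%N.
Proof.
have -> : moved_edges s = [set e : vpair n |
    ~~ (((s (val e).1 == (val e).1) && (s (val e).2 == (val e).2)) ||
  ((s (val e).1 == (val e).2) && (s (val e).2 == (val e).1)))]%SET.
  by apply/setP => e; rewrite !inE eperm_fixed.
rewrite (sum_vpair (Q := fun i j => ~~ ((s i == i) && (s j == j) || (s i == j) && (s j == i)))); last first.
  by move=> i j; rewrite [(s i == i) && _]andbC [(s i == j) && _]andbC.
set M := moved s; rewrite (bigID (mem M)) /=.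
apply: (@leq_trans (\sum_(i in M) (n - 2) + \sum_(i | i \notin M) #|M|)%N).
  rewrite !sum_nat_const.
  have -> : #|[predC M]| = (n - #|M|)%N.
    by rewrite -(addKn #|M| #|[predC M]|) (cardC (mem M)) card_ord.
  have : (#|M| <= n)%N by have := max_card (mem M); rewrite card_ord.
  by move: #|M| => k; nia.
apply: leq_add; apply: leq_sum => i; rewrite inE => iM.
  rewrite -[n in leqLHS]card_ord -cardsT.
  apply: (@leq_trans #|[set: 'I_n]%SET :\: [set i; s i]%SET|).
    by rewrite cardsD finset.setTI leq_sub2l // cards2; case: eqP.
  apply: subset_leq_card; apply/fintype.subsetP => j; rewrite !inE negb_or andbT => /andP[ji js].
  by rewrite ji (negPf iM) /= [s i == j]eq_sym (negPf js).
apply: subset_leq_card; apply/fintype.subsetP => j; rewrite !inE negbK in iM * => jM.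
have ij : j != i by apply: contraNneq jM => ->.
by rewrite ij (negPf jM) andbF /= (eqP iM) [i == j]eq_sym (negPf ij).
Qed.

(** * The entropy rate of a weak dependence *)

Definition marg (R : realType) (q : R) (a : bool) : R := if a then q else 1 - q.

Definition dev (R : realType) (q : R) (a : bool) : R := if a then 1 - q else - q.

(** With the normalized deviations as an orthonormal basis of the centred
    functions, this is the kernel of the operator with eigenvalues [1] and [l]. *)
Definition kern (R : realType) (q l : R) (a b : bool) : R :=
  1 + l * (dev q a * dev q b) / (q * (1 - q)).

Definition corr_law (R : realType) (q l : R) (a b : bool) : R :=
  marg q a * marg q b * kern q l a b.

Lemma big_bool2 (R : realType) (f : bool -> bool -> R) :
  \sum_a \sum_b f a b = f true true + f true false + (f false true + f false false).
Proof. by rewrite !big_bool. Qed.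

Lemma ln_leB1 (R : realType) (x : R) : 0 < x -> ln x <= x - 1.
Proof. by move=> x0; have := @le_ln1Dx R (x - 1); rewrite [1 + _]addrC subrK; apply; lra. Qed.

Lemma ln_ge1BV (R : realType) (x : R) : 0 < x -> 1 - x^-1 <= ln x.
Proof.
move=> x0; have := @ln_leB1 R x^-1; rewrite invr_gt0 lnV ?posrE // => /(_ x0); lra.
Qed.

Lemma expR_le_quad (R : realType) (x : R) : x <= 2^-1 -> expR x <= 1 + x + 2 * x ^+ 2.
Proof.
move=> x2; have x1 : 0 < 1 - x by lra.
have h : expR x <= (1 - x)^-1.
  rewrite -[expR x]invrK lef_pV2 ?posrE ?invr_gt0 ?expR_gt0 // -expRN.
  exact: expR_ge1Dx.
apply: le_trans h _; rewrite -[leLHS]mul1r ler_pdivrMr //.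
have := sqr_ge0 x; nra.
Qed.

Lemma is_derive_quad (R : realType) (c k s : R) :
  is_derive s 1 (fun z : R => c + k * z ^+ 2) (2 * k * s).
Proof.
have h : is_derive s 1 (cst c + k \*: (@id R ^+ 2)) (0 + k *: ((2%:R * s ^+ 1) *: 1)).
  by apply: is_deriveD.
by apply: is_derive_eq h _; rewrite /GRing.scale /= mulr1 expr1 add0r; ring.
Qed.

Lemma is_derive_xlnx (R : realType) (c k s : R) : 0 < c + k * s ^+ 2 ->
  is_derive s 1 (fun z : R => (c + k * z ^+ 2) * ln (c + k * z ^+ 2))
    (2 * k * s * (ln (c + k * s ^+ 2) + 1)).
Proof.
move=> pos.
have dln := @is_derive1_comp R (@ln R) (fun z => c + k * z ^+ 2) s _ _ (is_derive1_ln pos) (is_derive_quad c k s).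
have := is_deriveM (is_derive_quad c k s) dln.
move=> h; apply: is_derive_eq h _; rewrite /GRing.scale /=.
by field; rewrite gt_eqF.
Qed.

(** Both sides vanish at independence and the derivative of the difference in
    the variable [Num.sqrt (r ^+ 2 + l * r)] is nonnegative by
    [1 - x^-1 <= ln x]. *)
Lemma entropy_ge (R : realType) (q l : R) : 0 < q < 1 -> 0 <= l < 1 ->
  2 * (Num.sqrt ((q * (1 - q)) ^+ 2 + l * (q * (1 - q))) - q * (1 - q)) ^+ 2 <=
  \sum_a \sum_b corr_law q l a b * ln (kern q l a b).
Proof.
move=> /andP[q0 q1] /andP[l0 l1]; set r := q * (1 - q).
have q1' : 0 < 1 - q by lra.
have r0 : 0 < r by rewrite mulr_gt0.
have rE : r = q * (1 - q) by [].
pose f1 (s : R) := (q ^+ 2 - r ^+ 2 + 1 * s ^+ 2) * ln (q ^+ 2 - r ^+ 2 + 1 * s ^+ 2).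
pose f2 (s : R) := ((1 - q) ^+ 2 - r ^+ 2 + 1 * s ^+ 2) * ln ((1 - q) ^+ 2 - r ^+ 2 + 1 * s ^+ 2).
pose f3 (s : R) := (r + r ^+ 2 + (-1) * s ^+ 2) * ln (r + r ^+ 2 + (-1) * s ^+ 2).
pose c0 := - 2 * ln q * (q ^+ 2 - r ^+ 2) - 2 * ln (1 - q) * ((1 - q) ^+ 2 - r ^+ 2)
   - 2 * (ln q + ln (1 - q)) * (r + r ^+ 2) - 2 * r ^+ 2.
pose f4 (s : R) := c0 + (- 2) * s ^+ 2.
pose F : R -> R := f1 + f2 + 2 \*: f3 + f4 + (4 * r) \*: (@id R).
pose s1 := Num.sqrt (r ^+ 2 + l * r).
have s12 : s1 ^+ 2 = r ^+ 2 + l * r by rewrite sqr_sqrtr // addr_ge0 ?sqr_ge0 // mulr_ge0 // ltW.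
have rs1 : r <= s1.
  rewrite -[leLHS](gtr0_norm r0) -sqrtr_sqr ler_wsqrtr // lerDl mulr_ge0 // ltW //.
have pos s : r <= s <= s1 -> [/\ 0 < q ^+ 2 - r ^+ 2 + 1 * s ^+ 2,
   0 < (1 - q) ^+ 2 - r ^+ 2 + 1 * s ^+ 2 & 0 < r + r ^+ 2 + (-1) * s ^+ 2].
  move=> /andP[rs ss].
  have a1 : r ^+ 2 <= s ^+ 2 by rewrite ler_sqr ?nnegrE ?(ltW r0) // (le_trans (ltW r0)).
  have a2 : s ^+ 2 <= r ^+ 2 + l * r.
    by rewrite -s12 ler_sqr ?nnegrE ?sqrtr_ge0 // (le_trans (ltW r0)).
  have := exprn_gt0 2 q0; have := exprn_gt0 2 q1'; split; nra.
pose dF s := 2 * s * (ln (q ^+ 2 - r ^+ 2 + 1 * s ^+ 2) + ln ((1 - q) ^+ 2 - r ^+ 2 + 1 * s ^+ 2)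
   - 2 * ln (r + r ^+ 2 + (-1) * s ^+ 2)) - 4 * (s - r).
have FD s : r <= s <= s1 -> is_derive s 1 F (dF s).
  move=> /pos[p1 p2 p3].
  have d1 := is_derive_xlnx p1; have d2 := is_derive_xlnx p2; have d3 := is_derive_xlnx p3.
  have d4 := is_derive_quad c0 (-2) s.
  have := is_deriveD (is_deriveD (is_deriveD (is_deriveD d1 d2) (is_deriveZ 2 d3)) d4)
     (is_deriveZ (4 * r) (is_derive_id s 1)).
  move=> h; apply: is_derive_eq h _; rewrite /dF.
  set A := ln _; set B := ln _; set C := ln _.
  transitivity (2 * 1 * s * (A + 1) + 2 * 1 * s * (B + 1) +
    2 * (2 * (-1) * s * (C + 1)) + 2 * (- 2) * s + 4 * r * 1); first by [].
  by ring.
have FE s : F s = f1 s + f2 s + 2 * f3 s + f4 s + 4 * r * s by [].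
have Fr : F r = 0.
  rewrite FE /f1 /f2 /f3 /f4 /c0.
  have -> : q ^+ 2 - r ^+ 2 + 1 * r ^+ 2 = q * q by ring.
  have -> : (1 - q) ^+ 2 - r ^+ 2 + 1 * r ^+ 2 = (1 - q) * (1 - q) by ring.
  have -> : r + r ^+ 2 + (-1) * r ^+ 2 = q * (1 - q) by rewrite rE; ring.
  by rewrite !lnM ?posrE // rE; ring.
suff Fge : F r <= F s1.
  move: Fge; rewrite Fr FE /f1 /f2 /f3 /f4 /c0.
  rewrite big_bool2 /corr_law /kern /marg /dev.
  have -> : 1 + l * (- q * - q) / (q * (1 - q)) = 1 + l * q / (1 - q).
    by field; rewrite !gt_eqF.
  have -> : 1 + l * ((1 - q) * (1 - q)) / (q * (1 - q)) = 1 + l * (1 - q) / q.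
    by field; rewrite !gt_eqF.
  have -> : 1 + l * ((1 - q) * (- q)) / (q * (1 - q)) = 1 - l.
    by field; rewrite !gt_eqF.
  have -> : 1 + l * (- q * (1 - q)) / (q * (1 - q)) = 1 - l.
    by field; rewrite !gt_eqF.
  have k1 : 0 < 1 + l * (1 - q) / q by rewrite ltr_wpDr // divr_ge0 ?mulr_ge0 // ltW.
  have k2 : 0 < 1 + l * q / (1 - q) by rewrite ltr_wpDr // divr_ge0 ?mulr_ge0 // ltW.
  have k3 : 0 < 1 - l by lra.
  have -> : q ^+ 2 - r ^+ 2 + 1 * s1 ^+ 2 = q * q * (1 + l * (1 - q) / q).
    by rewrite s12 rE; field; rewrite gt_eqF.
  have -> : (1 - q) ^+ 2 - r ^+ 2 + 1 * s1 ^+ 2 = (1 - q) * (1 - q) * (1 + l * q / (1 - q)).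
    by rewrite s12 rE; field; rewrite gt_eqF.
  have -> : r + r ^+ 2 + -1 * s1 ^+ 2 = q * (1 - q) * (1 - l).
    by rewrite s12 rE; field.
  rewrite !lnM ?posrE ?mulr_gt0 //.
  rewrite -/s1 -subr_ge0 => h; rewrite -subr_ge0; apply: le_trans h _.
  rewrite le_eqVlt; apply/orP; left; apply/eqP.
  have -> : 2 * (s1 - r) ^+ 2 = 2 * s1 ^+ 2 - 4 * r * s1 + 2 * r ^+ 2 by ring.
  rewrite s12 rE; field; by rewrite !gt_eqF.
have F1 s : s \in `]r, s1[ -> derivable F s 1.
  rewrite in_itv /= => /andP[a b]; have sI : r <= s <= s1 by rewrite !ltW.
  by have [] := FD s sI.
have F2 s : s \in `]r, s1[ -> 0 <= F^`()%classic s.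
  rewrite in_itv /= => /andP[a b].
  have sI : r <= s <= s1 by rewrite !ltW.
  have := FD s sI => -[_]; rewrite derive1E => ->.
  have [p1 p2 p3] := pos s sI.
  have s0 : 0 < s by lra.
  have lnge : 2 * (ln s - ln r) <= ln (q ^+ 2 - r ^+ 2 + 1 * s ^+ 2) +
      ln ((1 - q) ^+ 2 - r ^+ 2 + 1 * s ^+ 2) - 2 * ln (r + r ^+ 2 + (-1) * s ^+ 2).
    rewrite -subr_ge0.
    have -> : ln (q ^+ 2 - r ^+ 2 + 1 * s ^+ 2) + ln ((1 - q) ^+ 2 - r ^+ 2 + 1 * s ^+ 2)
      - 2 * ln (r + r ^+ 2 + -1 * s ^+ 2) - 2 * (ln s - ln r) =
      ln ((q ^+ 2 - r ^+ 2 + 1 * s ^+ 2) * ((1 - q) ^+ 2 - r ^+ 2 + 1 * s ^+ 2) * r ^+ 2)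
      - ln ((r + r ^+ 2 + -1 * s ^+ 2) ^+ 2 * s ^+ 2).
      by rewrite !expr2 !lnM ?posrE -?expr2 ?mulr_gt0 ?exprn_gt0 //; ring.
    rewrite subr_ge0 ler_ln ?posrE ?mulr_gt0 ?exprn_gt0 //.
    have rs : r ^+ 2 <= s ^+ 2 by rewrite ler_sqr ?nnegrE ltW.
    set u := s ^+ 2 - r ^+ 2.
    have u0 : 0 <= u by rewrite subr_ge0.
    have -> : s ^+ 2 = r ^+ 2 + u by rewrite /u addrC subrK.
    have -> : (q ^+ 2 - r ^+ 2 + 1 * (r ^+ 2 + u)) * ((1 - q) ^+ 2 - r ^+ 2 + 1 * (r ^+ 2 + u)) =
      (r - u) ^+ 2 + u by rewrite rE; ring.
    have -> : r + r ^+ 2 + -1 * (r ^+ 2 + u) = r - u by ring.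
    have ur : 0 < r - u by move: p3; rewrite /u; lra.
    have r1 : r < 1 by rewrite rE; nra.
    have : (r - u) ^+ 2 <= r ^+ 2 by rewrite ler_sqr ?nnegrE; lra.
    nra.
  have := @ln_ge1BV R (s / r); rewrite divr_gt0 // => /(_ isT); rewrite invf_div ln_div ?posrE // => lns.
  rewrite /dF subr_ge0; apply: (@le_trans _ _ (2 * s * (2 * (ln s - ln r)))); last first.
    by rewrite ler_wpM2l // mulr_ge0 // ltW.
  have -> : 4 * (s - r) = 4 * s * (1 - r / s) by field; rewrite gt_eqF.
  have : 4 * s * (1 - r / s) <= 4 * s * (ln s - ln r) by rewrite ler_wpM2l // mulr_ge0 // ltW.
  lra.
have F3 : {within `[r, s1], continuous F}.
  apply: derivable_within_continuous => s; rewrite in_itv /= => sI.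
  by have [] := FD s sI.
exact: (ger0_derive1_ndecr F1 F2 F3 (lexx r) rs1 (lexx s1)).
Qed.
Lemma kernE (R : realType) (q l : R) : 0 < q < 1 ->
  [/\ kern q l true true = 1 + l * (1 - q) / q,
      kern q l false false = 1 + l * q / (1 - q),
      kern q l true false = 1 - l & kern q l false true = 1 - l].
Proof.
move=> /andP[q0 q1]; have q1' : 0 < 1 - q by lra.
by rewrite /kern /dev; split; field; rewrite !gt_eqF.
Qed.

(** [gap r l] is the positive root of [x ^+ 2 + 2 * (r * (1 - l)) * x = l * r];
    it is the difference of the geometric means of the two diagonal and of the
    two off-diagonal entries of [corr_law q l] when [r = q * (1 - q)]. *)
Definition gap (R : realType) (r l : R) : R :=
  Num.sqrt ((r * (1 - l)) ^+ 2 + l * r) - r * (1 - l).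

Lemma gap_root (R : realType) (r l : R) : 0 <= r -> 0 <= l ->
  gap r l ^+ 2 + 2 * (r * (1 - l)) * gap r l = l * r.
Proof.
move=> r0 l0; rewrite /gap; set s := Num.sqrt _.
have : s ^+ 2 = (r * (1 - l)) ^+ 2 + l * r by rewrite sqr_sqrtr // addr_ge0 ?sqr_ge0 ?mulr_ge0.
nra.
Qed.

Lemma gap_ge0 (R : realType) (r l : R) : 0 <= r -> 0 <= l -> 0 <= gap r l.
Proof.
move=> r0 l0; rewrite subr_ge0; apply: le_trans (ler_norm _) _.
by rewrite -sqrtr_sqr ler_wsqrtr // lerDl mulr_ge0.
Qed.

Lemma gap_le_half (R : realType) (r l : R) : 0 <= r <= 4^-1 -> 0 <= l <= 1 -> gap r l <= 2^-1.
Proof.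
move=> /andP[r0 r1] /andP[l0 l1]; rewrite leNgt; apply/negP => h.
have := gap_root r0 l0; set s := gap r l in h *.
have : 0 <= r * (1 - l) by rewrite mulr_ge0 // subr_ge0.
have : r * l <= r by rewrite ler_piMr.
nra.
Qed.

(** Subtracting the two quadratic equations solved by the gaps; [gap <= 1/2]
    bounds the cross term. *)
Lemma gap_sqr_lipschitz (R : realType) (r l l' : R) : 0 <= r <= 4^-1 ->
  0 <= l <= l' -> l' <= 1 -> gap r l' ^+ 2 <= gap r l ^+ 2 + 2 * r * (l' - l).
Proof.
move=> rr /andP[l0 ll'] l'1; have /andP[r0 r1] := rr.
have l'0 : 0 <= l' by lra.
have e1 := gap_root r0 l0; have e2 := gap_root r0 l'0.
have s0 := gap_ge0 r0 l0; have s'0 := gap_ge0 r0 l'0.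
have h : gap r l' <= 2^-1 by apply: gap_le_half; rewrite ?l'0.
move: e1 e2 s0 s'0 h; set s := gap r l; set s' := gap r l' => e1 e2 s0 s'0 h.
have [ss|ss] := leP s' s.
  apply: (@le_trans _ _ (s ^+ 2)); first by rewrite ler_sqr.
  by rewrite lerDl !mulr_ge0 // subr_ge0.
have l1 : 0 <= 1 - l by lra.
have d : 0 <= s' - s by lra.
have p1 : 0 <= r * (1 - l) * (s' - s) by rewrite !mulr_ge0.
have p2 : 0 <= r * (l' - l) * (2^-1 - s') by rewrite !mulr_ge0 // subr_ge0.
nra.
Qed.

Lemma gap0_root (R : realType) (r l : R) : 0 <= r -> 0 <= l ->
  let g := Num.sqrt (r ^+ 2 + l * r) - r in 0 <= g /\ g ^+ 2 + 2 * r * g = l * r.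
Proof.
move=> r0 l0 g; rewrite /g; set s := Num.sqrt _.
have sE : s ^+ 2 = r ^+ 2 + l * r by rewrite sqr_sqrtr // addr_ge0 ?sqr_ge0 ?mulr_ge0.
split; last by nra.
by rewrite subr_ge0 -[leLHS]ger0_norm // -sqrtr_sqr ler_wsqrtr // lerDl mulr_ge0.
Qed.

Lemma kern_ge0 (R : realType) (q l : R) a b : 0 < q < 1 -> 0 <= l <= 1 -> 0 <= kern q l a b.
Proof.
move=> qq /andP[l0 l1]; have /andP[q0 q1] := qq; have q1' : 0 < 1 - q by lra.
have [h1 h2 h3 h4] := kernE l qq.
case: a b => [] []; rewrite ?h1 ?h2 ?h3 ?h4; try lra;
by rewrite addr_ge0 // divr_ge0 ?mulr_ge0 // ltW.
Qed.

Lemma corr_law_ge0 (R : realType) (q l : R) a b : 0 < q < 1 -> 0 <= l <= 1 ->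
  0 <= corr_law q l a b.
Proof.
move=> qq ll; rewrite /corr_law !mulr_ge0 ?kern_ge0 // /marg; move: qq => /andP[*]; case: ifP => _; lra.
Qed.

Lemma corr_law_sum (R : realType) (q l : R) : 0 < q < 1 -> \sum_a \sum_b corr_law q l a b = 1.
Proof.
move=> qq; have /andP[q0 q1] := qq; rewrite big_bool2 /corr_law.
have [-> -> -> ->] := kernE l qq; rewrite /marg.
by field; rewrite !gt_eqF // subr_gt0.
Qed.

Lemma kern_bounds (R : realType) (q l C : R) a b : 0 < q < 1 -> 0 <= l <= 2^-1 -> 0 <= C ->
  l <= C * (q * (1 - q)) -> 2^-1 <= kern q l a b <= 1 + C.
Proof.
move=> qq /andP[l0 l1] C0 lC; have /andP[q0 q1] := qq; have q1' : 0 < 1 - q by lra.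
have [h1 h2 h3 h4] := kernE l qq.
case: a b => [] []; rewrite ?h1 ?h2 ?h3 ?h4; try lra.
- have p : 0 <= l * (1 - q) / q by rewrite divr_ge0 ?mulr_ge0 // ltW.
  have : l * (1 - q) / q <= C.
    rewrite ler_pdivrMr //; have : 0 <= C * q * q by rewrite !mulr_ge0 // ltW.
    have : 0 <= l * q by rewrite mulr_ge0 // ltW.
    lra.
  by move=> *; apply/andP; split; lra.
- have p : 0 <= l * q / (1 - q) by rewrite divr_ge0 ?mulr_ge0 // ltW.
  have : l * q / (1 - q) <= C.
    rewrite ler_pdivrMr //; have : 0 <= C * (1 - q) * (1 - q) by rewrite !mulr_ge0 // ltW.
    have : 0 <= l * (1 - q) by rewrite mulr_ge0 // ltW.
    lra.
  by move=> *; apply/andP; split; lra.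
Qed.

(** The mean log-kernel is affine in the correlation [rho], and equals the
    entropy bounded by [entropy_ge] at [rho = l]. *)
Lemma mean_ln_kern_ge (R : realType) (q l rho : R) : 0 < q < 1 -> 0 < l <= 2^-1 ->
  l <= rho -> let r := q * (1 - q) in
  2 * (Num.sqrt (r ^+ 2 + l * r) - r) ^+ 2 + (rho - l) * (r * ln (1 + l / r)) <=
  \sum_a \sum_b corr_law q rho a b * ln (kern q l a b).
Proof.
move=> qq /andP[l0 l1] lr; cbv zeta; set r := q * (1 - q); have /andP[q0 q1] := qq; have q1' : 0 < 1 - q by lra.
have r0 : 0 < r by rewrite mulr_gt0.
have l01 : 0 <= l < 1 by apply/andP; split; lra.
have [h1 h2 h3 h4] := kernE l qq.
have k1 : 0 < 1 + l * (1 - q) / q by rewrite ltr_wpDr // divr_ge0 ?mulr_ge0 // ltW.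
have k2 : 0 < 1 + l * q / (1 - q) by rewrite ltr_wpDr // divr_ge0 ?mulr_ge0 // ltW.
have k3 : 0 < 1 - l by lra.
have -> : \sum_a \sum_b corr_law q rho a b * ln (kern q l a b) =
   \sum_a \sum_b corr_law q l a b * ln (kern q l a b) + (rho - l) *
   (r * (ln (kern q l true true) + ln (kern q l false false) - 2 * ln (kern q l true false))).
  rewrite !big_bool2 /corr_law; have [-> -> -> ->] := kernE rho qq; rewrite h1 h2 h3 h4 /marg /r.
  by field; rewrite !gt_eqF.
apply: lerD; first exact: entropy_ge.
rewrite ler_wpM2l ?subr_ge0 // ler_wpM2l ?(ltW r0) // h1 h2 h3.
have lr0 : 0 < 1 + l / r by rewrite ltr_wpDr // divr_ge0 // ltW.
have e3 : 2 * ln (1 - l) = ln ((1 - l) * (1 - l)) by rewrite lnM ?posrE //; ring.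

rewrite e3 lerBrDr -!lnM ?posrE ?mulr_gt0 // ler_ln ?posrE ?mulr_gt0 //.
have -> : (1 + l * (1 - q) / q) * (1 + l * q / (1 - q)) = (1 - l) ^+ 2 + l / r.
  by rewrite /r; field; rewrite !gt_eqF.
have : 0 <= l / r by rewrite divr_ge0 // ltW.
have : (1 - l) * (1 - l) <= 1 by nra.
move: (l / r) => t; nra.
Qed.

(** The second moment of the product of the two deviations exceeds its value
    under independence by the product of the two third moments only. *)
Lemma mean_sqr_kernB1 (R : realType) (q l rho : R) : 0 < q < 1 -> 0 <= rho ->
  \sum_a \sum_b corr_law q rho a b * (kern q l a b - 1) ^+ 2 <=
  l ^+ 2 * (1 + rho / (q * (1 - q))).
Proof.
move=> qq rho0; have /andP[q0 q1] := qq; have q1' : 0 < 1 - q by lra.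
have -> : \sum_a \sum_b corr_law q rho a b * (kern q l a b - 1) ^+ 2 =
   l ^+ 2 * (1 + rho / (q * (1 - q)) * (1 - 2 * q) ^+ 2).
  rewrite !big_bool2 /corr_law; have [-> -> -> ->] := kernE rho qq.
  have [-> -> -> ->] := kernE l qq; rewrite /marg.
  by field; rewrite !gt_eqF.
rewrite ler_wpM2l ?sqr_ge0 // lerD2l ler_piMr ?(divr_ge0 rho0) ?(ltW (mulr_gt0 q0 q1')) //.
have : 0 <= q * (1 - q) by rewrite mulr_ge0 // ltW.
nra.
Qed.

Lemma ln_sqr_le (R : realType) (k : R) : 2^-1 <= k -> ln k ^+ 2 <= 4 * (k - 1) ^+ 2.
Proof.
move=> k2; have k0 : 0 < k by lra.
have u := ln_leB1 k0; have d := ln_ge1BV k0.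
have [k1|k1] := leP 1 k.
  have : 0 <= ln k by rewrite ln_ge0.
  nra.
have : ln k <= 0 by rewrite ln_le0 // ltW.
have : - (2 * (1 - k)) <= 1 - k^-1.
  have -> : 1 - k^-1 = - ((1 - k) / k) by field; rewrite gt_eqF.
  by rewrite lerN2 ler_pdivrMr //; nra.
nra.
Qed.
(** A Bernstein bound: only the first two moments of [g] enter once the exponent
    is bounded above. *)
Lemma expR_sum_le (R : realType) (p g : bool -> bool -> R) (th : R) :
  (forall a b, 0 <= p a b) -> \sum_a \sum_b p a b = 1 ->
  (forall a b, - (th * g a b) <= 2^-1) ->
  \sum_a \sum_b p a b * expR (- (th * g a b)) <=
  expR (- th * (\sum_a \sum_b p a b * g a b) + 2 * th ^+ 2 * (\sum_a \sum_b p a b * g a b ^+ 2)).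
Proof.
move=> p0 p1 g1; apply: le_trans (expR_ge1Dx _).
apply: (@le_trans _ _ (\sum_a \sum_b p a b * (1 + - (th * g a b) + 2 * (- (th * g a b)) ^+ 2))).
  by apply: ler_sum => a _; apply: ler_sum => b _; rewrite ler_wpM2l // expR_le_quad.
by rewrite -{3}p1 !big_bool2; lra.
Qed.

(** When [l <= C * r] the quadratic term cannot dominate, so the root is
    comparable to [l] itself. *)
Lemma root_ge (R : realType) (C r l g : R) : 0 <= C -> 0 < r -> 0 < l -> l <= C * r ->
  0 <= g -> g ^+ 2 + 2 * r * g = l * r -> l ^+ 2 <= (C + 2) ^+ 2 * g ^+ 2.
Proof.
move=> C0 r0 l0 lC g0 gE; set c1 := C + 2.
have c10 : 0 < c1 by rewrite /c1; lra.
suff gl : l <= c1 * g by rewrite -exprMn ler_sqr ?nnegrE ?(ltW l0) // (le_trans (ltW l0)).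
rewrite leNgt; apply/negP => h.
have cg0 : 0 <= c1 * g by rewrite mulr_ge0 // ltW.
have h1 : c1 * g * (c1 * g) <= l * (C * r) by rewrite ler_pM ?(ltW h) // (le_trans (ltW h)).
have h2 : c1 * g * (2 * r * c1) < l * (2 * r * c1) by rewrite ltr_pM2r // !mulr_gt0.
have h3 : c1 ^+ 2 * (g ^+ 2 + 2 * r * g) = c1 ^+ 2 * (l * r) by rewrite gE.
have h5 : (C + 2 * c1) * (l * r) <= c1 ^+ 2 * (l * r).
  by rewrite ler_wpM2r ?(mulr_ge0 (ltW l0) (ltW r0)) //; rewrite /c1; have := mulr_ge0 C0 C0; clear -C0; lra.
clearbody c1; clear -h1 h2 h3 h5; lra.
Qed.

(** The net gain per unit of correlation given up when the score is built for
    the correlation [l] instead of the true one. *)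
Lemma log_gain_ge (R : realType) (C r l : R) : 0 <= C -> 0 < r -> 0 < l -> l <= C * r ->
  l * (2 * (1 + C)) <= 1 -> l / (2 * (1 + C)) <= r * ln (1 + l / r) - l ^+ 2.
Proof.
move=> C0 r0 l0 lC ld; have u0 : 0 < l / r by rewrite divr_gt0.
have C1 : 0 < 1 + C by lra.
have lnu : (l / r) / (1 + C) <= ln (1 + l / r).
  have u1 : 0 < 1 + l / r by rewrite addr_gt0.
  apply: le_trans (ln_ge1BV u1).
  have -> : 1 - (1 + l / r)^-1 = (l / r) / (1 + l / r) by field; rewrite !gt_eqF // addr_gt0.
  by rewrite ler_pM2l // lef_pV2 ?posrE // lerD2l ler_pdivrMr.
have := ler_wpM2l (ltW r0) lnu.
have -> : r * (l / r / (1 + C)) = l / (1 + C) by field; rewrite !gt_eqF.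
have -> : l / (2 * (1 + C)) = l / (1 + C) / 2 by field; rewrite gt_eqF.
have : l ^+ 2 <= l / (1 + C) / 2.
  rewrite expr2 -mulrA ler_pM2l // -invfM -[leRHS]mul1r ler_pdivlMr ?mulr_gt0 //.
  by rewrite [(1 + C) * 2]mulrC.
move: (ln _) (l / (1 + C)) => a b; clear; lra.
Qed.

(** [score q rho l] is the rate left, after the cost of the cyclic dependence,
    when the likelihood ratio of correlation [l] is used as a score under the
    law of correlation [rho]. *)
Definition score (R : realType) (q rho l : R) : R :=
  \sum_a \sum_b corr_law q rho a b * ln (kern q l a b) - l ^+ 2 * rho ^+ 2 / 2.

Lemma score_ge (R : realType) (eta C q rho l : R) (r := q * (1 - q)) :
  0 < eta < 1 -> 6 <= C -> 0 < q < 1 -> rho <= 1 -> 0 < l <= rho ->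
  l <= C * r -> l * (4 * (C + 2) ^+ 2) <= eta ->
  (2 - eta / 2) * (Num.sqrt (r ^+ 2 + l * r) - r) ^+ 2 +
    (rho - l) * (r * ln (1 + l / r) - l ^+ 2) <= score q rho l.
Proof.
move=> /andP[eta0 eta1] C6 qq rho1 /andP[l0 l_rho] lC ld.
have /andP[q0 q1] := qq; have q1' : 0 < 1 - q by lra.
have r0 : 0 < r by rewrite mulr_gt0.
set g := Num.sqrt (r ^+ 2 + l * r) - r.
have [g0 gE] := gap0_root (ltW r0) (ltW l0); rewrite -/g in g0 gE.
have C0 : 0 <= C by lra.
have gl := root_ge C0 r0 l0 lC g0 gE.
have g20 := sqr_ge0 g.
have c2 : 64 <= (C + 2) ^+ 2 by clear -C6; nra.
have ld' : l * 256 <= eta.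
  apply: le_trans ld; rewrite ler_pM2l //; clear -c2; lra.
have l2 : 0 < l <= 2^-1 by rewrite l0 /=; clear -ld' eta1; lra.
have h : 2 * g ^+ 2 + (rho - l) * (r * ln (1 + l / r)) <=
  \sum_a \sum_b corr_law q rho a b * ln (kern q l a b) := mean_ln_kern_ge qq l2 l_rho.
have l4 : l ^+ 4 <= eta / 16 * g ^+ 2.
  have -> : l ^+ 4 = l ^+ 2 * l ^+ 2 by ring.
  apply: (@le_trans _ _ (l ^+ 2 * ((C + 2) ^+ 2 * g ^+ 2))); first by rewrite ler_wpM2l ?sqr_ge0.
  rewrite mulrA ler_wpM2r //.
  have -> : l ^+ 2 * (C + 2) ^+ 2 = l / 4 * (l * (4 * (C + 2) ^+ 2)) by field.
  apply: (@le_trans _ _ (l / 4 * eta)); first by rewrite ler_wpM2l // divr_ge0 ?(ltW l0).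
  rewrite -subr_ge0; have -> : eta / 16 - l / 4 * eta = eta * (1 / 16 - l / 4) by field.
  by rewrite mulr_ge0 ?(ltW eta0) //; clear -ld' eta1; lra.
have t : l ^+ 2 * rho ^+ 2 / 2 <= l ^+ 4 / 2 + (rho - l) * l ^+ 2.
  have : 0 <= l ^+ 2 * (rho - l) * (2 - rho - l).
    apply: mulr_ge0; first by rewrite mulr_ge0 ?sqr_ge0 // subr_ge0.
    by clear -rho1 l_rho; lra.
  clear; lra.
have p := mulr_ge0 (ltW eta0) g20.
rewrite /score; move: h t l4 p; move: (\sum_a _) (ln _) (l ^+ 4) => a b c; clear; lra.
Qed.

(** The second moment of the log-kernel is of the same order as the score,
    which makes lower deviations of order [score] exponentially unlikely. *)
Lemma sqr_ln_kern_le (R : realType) (eta C q rho l : R) (r := q * (1 - q)) :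
  0 < eta < 1 -> 6 <= C -> 0 < q < 1 -> 0 < rho <= 1 -> 0 < l <= rho ->
  l <= C * r -> l * (4 * (C + 2) ^+ 2) <= eta ->
  \sum_a \sum_b corr_law q rho a b * ln (kern q l a b) ^+ 2 <=
  (4 * (1 + C) * (C + 2) ^+ 2 + 8 * C * (1 + C)) * score q rho l.
Proof.
move=> eta01 C6 qq rr ll lC ld.
have /andP[rho0 rho1] := rr; have /andP[l0 l_rho] := ll.
have := score_ge eta01 C6 qq rho1 ll lC ld; move: eta01 => /andP[eta0 eta1].
have /andP[q0 q1] := qq; have q1' : 0 < 1 - q by lra.
have r0 : 0 < r by rewrite mulr_gt0.
rewrite -/r; set g := Num.sqrt (r ^+ 2 + l * r) - r; set X := _ - l ^+ 2 => e_ge.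
have [g0 gE] := gap0_root (ltW r0) (ltW l0); rewrite -/g in g0 gE.
have C0 : 0 <= C by lra.
have C1 : 0 < 1 + C by lra.
have gl := root_ge C0 r0 l0 lC g0 gE.
have g20 := sqr_ge0 g.
have lC1 : l * (2 * (1 + C)) <= 1.
  apply: (@le_trans _ _ (l * (4 * (C + 2) ^+ 2))); last by apply: le_trans ld (ltW eta1).
  by rewrite ler_pM2l //; clear -C0; nra.
have X1 : l / (2 * (1 + C)) <= X := log_gain_ge C0 r0 l0 lC lC1.
have l2 : 0 <= l <= 2^-1.
  rewrite ltW //=; have : 2 <= 2 * (1 + C) by lra.
  by move=> h; have := ler_wpM2l (ltW l0) h; clear -lC1; lra.
apply: (@le_trans _ _ (4 * (l ^+ 2 * (1 + rho / r)))).
  apply: le_trans (ler_wpM2l _ (mean_sqr_kernB1 l qq (ltW rho0))); last by [].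
  rewrite mulr_sumr; apply: ler_sum => a _; rewrite mulr_sumr; apply: ler_sum => b _.
  rewrite [leRHS]mulrCA; apply: ler_wpM2l; first by apply: corr_law_ge0 => //; rewrite ltW.
  by have /andP[k1 k2] := kern_bounds a b qq l2 C0 lC; rewrite ln_sqr_le.
have -> : 4 * (l ^+ 2 * (1 + rho / r)) = 4 * (1 + l / r) * l ^+ 2 + 4 * l * (l / r) * (rho - l).
  by field; rewrite gt_eqF.
have uC : l / r <= C by rewrite ler_pdivrMr.
have X0 : 0 <= X by apply: le_trans X1; rewrite divr_ge0 ?(ltW l0) // mulr_ge0 // ltW.
have t1 : 4 * (1 + l / r) * l ^+ 2 <= 4 * (1 + C) * ((C + 2) ^+ 2 * g ^+ 2).
  apply: ler_pM => //; rewrite ?sqr_ge0 //.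
    by rewrite mulr_ge0 // addr_ge0 // divr_ge0 // ltW.
  by rewrite ler_pM2l // lerD2l.
have t2 : 4 * l * (l / r) * (rho - l) <= 8 * C * (1 + C) * ((rho - l) * X).
  have : 4 * l * (l / r) <= 8 * C * (1 + C) * X.
    apply: (@le_trans _ _ (4 * l * C)); first by rewrite ler_pM2l // mulr_gt0.
    have : 8 * C * (1 + C) * (l / (2 * (1 + C))) <= 8 * C * (1 + C) * X.
      by rewrite ler_wpM2l // !mulr_ge0 // ltW.
    have -> // : 8 * C * (1 + C) * (l / (2 * (1 + C))) = 4 * l * C by field; rewrite gt_eqF.
  move=> h; have d1 : 0 <= rho - l by rewrite subr_ge0.
  have -> : 8 * C * (1 + C) * ((rho - l) * X) = 8 * C * (1 + C) * X * (rho - l) by clearbody X; ring.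
  by have := ler_wpM2r d1 h.
have d0 : 0 <= (rho - l) * X by rewrite mulr_ge0 // subr_ge0.
have gg : g ^+ 2 <= (2 - eta / 2) * g ^+ 2 by rewrite ler_peMl //; clear -eta1; lra.
rewrite [leRHS]mulrDl; apply: lerD.
  apply: le_trans t1 _; rewrite mulrA ler_wpM2l //.
    by rewrite mulr_ge0 ?sqr_ge0 // mulr_ge0 // ltW.
  by clear -gg d0 e_ge; lra.
apply: le_trans t2 _; rewrite ler_wpM2l //; first by rewrite !mulr_ge0 // ltW.
have g2 : 0 <= (2 - eta / 2) * g ^+ 2 by apply: le_trans gg.
by clear -g2 e_ge; lra.
Qed.

(** Replacing the true correlation by the smaller [l] is harmless for the
    comparison with the squared gap: the gap is Lipschitz in the correlation
    and the logarithmic term of the score grows faster once [ln (1 + C)]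
    exceeds [5]. *)
Lemma score_ge_gap (R : realType) (eta C q rho l : R) (r := q * (1 - q)) :
  0 < eta < 1 -> 6 <= C -> 5 <= ln (1 + C) -> 0 < q < 1 -> rho <= 1 -> 0 < l <= rho ->
  l <= C * r -> l * (4 * (C + 2) ^+ 2) <= eta ->
  l = rho \/ l = C * r ->
  2 * (1 - eta) * gap r rho ^+ 2 <= score q rho l.
Proof.
move=> eta01 C6 lnC qq rho1 ll lC ld hl.
apply: le_trans (score_ge eta01 C6 qq rho1 ll lC ld); move: eta01 ll => /andP[eta0 eta1] /andP[l0 l_rho].
have /andP[q0 q1] := qq; have q1' : 0 < 1 - q by lra.
have r0 : 0 < r by rewrite mulr_gt0.
have r4 : r <= 4^-1 by rewrite /r; have := sqr_ge0 (2 * q - 1); clear; nra.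
rewrite -/r; set g := Num.sqrt (r ^+ 2 + l * r) - r; set X := _ - l ^+ 2.
have [g0 gE] := gap0_root (ltW r0) (ltW l0); rewrite -/g in g0 gE.
have gap0 := gap_ge0 (ltW r0) (ltW l0).
have gapE := gap_root (ltW r0) (ltW l0).
have C0 : 0 <= C by lra.
have c2 : 64 <= (C + 2) ^+ 2 by clear -C6; nra.
have ld4 : l * 4 <= eta.
  by apply: le_trans ld; rewrite ler_pM2l //; clear -c2; lra.
have l1 : 0 <= 1 - l by clear -ld4 eta1; lra.
have lC1 : l * C <= 1.
  apply: (@le_trans _ _ (l * (4 * (C + 2) ^+ 2))); last by apply: le_trans ld (ltW eta1).
  by rewrite ler_pM2l //; clear -C0; nra.
have hg : (1 - l) * gap r l <= g.
  rewrite leNgt; apply/negP => h.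
  have k1 : g ^+ 2 <= ((1 - l) * gap r l) ^+ 2 by rewrite ler_sqr ?nnegrE ?mulr_ge0 // ltW.
  have k2 : 2 * r * g < 2 * r * ((1 - l) * gap r l) by rewrite ltr_pM2l // mulr_gt0.
  have k3 : ((1 - l) * gap r l) ^+ 2 <= gap r l ^+ 2.
    by rewrite ler_sqr ?nnegrE ?mulr_ge0 // ler_piMl // gerBl ltW.
  by clear -k1 k2 k3 gapE gE; lra.
have hg2 : (1 - eta / 2) * gap r l ^+ 2 <= g ^+ 2.
  apply: (@le_trans _ _ (((1 - l) * gap r l) ^+ 2)); last by rewrite ler_sqr ?nnegrE ?mulr_ge0.
  by rewrite exprMn ler_wpM2r ?sqr_ge0 //; have := sqr_ge0 l; clear -ld4; lra.
have lip : gap r rho ^+ 2 <= gap r l ^+ 2 + 2 * r * (rho - l).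
  by apply: gap_sqr_lipschitz => //; rewrite ?(ltW r0) ?(ltW l0).
have hX : 4 * r * (rho - l) <= (rho - l) * X.
  case: hl => [->|lE]; first by rewrite subrr mulr0 mul0r.
  rewrite mulrC ler_wpM2l ?subr_ge0 // /X.
  have -> : l / r = C by rewrite lE mulfK // gt_eqF.
  have l2r : l ^+ 2 <= r by rewrite expr2 {2}lE mulrA ler_piMl ?(ltW r0).
  have := ler_wpM2l (ltW r0) lnC; clear -l2r; lra.
have k4 : (2 - eta / 2) * ((1 - eta / 2) * gap r l ^+ 2) <= (2 - eta / 2) * g ^+ 2.
  by rewrite ler_wpM2l //; clear -eta1; lra.
have k5 : 2 * (1 - eta) * gap r l ^+ 2 <= (2 - eta / 2) * ((1 - eta / 2) * gap r l ^+ 2).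
  by rewrite mulrA ler_wpM2r ?sqr_ge0 //; have := sqr_ge0 eta; clear -eta0; lra.
have k6 : 2 * (1 - eta) * gap r rho ^+ 2 <= 2 * (1 - eta) * (gap r l ^+ 2 + 2 * r * (rho - l)).
  by rewrite ler_wpM2l //; clear -eta1; lra.
have k7 : 0 <= r * (rho - l) * eta by rewrite !mulr_ge0 ?subr_ge0 // ltW.
by clearbody X g; clear -k4 k5 k6 k7 hX; lra.
Qed.

(** With the likelihood ratio of a correlation [l] possibly smaller than
    [rho] as score, the rate [e] is nearly twice the squared gap or bounded
    below. Three constraints limit [l]: it does not exceed the true
    correlation, it keeps the kernel bounded ([l <= C * r]), and it stays below
    a constant [delta] so that fourth-order terms are negligible; only when the
    last one is active is the rate compared with a constant. *)
Lemma entropy_rate (R : realType) (eta : R) : 0 < eta < 1 ->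
  exists th c e0 : R, [/\ 0 < th, 0 < c, 0 < e0 & forall q rho : R,
    0 < q < 1 -> 0 < rho <= 1 -> exists l m e : R,
    [/\ 0 <= l <= 2^-1,
        \sum_a \sum_b corr_law q rho a b * expR (- (th * ln (kern q l a b))) <=
          expR (- (th * m) - c * e),
        m - l ^+ 2 * rho ^+ 2 / 2 = (1 - eta) * e &
        Num.min (2 * (1 - eta) * gap (q * (1 - q)) rho ^+ 2) e0 <= e]].
Proof.
move=> eta01; have /andP[eta0 eta1] := eta01.
have [C C6 lnC] : exists2 C : R, 6 <= C & 5 <= ln (1 + C).
  have C6 : 1 + 5 <= expR 5 :> R := expR_ge1Dx _.
  exists (expR 5); first by clear -C6; lra.
  by rewrite -[leLHS]expRK ler_ln ?posrE ?addr_gt0 ?expR_gt0 //; clear; lra.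
have C0 : 0 <= C by lra.
have C1 : 0 < 1 + C by lra.
have c2 : 0 < 4 * (C + 2) ^+ 2 by rewrite mulr_gt0 // exprn_gt0 //; lra.
pose delta := eta / (4 * (C + 2) ^+ 2).
pose CV := 4 * (1 + C) * (C + 2) ^+ 2 + 8 * C * (1 + C).
have CV1 : (1 + C) * 2 <= 4 * CV by rewrite /CV; clear -C6; nra.
have CV0 : 0 < CV by clear -CV1 C1; lra.
have delta0 : 0 < delta by rewrite divr_gt0.
have deltaE : delta * (4 * (C + 2) ^+ 2) = eta by rewrite divfK // gt_eqF.
pose th := eta / (4 * CV).
have th0 : 0 < th by rewrite divr_gt0 // mulr_gt0.
have thE : th * (4 * CV) = eta by rewrite divfK // gt_eqF // mulr_gt0.
have thC : th * (1 + C) <= 2^-1.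
  by have := ler_wpM2l (ltW th0) CV1; rewrite thE; clear -eta1; lra.
exists th, (th * eta / 2), (delta ^+ 2 / (C + 2) ^+ 2); split.
- exact: th0.
- by rewrite divr_gt0 // mulr_gt0.
- by rewrite divr_gt0 ?exprn_gt0 //; lra.
move=> q rho qq rr; have /andP[q0 q1] := qq; have /andP[rho0 rho1] := rr.
have q1' : 0 < 1 - q by lra.
set r := q * (1 - q); have r0 : 0 < r by rewrite mulr_gt0.
pose l := Num.min rho (Num.min (C * r) delta).
have [l_rho l_C l_d] : [/\ l <= rho, l <= C * r & l <= delta].
  by rewrite /l; split; rewrite !ge_min ?lexx ?orbT.
have l0 : 0 < l by rewrite !lt_min rho0 delta0 mulr_gt0 //; lra.
have hl : l = rho \/ l = C * r \/ l = delta.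
  rewrite /l /Num.min; case: ifP => _; first by left.
  by case: ifP => _; [right; left|right; right].
clearbody l.
have ll : 0 < l <= rho by rewrite l0.
have ld : l * (4 * (C + 2) ^+ 2) <= eta by rewrite -deltaE ler_pM2r.
have l2 : 0 <= l <= 2^-1.
  rewrite ltW //=; have : 2 <= 4 * (C + 2) ^+ 2 by clear -C6; nra.
  by move=> h; have := ler_wpM2l (ltW l0) h; clear -ld eta1; lra.
pose mu := \sum_a \sum_b corr_law q rho a b * ln (kern q l a b).
pose e := score q rho l.
have eV : \sum_a \sum_b corr_law q rho a b * ln (kern q l a b) ^+ 2 <= CV * e
  := sqr_ln_kern_le eta01 C6 qq rr ll l_C ld.
have muE : mu = e + l ^+ 2 * rho ^+ 2 / 2 by rewrite /e /score -/mu; ring.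
exists l, (mu - eta * e), e; split => //.
- apply: le_trans (expR_sum_le _ _ _) _.
  + by move=> a b; apply: corr_law_ge0 => //; rewrite ltW.
  + exact: corr_law_sum.
  + move=> a b; have /andP[k1 k2] := kern_bounds a b qq l2 C0 l_C.
    have k0 : 0 < kern q l a b by apply: lt_le_trans k1.
    have : (kern q l a b)^-1 <= 2 by rewrite -[leRHS]invrK lef_pV2 ?posrE.
    have := ln_ge1BV k0; move: (ln _) (_^-1) => x y h1 h2.
    have h3 : - (1 + C) <= x by clear -h1 h2 C0; lra.
    by have := ler_wpM2l (ltW th0) h3; clear -thC; lra.
  rewrite ler_expR -/mu; move: eV; move: (\sum_a _) => V VC.
  have t2 : 0 <= 2 * th ^+ 2 by rewrite mulr_ge0 ?sqr_ge0.
  have := ler_wpM2l t2 VC.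
  have -> : 2 * th ^+ 2 * (CV * e) = th * e * (th * (4 * CV)) / 2 by field.
  by rewrite thE; clear; lra.
- by rewrite muE; clear; ring.
rewrite ge_min; apply/orP; case: hl => [h|[h|h]]; [left|left|right].
- by apply: (score_ge_gap eta01 C6 lnC qq rho1 ll l_C ld); left.
- by apply: (score_ge_gap eta01 C6 lnC qq rho1 ll l_C ld); right.
have [g0 gE] := gap0_root (ltW r0) (ltW l0).
apply: le_trans (score_ge eta01 C6 qq rho1 ll l_C ld); rewrite -/r.
have := root_ge C0 r0 l0 l_C g0 gE; move: (_ - r) => g gl.
have X1 : 0 <= r * ln (1 + l / r) - l ^+ 2.
  apply: le_trans (log_gain_ge C0 r0 l0 l_C _).
    by rewrite divr_ge0 ?(ltW l0) // mulr_ge0 // ltW.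
  apply: (@le_trans _ _ (l * (4 * (C + 2) ^+ 2))); last by apply: le_trans ld (ltW eta1).
  by rewrite ler_pM2l //; clear -C0; nra.
apply: (@le_trans _ _ (g ^+ 2)).
  by rewrite ler_pdivrMr ?exprn_gt0 //; [rewrite mulrC -h | lra].
have g20 := sqr_ge0 g.
have : g ^+ 2 <= (2 - eta / 2) * g ^+ 2 by rewrite ler_peMl //; clear -eta1; lra.
have : 0 <= (rho - l) * (r * ln (1 + l / r) - l ^+ 2) by rewrite mulr_ge0 // subr_ge0.
by move: (_ * (_ - _)) => x; clear; lra.
Qed.

(** * Pairwise error probabilities *)

(** Sum over all permutations of the two-state transfer matrix: the eigenvalues
    are real because the off-diagonal entries are positive, and the two
    invariants in the bound are the trace and the trace of the square. *)
Lemma two_state_trace_le (R : realType) (E : finType) (tau : {perm E})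
    (G : bool -> bool -> R) :
  0 <= G false false -> 0 <= G true true -> 0 < G false true -> 0 < G true false ->
  G false true * G true false <= G false false * G true true ->
  let t := G false false + G true true in
  let dt := G false false * G true true - G false true * G true false in
  \sum_(x : {ffun E -> bool}) \prod_e G (x e) (x (tau e)) <=
  \prod_e (if tau e == e then t else Num.sqrt (t ^+ 2 - 2 * dt)).
Proof.
move=> a0 d0 b0 c0 det; cbv zeta.
set a := G false false in a0 det *; set d := G true true in d0 det *.
set b := G false true in b0 det *; set c := G true false in c0 det *.
set dc := (a - d) ^+ 2 + 4 * (b * c).
have dc0 : 0 < dc by rewrite ltr_wpDl ?sqr_ge0 // !mulr_gt0.
set s := Num.sqrt dc.
have s0 : 0 < s by rewrite sqrtr_gt0.
have sE : s ^+ 2 = (a - d) ^+ 2 + 4 * (b * c) by rewrite sqr_sqrtr // ltW.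
pose mu i : R := if i then (a + d - s) / 2 else (a + d + s) / 2.
have s_le : s <= a + d.
  rewrite -(ger0_norm (addr_ge0 a0 d0)) -sqrtr_sqr ler_wsqrtr // /dc; clear -det; lra.
have mu0 i (e : E) : 0 <= mu i by rewrite /mu; case: i; rewrite divr_ge0 //; clear -s_le s0; lra.
have ne i : mu i - mu (~~ i) != 0.
  case: i; rewrite /mu /=.
    by rewrite (_ : _ - _ = - s) ?oppr_eq0 ?gt_eqF //; field.
  by rewrite (_ : _ - _ = s) ?gt_eqF //; field.
have prodmu : mu true * mu false = a * d - b * c.
  rewrite /mu; have -> : (a + d - s) / 2 * ((a + d + s) / 2) = ((a + d) ^+ 2 - s ^+ 2) / 4 by field.
  by rewrite sE; field.
have summu : mu true + mu false = a + d by rewrite /mu; field.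
clearbody mu.
pose g (i x : bool) : R := if x then (mu i - a) / b else 1.
pose f (i x : bool) : R := (if x then b else a - mu (~~ i)) / (mu i - mu (~~ i)).
apply: le_trans (@permuted_product_le R E tau (fun i _ => mu i) f g (fun _ => G) mu0 _ _) _.
- move=> i j; rewrite big_bool /g /f.
  have nt := ne true; have nf := ne false; move: nt nf.
  case: i; case: j => /=; move: (mu true) (mu false) => m m' nt nf; field;
    by rewrite ?nt ?nf ?(gt_eqF b0).
- move=> _ x x'; rewrite big_bool /g /f.
  have nt := ne true; move: nt prodmu summu; rewrite /=; move: (mu true) (mu false) => m m' nt pm sm.
  have m'E : m' = a + d - m by rewrite -sm; ring.
  have nm : m' - m != 0 by rewrite -opprB oppr_eq0.
  have cE : c = (a * d - m * m') / b by rewrite pm; field; rewrite gt_eqF.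
  case: x; case: x'; rewrite -?/a -?/b -?/c -?/d ?cE; move: nt nm; rewrite m'E => nt nm;
    by field; rewrite ?nt ?nm ?(gt_eqF b0).
rewrite le_eqVlt; apply/orP; left; apply/eqP; apply: eq_bigr => e _.
rewrite [mu false + _]addrC summu; congr (if _ then _ else Num.sqrt _).
have -> : mu false ^+ 2 + mu true ^+ 2 = (mu true + mu false) ^+ 2 - 2 * (mu true * mu false) by ring.
by rewrite summu prodmu.
Qed.

Lemma prod_if_cst (R : realType) (E : finType) (P : pred E) (u : R) :
  \prod_e (if P e then 1 else u) = u ^+ #|[set e | ~~ P e]%SET|.
Proof.
rewrite (bigID P) /= big1 => [|e ->//]; rewrite mul1r.
rewrite (eq_bigr (fun=> u)) => [|e /negPf ->//].
by rewrite big_const -Monoid.iteropE -/(_ ^+ _) cardsE.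
Qed.

Lemma sqrt_le_expR (R : realType) (x : R) : Num.sqrt (1 - 2 * x) <= expR (- x).
Proof.
rewrite -[leRHS]ger0_norm ?expR_ge0 // -sqrtr_sqr ler_wsqrtr // -expRM_natl.
by apply: le_trans (expR_ge1Dx _); rewrite mulrN.
Qed.

(** The Chernoff bound with the base [w]: the transfer matrix has trace [1]
    and the determinant displayed in the exponent. *)
Lemma pairwise_error_le (R : realType) (n : nat) (p : bool -> bool -> R) (w : R) (tau : 'S_n) :
  law p -> p true false = p false true -> 0 < w ->
  let D := (p false false * p true true / w - p false true ^+ 2) * (w - 1) in
  0 < p false false -> 0 < p true true -> 0 <= D -> 1 <= w ->
  mean p (fun x y : adjvec n => (inner x y <= inner (relabel tau x) y)%N%:R) <=
  expR (- D * #|moved_edges tau|%:R).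
Proof.
move=> lp pC w0 D p00 p11 D0 w1; have [p0 p1] := lp.
pose wt (a b : bool) : R := if a && b then w else 1.
have wt0 a b : 0 < wt a b by rewrite /wt; case: ifP.
have wtE (x y : adjvec n) : \prod_e wt (x e) (y e) = w ^+ inner x y.
  by rewrite /inner -prodrXr; apply: eq_bigr => e _; rewrite /wt; case: (x e) (y e) => [] [].
apply: (@le_trans _ _ (mean p (fun x y : adjvec n =>
   \prod_e (wt (x (eperm tau e)) (y e) / wt (x e) (y e))))).
  apply: ler_mean => // x y; rewrite prodf_div wtE.
  have -> : \prod_e wt (x (eperm tau e)) (y e) = w ^+ inner (relabel tau x) y.
    by rewrite -wtE; apply: eq_bigr => e _; rewrite relabelE.
  rewrite ler_pdivlMr ?exprn_gt0 //; case: leqP => h; last by rewrite mul0r exprn_ge0 // ltW.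
  by rewrite mul1r ler_weXn2l.
pose G (a a' : bool) := \sum_b p a b * (wt a' b / wt a b).
have -> : mean p (fun x y : adjvec n => \prod_e (wt (x (eperm tau e)) (y e) / wt (x e) (y e))) =
   \sum_(x : adjvec n) \prod_e G (x e) (x (eperm tau e)).
  apply: eq_bigr => x _; rewrite bigA_distr_bigA /=; apply: eq_bigr => y _.
  by rewrite /mass -big_split.
have p01 := p0 false true.
have wn : w != 0 by rewrite gt_eqF.
have Gs : [/\ G false false = p false false + p false true, G true true = p false true + p true true,
   G false true = p false false + p false true * w & G true false = p false true + p true true / w].
  by rewrite /G !big_bool /wt /= pC; split; field.
have p1' : p false false + p true true = 1 - 2 * p false true.
  by move: p1; rewrite big_bool2 pC; clear; lra.
have [G1 G2 G3 G4] := Gs.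
have detE : G false false * G true true - G false true * G true false = D.
  by rewrite G1 G2 G3 G4 /D; field.
apply: le_trans (two_state_trace_le _ _ _ _ _ _) _.
- by rewrite G1 addr_ge0 // ltW.
- by rewrite G2 addr_ge0 // ltW.
- by rewrite G3 ltr_wpDr // mulr_ge0 // ltW.
- by rewrite G4 ltr_wpDl // divr_gt0.
- by rewrite -subr_ge0 detE.
cbv zeta; rewrite detE.
have -> : G false false + G true true = 1 by rewrite G1 G2; lra.
rewrite expr1n prod_if_cst [- D * _]mulrC expRM_natl lerXn2r ?nnegrE ?sqrtr_ge0 ?expR_ge0 //.
exact: sqrt_le_expR.
Qed.

(** The maximizer of the right-hand side is [A / b]; when [b = 0] the supremum
    is not attained and is approached as [w] grows. *)
Lemma chernoff_base (R : realType) (eta A b : R) : 0 < eta < 1 -> 0 <= b < A ->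
  exists2 w : R, 1 <= w & (1 - eta) * (A - b) ^+ 2 <= (A ^+ 2 / w - b ^+ 2) * (w - 1).
Proof.
move=> /andP[eta0 eta1] /andP[b0 bA]; have A0 : 0 < A by lra.
have [b0'|bn] := eqVneq b 0.
  exists eta^-1; first by rewrite invf_ge1 // ltW.
  rewrite b0' subr0 expr0n /= subr0 invrK.
  by rewrite le_eqVlt; apply/orP; left; apply/eqP; field; rewrite gt_eqF.
have {}b0 : 0 < b by rewrite lt_def bn.
exists (A / b); first by rewrite ler_pdivlMr // mul1r ltW.
have -> : (A ^+ 2 / (A / b) - b ^+ 2) * (A / b - 1) = (A - b) ^+ 2.
  by field; rewrite !gt_eqF.
by rewrite ler_piMl ?sqr_ge0 //; lra.
Qed.

(** At most [n ^ k] permutations move exactly [k] points. *)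
Lemma sum_moved_le (R : realType) (n : nat) (z : R) : 0 <= z -> n%:R * z <= 2^-1 ->
  \sum_(tau : 'S_n | tau != 1%g) z ^+ #|moved tau| <= 2 * (n%:R * z).
Proof.
move=> z0 nz.
have moved0 (tau : 'S_n) : tau != 1%g -> moved tau != finset.set0.
  apply: contra_neq => /setP m0; apply/permP => i; rewrite perm1.
  by have := m0 i; rewrite !inE => /negbFE/eqP.
rewrite (partition_big (@moved n) (fun M => M != finset.set0)) //=.
apply: (@le_trans _ _ (\sum_(M : {set 'I_n} | M != finset.set0) (#|M| `!)%:R * z ^+ #|M|)).
  apply: ler_sum => M M0.
  rewrite (eq_bigr (fun=> z ^+ #|M|)) => [|tau /andP[_ /eqP ->]//].
  rewrite sumr_const -[leLHS]mulr_natl ler_wpM2r ?exprn_ge0 // ler_nat -card_perm.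
  apply: subset_leq_card; apply/fintype.subsetP => tau; rewrite !unfold_in => /andP[_ /eqP <-].
  by apply/fintype.subsetP => i; rewrite !inE.
rewrite (partition_big (fun M : {set 'I_n} => inord #|M| : 'I_n.+1) (fun k => k != ord0)) /=; last first.
  move=> M M0; rewrite -val_eqE /= inordK ?cards_eq0 // ltnS.
  by have := max_card (mem M); rewrite card_ord.
apply: (@le_trans _ _ (\sum_(k < n.+1 | k != ord0) (n%:R * z) ^+ k)).
  apply: ler_sum => k k0.
  have cM (M : {set 'I_n}) : (inord #|M| == k) = (#|M| == k).
    rewrite -val_eqE /= inordK // ltnS.
    by have := max_card (mem M); rewrite card_ord.
  rewrite (eq_bigr (fun=> (k`!)%:R * z ^+ k)) => [|M /andP[_]]; last by rewrite cM => /eqP ->.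
  rewrite sumr_const -[leLHS]mulr_natl mulrA exprMn ler_wpM2r ?exprn_ge0 // -natrM -natrX ler_nat.
  apply: (@leq_trans ('C(n, k) * k`!)).
    rewrite leq_mul2r; apply/orP; right.
    have := card_draws 'I_n k; rewrite card_ord => <-.
    apply: subset_leq_card; apply/fintype.subsetP => M; rewrite unfold_in => /andP[_].
    by rewrite cM inE.
  rewrite bin_ffact ffact_prod.
  have -> : (n ^ k = \prod_(i < k) n)%N by rewrite prod_nat_const card_ord.
  by apply: leq_prod => i _; rewrite leq_subr.
rewrite big_mkcond big_ord_recl /= add0r.
have {nz z0} : 0 <= n%:R * z <= 2^-1 by rewrite nz mulr_ge0.
move: (n%:R * z) => y /andP[y0 y2].
suff : forall m, \sum_(i < m) y ^+ i.+1 <= 2 * y.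
  by move=> h; apply: le_trans (h n); rewrite le_eqVlt; apply/orP; left; apply/eqP; apply: eq_bigr.
elim=> [|m IH]; first by rewrite big_ord0 mulr_ge0.
rewrite big_ord_recl expr1.
under eq_bigr => i _ do rewrite /= /bump /= add1n exprS.
by rewrite -mulr_sumr; have := ler_wpM2l y0 IH; nra.
Qed.

(** * Errors of large support *)

Lemma law_corr (R : realType) (q l : R) : 0 < q < 1 -> 0 <= l <= 1 -> law (corr_law q l).
Proof. by move=> qq ll; split=> [a b|]; [exact: corr_law_ge0|exact: corr_law_sum]. Qed.

Lemma ln_kern_affine (R : realType) (q l : R) : 0 < q < 1 -> 0 <= l < 1 ->
  exists u v t : R, 0 <= t /\
    forall a b, ln (kern q l a b) = u + v * a%:R + v * b%:R + t * (a && b)%:R.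
Proof.
move=> qq /andP[l0 l1]; have /andP[q0 q1] := qq; have q1' : 0 < 1 - q by lra.
have [h1 h2 h3 h4] := kernE l qq.
have k1 : 0 < 1 + l * (1 - q) / q by rewrite ltr_wpDr // divr_ge0 ?mulr_ge0 // ltW.
have k2 : 0 < 1 + l * q / (1 - q) by rewrite ltr_wpDr // divr_ge0 ?mulr_ge0 // ltW.
have k3 : 0 < 1 - l by lra.
exists (ln (1 + l * q / (1 - q))), (ln (1 - l) - ln (1 + l * q / (1 - q))),
  (ln (1 + l * (1 - q) / q) + ln (1 + l * q / (1 - q)) - 2 * ln (1 - l)); split.
  have -> : 2 * ln (1 - l) = ln ((1 - l) * (1 - l)) by rewrite lnM ?posrE //; ring.
  rewrite subr_ge0 -lnM ?posrE // ler_ln ?posrE ?mulr_gt0 //.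
  have -> : (1 + l * (1 - q) / q) * (1 + l * q / (1 - q)) = (1 - l) ^+ 2 + l / (q * (1 - q)).
    by field; rewrite !gt_eqF.
  by rewrite expr2 lerDl divr_ge0 // mulr_ge0 // ltW.
by case=> [] []; rewrite ?h1 ?h2 ?h3 ?h4 /=; ring.
Qed.

(** Since the score is affine in each argument up to a multiple of the product,
    and a relabelling preserves the number of edges of each graph, comparing
    total scores amounts to comparing inner products. *)
Lemma inner_le_score (R : realType) (n : nat) (q l : R) (tau : 'S_n) (x y : adjvec n) :
  0 < q < 1 -> 0 <= l < 1 -> (inner x y <= inner (relabel tau x) y)%N ->
  \sum_(e in touches (moved tau)) ln (kern q l (x e) (y e)) <=
  \sum_(e in touches (moved tau)) ln (kern q l (x (eperm tau e)) (y e)).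
Proof.
move=> qq ll xy; have [u [v [t [t0 lnE]]]] := ln_kern_affine qq ll.
have innerE (z : adjvec n) : (inner z y)%:R = \sum_e (z e && y e)%:R :> R.
  by rewrite /inner natr_sum; apply: eq_bigr => e _; case: (z e) (y e) => [] [].
have all : \sum_e ln (kern q l (x (eperm tau e)) (y e)) - \sum_e ln (kern q l (x e) (y e)) =
    t * ((inner (relabel tau x) y)%:R - (inner x y)%:R).
  have tr : \sum_e v * (x (eperm tau e))%:R = \sum_e v * (x e)%:R :> R.
    by rewrite [RHS](reindex_inj (@perm_inj _ (eperm tau))).
  rewrite !innerE !(eq_bigr _ (fun e _ => lnE _ _)) !big_split /= tr.
  rewrite -!mulr_sumr.
  have -> : \sum_e (relabel tau x e && y e)%:R = \sum_e (x (eperm tau e) && y e)%:R :> R.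
    by apply: eq_bigr => e _; rewrite relabelE.
  ring.
rewrite -subr_ge0.
have out (f : vpair n -> R) : \sum_e f e = \sum_(e in touches (moved tau)) f e +
    \sum_(e | e \notin touches (moved tau)) f e by rewrite (bigID (mem (touches (moved tau)))).
move: all; rewrite !out.
rewrite [X in _ + X - _](eq_bigr (fun e => ln (kern q l (x e) (y e)))); last first.
  move=> e eM; have : e \notin moved_edges tau.
    by apply: contra eM; apply: (fintype.subsetP (moved_edges_touch tau)).
  by rewrite inE negbK => /eqP ->.
rewrite opprD addrACA subrr addr0 => ->.
by rewrite mulr_ge0 // subr_ge0 ler_nat.
Qed.

Lemma prod_set_cst (R : realType) (E : finType) (T : {set E}) (u : R) :
  \prod_e (if e \in T then u else 1) = u ^+ #|T|.
Proof. by rewrite -big_mkcond prodr_const. Qed.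

(** The exponential Markov inequality, the scores of distinct edges being
    independent. *)
Lemma low_score_le (R : realType) (E : finType) (p K : bool -> bool -> R)
    (T : {set E}) (th m c : R) :
  law p -> 0 <= th ->
  \sum_a \sum_b p a b * expR (- (th * ln (K a b))) <= expR (- (th * m) - c) ->
  mean p (fun x y : {ffun E -> bool} =>
    ((\sum_(e in T) ln (K (x e) (y e)) <= m * #|T|%:R)%R)%:R) <= expR (- c * #|T|%:R).
Proof.
move=> lp th0 hK; have [p0 p1] := lp.
pose k (e : E) (a b : bool) := if e \in T then expR (th * m - th * ln (K a b)) else 1 : R.
apply: (@le_trans _ _ (mean p (fun x y => \prod_e k e (x e) (y e)))).
  apply: ler_mean => // x y.
  rewrite -big_mkcond /= -expR_sum.
  have -> : \sum_(e in T) (th * m - th * ln (K (x e) (y e))) =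
      th * (m * #|T|%:R - \sum_(e in T) ln (K (x e) (y e))).
    by rewrite sumrB sumr_const -mulr_sumr -mulr_natr; ring.
  case: (leP (\sum_(e in T) _)) => h; last by rewrite mulr0n expR_ge0.
  by apply: le_trans (expR_ge1Dx _); rewrite lerDl mulr_ge0 // subr_ge0.
rewrite mean_prod.
rewrite (eq_bigr (fun e => if e \in T then expR (th * m) *
    (\sum_a \sum_b p a b * expR (- (th * ln (K a b)))) else 1)); last first.
  move=> e _; rewrite /k; case: ifP => _; last first.
    by rewrite -[RHS]p1; apply: eq_bigr => a _; apply: eq_bigr => b _; rewrite mulr1.
  rewrite mulr_sumr; apply: eq_bigr => a _; rewrite mulr_sumr; apply: eq_bigr => b _.
  by rewrite expRD mulrCA.
rewrite prod_set_cst [- c * _]mulrC expRM_natl lerXn2r ?nnegrE ?expR_ge0 //.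
  rewrite mulr_ge0 ?expR_ge0 //; apply: sumr_ge0 => a _; apply: sumr_ge0 => b _.
  by rewrite mulr_ge0 ?expR_ge0.
apply: le_trans (ler_wpM2l (expR_ge0 _) hK) _.
by rewrite -expRD addrA subrr add0r.
Qed.

(** The transfer matrix of the score has eigenvalues [1] and [l * rho] on the
    touched edges. *)
Lemma high_score_le (R : realType) (n : nat) (q rho l m : R) (tau : 'S_n) :
  0 < q < 1 -> 0 < rho <= 1 -> 0 <= l <= 2^-1 ->
  let T := touches (moved tau) in
  mean (corr_law q rho) (fun x y : adjvec n =>
    ((m * #|T|%:R <= \sum_(e in T) ln (kern q l (x (eperm tau e)) (y e)))%R)%:R) <=
  2 ^+ #|moved tau| * expR (- (m - l ^+ 2 * rho ^+ 2 / 2) * #|T|%:R).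
Proof.
move=> qq /andP[rho0 rho1] /andP[l0 l2]; cbv zeta; set T := touches (moved tau); have /andP[q0 q1] := qq.
have q1' : 0 < 1 - q by lra.
have lp : law (corr_law q rho) by apply: law_corr => //; rewrite ltW.
have K0 a b : 0 < kern q l a b.
  have [h1 h2 h3 h4] := kernE l qq.
  case: a b => [] []; rewrite ?h1 ?h2 ?h3 ?h4; try (clear -l2; lra);
  by rewrite ltr_wpDr // divr_ge0 ?mulr_ge0 // ltW.
pose k (e : vpair n) a b := if e \in T then kern q l a b else 1.
apply: (@le_trans _ _ (mean (corr_law q rho) (fun x y : adjvec n =>
   expR (- m * #|T|%:R) * \prod_e k e (x (eperm tau e)) (y e)))).
  apply: ler_mean => // x y; rewrite -big_mkcond /=.
  have -> : \prod_(e in T) kern q l (x (eperm tau e)) (y e) =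
      expR (\sum_(e in T) ln (kern q l (x (eperm tau e)) (y e))).
    by rewrite expR_sum; apply: eq_bigr => e _; rewrite lnK // posrE.
  rewrite -expRD mulNr.
  case: (leP (m * _)) => h; last by rewrite mulr0n expR_ge0.
  by apply: le_trans (expR_ge1Dx _); rewrite lerDl addrC subr_ge0.
rewrite meanZ.
pose le_ (e : vpair n) : R := if e \in T then l else 0.
pose G (e : vpair n) (a a' : bool) : R := \sum_b corr_law q rho a b * k e a' b.
have -> : mean (corr_law q rho) (fun x y : adjvec n => \prod_e k e (x (eperm tau e)) (y e)) =
   \sum_(x : adjvec n) \prod_e G e (x e) (x (eperm tau e)).
  apply: eq_bigr => x _; rewrite bigA_distr_bigA /=; apply: eq_bigr => y _.
  by rewrite /mass -big_split.
pose mu (i : bool) e : R := if i then rho * le_ e else 1.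
pose g (i a : bool) : R := if i then marg q a * dev q a else marg q a.
pose f (i a : bool) : R := if i then dev q a / (q * (1 - q)) else 1.
have le0 e : 0 <= le_ e by rewrite /le_; case: ifP.
have tr : \sum_(x : adjvec n) \prod_e G e (x e) (x (eperm tau e)) <=
   \prod_e (if eperm tau e == e then mu false e + mu true e
           else Num.sqrt (mu false e ^+ 2 + mu true e ^+ 2)).
  apply: (@permuted_product_le R _ (eperm tau) mu f g G).
  - by case=> e //=; rewrite mulr_ge0 // ltW.
  - by case=> [] []; rewrite big_bool /g /f /marg /dev /=; field; rewrite ?gt_eqF.
  - move=> e a a'; rewrite /G !big_bool /corr_law /k /mu /le_ /g /f.
    by case: ifP => _; rewrite /kern; case: a; case: a'; rewrite /marg /dev /=; field; rewrite ?gt_eqF.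
apply: le_trans (ler_wpM2l (expR_ge0 _) tr) _.
set s2 := l ^+ 2 * rho ^+ 2 / 2.
have s20 : 0 <= s2 by rewrite divr_ge0 // mulr_ge0 ?sqr_ge0.
have bound e : (if eperm tau e == e then mu false e + mu true e
           else Num.sqrt (mu false e ^+ 2 + mu true e ^+ 2)) <=
    (if (e \in T) && (e \notin moved_edges tau) then 2 else 1) *
    (if e \in T then expR s2 else 1).
  have -> : (e \notin moved_edges tau) = (eperm tau e == e) by rewrite inE negbK.
  case: ifP => fe; rewrite /mu /le_.
    case: ifP => eT; rewrite ?mulr0 ?addr0 ?mulr1 //=.
    have r2 : rho * l <= 1 by rewrite -[leRHS]mulr1; apply: ler_pM; rewrite ?(ltW rho0) //; clear -l2; lra.
    apply: (@le_trans _ _ 2); first by clear -r2; lra.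
    by rewrite ler_peMr // -[leLHS]expR0 ler_expR.
  rewrite andbF mul1r; case: ifP => eT; last by rewrite mulr0 expr0n addr0 expr1n sqrtr1.
  rewrite -[leRHS]ger0_norm ?expR_ge0 // -sqrtr_sqr ler_wsqrtr // -expRM_natl.
  by apply: le_trans (expR_ge1Dx _); rewrite expr1n exprMn /s2 le_eqVlt; apply/orP; left; apply/eqP; field.
have bound0 e : 0 <= (if eperm tau e == e then mu false e + mu true e
           else Num.sqrt (mu false e ^+ 2 + mu true e ^+ 2)).
  by case: ifP => _; rewrite ?sqrtr_ge0 // addr_ge0 // /mu mulr_ge0 // ltW.
apply: (@le_trans _ _ (expR (- m * #|T|%:R) * (2 ^+ #|moved tau| * expR s2 ^+ #|T|))).
  rewrite ler_wpM2l ?expR_ge0 //.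
  apply: (@le_trans _ _ (\prod_e ((if (e \in T) && (e \notin moved_edges tau) then 2 else 1) *
    (if e \in T then expR s2 else 1)))).
    by apply: ler_prod => e _; rewrite bound0 bound.
  rewrite big_split /= prod_set_cst ler_wpM2r ?exprn_ge0 ?expR_ge0 //.
  rewrite (eq_bigr (fun e => if e \in T :\: moved_edges tau then 2 else 1 : R)); last first.
    by move=> e _; rewrite finset.in_setD andbC.
  rewrite prod_set_cst; apply: ler_weXn2l; first by clear; lra.
  rewrite cardsD (finset.setIidPr (moved_edges_touch tau)).
  have := card_touches (moved tau); have := card_moved_edges tau; rewrite -/T.
  move: #|T| #|moved_edges tau| #|moved tau| => a b c; nia.
rewrite mulrCA ler_wpM2l ?exprn_ge0 // -expRM_natl -expRD ler_expR le_eqVlt.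
by apply/orP; left; apply/eqP; ring.
Qed.

(** * Achievability *)

(** Ties count as errors, so this event bounds the failure of every maximizer. *)
Definition beaten (n : nat) (x y : adjvec n) : bool :=
  [exists tau : 'S_n, (tau != 1%g) && (inner x y <= inner (relabel tau x) y)%N].

Lemma card_touches_ge (n : nat) (M : {set 'I_n}) : (#|M| * n.-1 <= 2 * #|touches M|)%N.
Proof.
rewrite card_touches; have : (#|M| <= n)%N by have := max_card (mem M); rewrite card_ord.
by move: #|M| => k; nia.
Qed.

(** Union bound: a permutation moving at most [K] points is excluded by the
    pairwise bound; for one moving more points, either the score of the true
    alignment on the edges touching the moved set is low, or the score of the
    wrong alignment is high. *)
Lemma mean_beaten_le (R : realType) (n K : nat) (q rho w th c m l e d : R) :
  0 < q < 1 -> 0 < rho <= 1 -> 0 <= l <= 2^-1 -> 0 <= th -> 0 <= c -> 0 <= e -> 1 <= w ->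
  let p := corr_law q rho in
  let D := (p false false * p true true / w - p false true ^+ 2) * (w - 1) in
  0 <= D ->
  \sum_a \sum_b p a b * expR (- (th * ln (kern q l a b))) <= expR (- (th * m) - c * e) ->
  m - l ^+ 2 * rho ^+ 2 / 2 = d -> 0 <= d ->
  let z1 := expR (- (D * ((2 * n - 2 - K)%N%:R / 2))) in
  let z2 := 2 * expR (- (d * (n.-1%:R / 2))) in
  n%:R * z1 <= 2^-1 -> n%:R * z2 <= 2^-1 ->
  mean p (fun x y : adjvec n => (beaten x y)%:R) <=
  2 * (n%:R * z1) + 2 * (n%:R * z2) + 2 ^+ n * expR (- (c * (K%:R * (e * (n.-1%:R / 2))))).
Proof.
move=> qq rr ll th0 c0 e0 w1 p D D0 hlow md d0 z1 z2 nz1 nz2.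
have /andP[rho0 rho1] := rr; have /andP[q0 q1] := qq; have q1' : 0 < 1 - q by lra.
have lp : law p by apply: law_corr; rewrite // ltW.
have l01 : 0 <= l < 1 by move: ll => /andP[l0 l2]; rewrite l0 /=; clear -l2; lra.
pose lowf (M : {set 'I_n}) (x y : adjvec n) : R :=
  ((\sum_(f in touches M) ln (kern q l (x f) (y f)) <= m * #|touches M|%:R)%R)%:R.
pose highf (tau : 'S_n) (x y : adjvec n) : R :=
  ((m * #|touches (moved tau)|%:R <=
     \sum_(f in touches (moved tau)) ln (kern q l (x (eperm tau f)) (y f)))%R)%:R.
pose pairf (tau : 'S_n) (x y : adjvec n) : R := (inner x y <= inner (relabel tau x) y)%N%:R.
have b01 (b : bool) : 0 <= b%:R :> R by rewrite ler0n.
apply: (@le_trans _ _ (mean p (fun x y : adjvec n =>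
   \sum_(tau : 'S_n | (tau != 1%g) && (#|moved tau| <= K)%N) pairf tau x y +
   (\sum_(tau : 'S_n | tau != 1%g) highf tau x y +
    \sum_(M : {set 'I_n} | (K <= #|M|)%N) lowf M x y)))).
  apply: ler_mean => // x y; case: (boolP (beaten x y)) => [/existsP[tau /andP[t1 ht]]|_]; last first.
    by rewrite !addr_ge0 //; apply: sumr_ge0 => i _; exact: b01.
  have [tK|tK] := leqP #|moved tau| K.
    rewrite (bigD1 tau) /= ?t1 ?tK // /pairf ht -addrA lerDl !addr_ge0 //;
    by apply: sumr_ge0 => i _; exact: b01.
  have := inner_le_score qq l01 ht.
  have [hl _|hl hs] := leP (\sum_(f in touches (moved tau)) ln (kern q l (x f) (y f)))
                        (m * #|touches (moved tau)|%:R).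
    rewrite addrA [X in _ <= _ + X](bigD1 (moved tau)) /= ?(ltnW tK) // /lowf hl.
    rewrite addrCA lerDl !addr_ge0 //; by apply: sumr_ge0 => i _; exact: b01.
  rewrite addrCA (bigD1 tau) //= /highf (ltW (lt_le_trans hl hs)).
  rewrite -addrA lerDl !addr_ge0 //; by apply: sumr_ge0 => i _; exact: b01.
rewrite !meanD !mean_sum -addrA; apply: lerD; last apply: lerD.
- apply: le_trans (sum_moved_le (expR_ge0 _) nz1).
  apply: (@le_trans _ _ (\sum_(tau : 'S_n | (tau != 1%g) && (#|moved tau| <= K)%N) z1 ^+ #|moved tau|)).
    apply: ler_sum => tau /andP[t1 tK].
    have p01 : p true false = p false true by rewrite /p /corr_law /kern; ring.
    have [h1 h2 _ _] := kernE rho qq.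
    apply: le_trans (pairwise_error_le tau lp p01 (lt_le_trans ltr01 w1) _ _ D0 w1) _.
    + rewrite /p /corr_law h2 /marg mulr_gt0 ?mulr_gt0 //.
      by rewrite ltr_wpDr // divr_ge0 ?mulr_ge0 // ltW.
    + rewrite /p /corr_law h1 /marg mulr_gt0 ?mulr_gt0 //.
      by rewrite ltr_wpDr // divr_ge0 ?mulr_ge0 // ltW.
    rewrite -expRM_natl ler_expR -/D mulNr mulrN lerN2 mulrCA ler_wpM2l //.
    rewrite mulrA ler_pdivrMr // -!natrM ler_nat mulnC [(_ * 2)%N]mulnC.
    apply: leq_trans (card_moved_edges tau).
    rewrite mulnC leq_mul2l leq_sub2l ?orbT //.
  rewrite [leRHS](bigID (fun tau => (#|moved tau| <= K)%N)) /= lerDl.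
  by apply: sumr_ge0 => tau _; rewrite exprn_ge0 // expR_ge0.
- have z20 : 0 <= z2 by rewrite mulr_ge0 ?expR_ge0.
  apply: le_trans (sum_moved_le z20 nz2); apply: ler_sum => tau t1.
  apply: le_trans (high_score_le m tau qq rr ll) _.
  rewrite md exprMn ler_wpM2l ?exprn_ge0 // -expRM_natl ler_expR mulNr mulrN lerN2 mulrCA ler_wpM2l //.
  by rewrite mulrA ler_pdivrMr // -!natrM ler_nat [(_ * 2)%N]mulnC card_touches_ge.
- apply: (@le_trans _ _ (\sum_(M : {set 'I_n} | (K <= #|M|)%N)
     expR (- (c * (K%:R * (e * (n.-1%:R / 2))))))).
    apply: ler_sum => M KM.
    apply: le_trans (low_score_le (touches M) lp th0 hlow) _.
    rewrite ler_expR mulNr lerN2 -mulrA ler_wpM2l // mulrCA ler_wpM2l //.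
    rewrite mulrA ler_pdivrMr // -!natrM ler_nat [(_ * 2)%N]mulnC.
    by apply: leq_trans (card_touches_ge M); rewrite leq_mul2r KM orbT.
  rewrite sumr_const -[leLHS]mulr_natl ler_wpM2r ?expR_ge0 // -natrX ler_nat.
  apply: leq_trans (max_card _) _.
  by rewrite -cardsT -powersetT card_powerset cardsT card_ord.
Qed.

Lemma corr_law_gap (R : realType) (q rho : R) : 0 < q < 1 -> 0 <= rho <= 1 ->
  Num.sqrt (corr_law q rho false false * corr_law q rho true true) - corr_law q rho false true
  = gap (q * (1 - q)) rho.
Proof.
move=> qq /andP[rho0 rho1]; have /andP[q0 q1] := qq; have q1' : 0 < 1 - q by lra.
rewrite /gap /corr_law /marg; have [-> -> _ ->] := kernE rho qq.
congr (Num.sqrt _ - _); last by ring.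
by field; rewrite !gt_eqF.
Qed.

Lemma expR_ln_nat (R : realType) (n : nat) (u : R) : (0 < n)%N ->
  n%:R * expR (- ((1 + u) * ln n%:R)) = expR (- (u * ln n%:R)) :> R.
Proof.
move=> n0; rewrite -{1}[n%:R]lnK ?posrE ?ltr0n // -expRD; congr expR; ring.
Qed.

(** When [n Q >= (1 + eps) ln n], each sum over permutations is dominated by a
    geometric series of ratio about [n ^ (- eps / 4)]: a permutation moving [k]
    points costs about [k n Q] when [k] is a small fraction of [n] and
    [k n e / 2] in general, with a rate [e] of nearly [2 Q]. The fraction [eta]
    absorbs every loss of lower order. *)
Lemma mean_beaten_asymptotic (R : realType) (eps : R) : 0 < eps <= 1 ->
  exists2 n0 : R, 0 < n0 & forall (n : nat) (q rho : R),
    n0 <= ln n%:R -> n0 * ln n%:R <= n.-1%:R -> 0 < q < 1 -> 0 < rho <= 1 ->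
    (1 + eps) * ln n%:R <= n%:R * gap (q * (1 - q)) rho ^+ 2 ->
    mean (corr_law q rho) (fun x y : adjvec n => (beaten x y)%:R) <=
      7 * expR (- (eps / 4 * ln n%:R)).
Proof.
move=> /andP[eps0 eps1]; pose eta := eps / 8.
have eta01 : 0 < eta < 1 by rewrite /eta; apply/andP; split; clear -eps0 eps1; lra.
have [th [c [e0 [th0 c0 e00 rate]]]] := entropy_rate eta01.
pose n0 := 16 / eps + 8 / e0 + 4 / (c * eta) + 2 / eta.
have n01 : [/\ 16 / eps <= n0, 8 / e0 <= n0, 4 / (c * eta) <= n0 & 2 / eta <= n0].
  have /andP[eta0 _] := eta01.
  have a1 : 0 < 16 / eps by rewrite divr_gt0.
  have a2 : 0 < 8 / e0 by rewrite divr_gt0.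
  have a3 : 0 < 4 / (c * eta) by rewrite divr_gt0 // mulr_gt0.
  have a4 : 0 < 2 / eta by rewrite divr_gt0.
  by rewrite /n0; move: a1 a2 a3 a4; move: (16 / _) (8 / _) (4 / _) (2 / _) => a b f g;
    clear => *; split; lra.
clearbody n0; have [b1 b2 b3 b4] := n01.
have n00 : 0 < n0 by apply: lt_le_trans b1; rewrite divr_gt0.
exists n0 => //.
move=> n q rho; set L := ln n%:R => nL nn qq rr hQ.
have L0 : 0 < L by apply: lt_le_trans nL.
have /andP[eta0 eta1] := eta01.
have eta8 : eta <= 8^-1 by rewrite /eta; clear -eps1; lra.
have epsE : eps = 8 * eta by rewrite /eta; field.
have nL2 : 16 <= eps * L.
  by rewrite mulrC -ler_pdivrMr //; apply: le_trans nL.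
have nE : n%:R = n.-1%:R + 1 :> R.
  case: n @L nL nn hQ L0 nL2 => [|n] L //= nL nn hQ L0 nL2; last by rewrite -natr1.
  by move: L0; rewrite /L ln0 // ltxx.
have N1 : n0 <= n.-1%:R.
  have : 1 <= L by clear -nL2 eps1 L0; nra.
  move=> L1; apply: le_trans nn; rewrite ler_peMr // ltW //.
have Npos : 0 < n%:R :> R by rewrite nE natr1 ltr0n.
have etaN : 2 <= eta * n.-1%:R.
  by rewrite mulrC -ler_pdivrMr //; apply: le_trans N1.
set N := n%:R in hQ Npos nE *; set N' := n.-1%:R in nn nE N1 etaN *.
have etaNN : 2 <= eta * N by rewrite nE mulrDr; clear -etaN eta0; lra.
set Q := gap _ _ in hQ *.
have Q2 : 0 < Q ^+ 2.
  have : 0 < N * Q ^+ 2 by apply: lt_le_trans hQ; rewrite mulr_gt0 // addr_gt0.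
  by rewrite pmulr_rgt0.
have QE : Q = Num.sqrt (corr_law q rho false false * corr_law q rho true true) - corr_law q rho false true.
  by rewrite corr_law_gap //; move: rr => /andP[r0 ->]; rewrite ltW.
have /andP[rho0 rho1] := rr; have /andP[q0 q1] := qq; have q1' : 0 < 1 - q by clear -q1; lra.
have p01 : 0 <= corr_law q rho false true by apply: corr_law_ge0; rewrite // ltW.
have Q0 : 0 < Q.
  rewrite lt_def; apply/andP; split; last by apply: gap_ge0; rewrite ?ltW // mulr_gt0.
  by apply: contraTneq Q2 => ->; rewrite expr0n ltxx.
have [w w1 hw] : exists2 w : R, 1 <= w & (1 - eta) * Q ^+ 2 <=
    (corr_law q rho false false * corr_law q rho true true / w - corr_law q rho false true ^+ 2) * (w - 1).
  have := @chernoff_base R eta (Num.sqrt (corr_law q rho false false * corr_law q rho true true)) (corr_law q rho false true) eta01.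
  rewrite -QE p01 -subr_gt0 -QE Q0 => /(_ isT) [w w1].
  rewrite sqr_sqrtr; first by exists w.
  by apply: mulr_ge0; apply: corr_law_ge0; rewrite // ltW.
have [l [m [e [ll hlow md hmin]]]] := rate q rho qq rr.
set D := (_ - _) * (w - 1) in hw.
have D0 : 0 <= D by apply: le_trans hw; rewrite mulr_ge0 ?(ltW Q2) //; clear -eta1; lra.
have e0' : 0 <= e.
  apply: le_trans hmin; rewrite le_min (ltW e00) andbT mulr_ge0 ?sqr_ge0 //.
  by rewrite mulr_ge0 //; clear -eta1; lra.
pose K := Num.truncn (eta * N).
have K1 : K%:R <= eta * N by rewrite truncn_le mulr_ge0 // ltW.
have K2 : eta * N < K%:R + 1 by rewrite natr1 truncnS_gt.
have en : (1 + eps / 4) * L <= (1 - eta) * e * (N' / 2).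
  have e2 : (1 - eta) * Q ^+ 2 * N' * (1 - eta) >= (1 + eps / 4) * L.
    have N1' : (1 - eta) * N <= N' by rewrite nE; clear -etaN eta8 eta0; lra.
    apply: (@le_trans _ _ ((1 - eta) * (1 - eta) * ((1 - eta) * N * Q ^+ 2))).
      apply: (@le_trans _ _ ((1 - eta) * (1 - eta) * (1 - eta) * ((1 + eps) * L))).
        rewrite [leRHS]mulrA ler_pM2r // epsE; clear -eta0 eta8; nra.
      rewrite -!mulrA !ler_wpM2l //; try (clear -eta1; lra).
    have -> : (1 - eta) * Q ^+ 2 * N' * (1 - eta) = (1 - eta) * (1 - eta) * (N' * Q ^+ 2) by ring.
    by rewrite !ler_wpM2l ?mulr_ge0 ?ler_wpM2r ?(ltW Q2) //; clear -eta1; lra.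
  have [h|h] := leP (2 * (1 - eta) * Q ^+ 2) e0.
    have he : 2 * (1 - eta) * Q ^+ 2 <= e by apply: le_trans hmin; rewrite le_min lexx h.
    apply: le_trans e2 _.
    have -> : (1 - eta) * Q ^+ 2 * N' * (1 - eta) = (2 * (1 - eta) * Q ^+ 2) * ((1 - eta) * (N' / 2)).
      by field.
    have -> : (1 - eta) * e * (N' / 2) = e * ((1 - eta) * (N' / 2)) by ring.
    rewrite ler_wpM2r // mulr_ge0 ?divr_ge0 ?ler0n //; clear -eta1; lra.
  have he : e0 <= e by apply: le_trans hmin; rewrite le_min lexx (ltW h).
  have LN : 8 * L <= e0 * N'.
    have : 8 / e0 * L <= N' by apply: le_trans nn; rewrite ler_pM2r.
    by rewrite mulrAC ler_pdivrMr // mulrC [N' * _]mulrC.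
  have h1 : e0 * N' <= e * N' by rewrite ler_wpM2r.
  have h2 : 0 <= e * N' by rewrite mulr_ge0 ?ler0n.
  have h3 : 0 <= (8^-1 - eta) * (e * N') by rewrite mulr_ge0 // subr_ge0.
  have h4 : 0 <= (1 - eps) * L by rewrite mulr_ge0 ?(ltW L0) // subr_ge0.
  clear -LN h1 h2 h3 h4; lra.
have nz1 : N * expR (- (D * ((2 * n - 2 - K)%N%:R / 2))) <= expR (- (eps / 4 * L)).
  rewrite -expR_ln_nat; last by rewrite -(ltr0n R).
  rewrite ler_pM2l // ler_expR lerN2 -/L.
  have KN : (K <= 2 * n - 2)%N.
    rewrite -(ler_nat R) natrB; last by rewrite -(ler_nat R) natrM -/N nE; clear -etaN eta8 N1 eta0; nra.
    rewrite natrM -/N; apply: le_trans K1 _; rewrite nE; clear -etaN eta8 eta0; nra.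
  rewrite natrB // natrB; last by rewrite -(ler_nat R) natrM -/N nE; clear -etaN eta8 N1 eta0; nra.
  rewrite natrM -/N.
  have h1 : (1 - eta) * N <= (2%:R * N - 2%:R - K%:R) / 2.
    clear -K1 etaNN; lra.
  apply: (@le_trans _ _ ((1 - eta) * Q ^+ 2 * ((1 - eta) * N))).
    have -> : (1 - eta) * Q ^+ 2 * ((1 - eta) * N) = (1 - eta) * (1 - eta) * (N * Q ^+ 2) by ring.
    apply: (@le_trans _ _ ((1 - eta) * (1 - eta) * ((1 + eps) * L))).
      rewrite [leRHS]mulrA ler_pM2r // epsE; clear -eta0 eta8; nra.
    by rewrite ler_wpM2l // mulr_ge0 //; clear -eta1; lra.
  apply: ler_pM => //; rewrite mulr_ge0 ?(ltW Q2) ?(ltW Npos) //; clear -eta1; lra.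
have nz2 : N * (2 * expR (- ((1 - eta) * e * (N' / 2)))) <= 2 * expR (- (eps / 4 * L)).
  rewrite mulrCA ler_pM2l // -expR_ln_nat; last by rewrite -(ltr0n R).
  by rewrite ler_pM2l // ler_expR lerN2.
set v := expR (- (eps / 4 * L)) in nz1 nz2 *.
have v4 : v <= 4^-1.
  have : v * expR (eps / 4 * L) = 1 by rewrite -expRD addrC subrr expR0.
  have : 4 <= expR (eps / 4 * L) by apply: le_trans (expR_ge1Dx _); clear -nL2; lra.
  have := expR_ge0 (- (eps / 4 * L)); rewrite -/v; clear; nra.
have := @mean_beaten_le R n K q rho w th c m l e ((1 - eta) * e) qq rr ll (ltW th0) (ltW c0) e0' w1 D0 hlow md.
rewrite -/N -/N' -/D => main.
apply: le_trans (main _ _ _) _.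
- by rewrite mulr_ge0 //; clear -eta1; lra.
- by apply: le_trans nz1 _; clear -v4; lra.
- by apply: le_trans nz2 _; clear -v4; lra.
have h3 : 2 ^+ n * expR (- (c * (K%:R * (e * (N' / 2))))) <= v.
  have e1 : 2 <= expR 1 :> R by exact: expR_ge1Dx.
  apply: (@le_trans _ _ (expR N * expR (- (c * (K%:R * (e * (N' / 2))))))).
    rewrite ler_wpM2r ?expR_ge0 // -[N]mulr1 expRM_natl lerXn2r ?nnegrE ?expR_ge0 //.
  rewrite -expRD ler_expR.
  have KN : eta * N <= 2 * K%:R by clear -K2 etaNN; lra.
  have eL : L <= e * (N' / 2).
    have t1 : 0 <= eta * (e * (N' / 2)) by rewrite !mulr_ge0 ?invr_ge0 ?ler0n // ltW.
    have t2 : 0 <= eps * L by rewrite mulr_ge0 // ltW.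
    clear -en t1 t2; lra.
  have t : eta * N * L <= 2 * K%:R * (e * (N' / 2)) by apply: ler_pM; rewrite ?mulr_ge0 // ltW.
  have c4 : 4 <= c * eta * L.
    by rewrite mulrC -ler_pdivrMr ?mulr_gt0 //; apply: le_trans nL.
  have t3 : 4 * N <= c * eta * L * N by rewrite ler_wpM2r // ltW.
  have t4 := ler_wpM2l (ltW c0) t.
  have LN : L <= N by apply: le_trans (ln_leB1 Npos) _; clear; lra.
  have t5 : eps * L <= N.
    by apply: le_trans LN; rewrite ler_piMl // ltW.
  clear -t3 t4 t5 Npos; lra.
apply: le_trans (lerD (lerD (ler_wpM2l _ nz1) (ler_wpM2l _ nz2)) h3) _ => //.
rewrite le_eqVlt; apply/orP; left; apply/eqP; ring.
Qed.

(** * The likelihood cost of a transposition *)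

(** Exchanging two vertices multiplies the likelihood by the square of a product
    over the remaining vertices [v]; the factor of [v] is the geometric-mean
    ratio below, where [a, b] and [a', b'] are the bits of the two graphs on the
    two exchanged edges at [v]. The convention that the inverse of zero is zero
    only affects configurations of probability zero. *)
Definition swap_weight (R : realType) (p : bool -> bool -> R) (a b a' b' : bool) : R :=
  let A := Num.sqrt (p false false * p true true) in
  if (a != a') && (b != b') then
    if a == b then p false true / A else A / p false true
  else 1.

Definition mean2 (R : realType) (p : bool -> bool -> R)
    (k : bool -> bool -> bool -> bool -> R) : R :=
  \sum_a \sum_b p a b * (\sum_a' \sum_b' p a' b' * k a b a' b').

Definition mean3 (R : realType) (p : bool -> bool -> R)
    (k : bool -> bool -> bool -> bool -> bool -> bool -> R) : R :=
  \sum_a \sum_b p a b * (\sum_a' \sum_b' p a' b' *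
    (\sum_a'' \sum_b'' p a'' b'' * k a b a' b' a'' b'')).

Definition sgap (R : realType) (p : bool -> bool -> R) : R :=
  Num.sqrt (p false false * p true true) - p false true.

Definition assoc_law (R : realType) (p : bool -> bool -> R) : Prop :=
  [/\ law p, p true false = p false true &
      p false true ^+ 2 <= p false false * p true true].

Lemma swap_weightC (R : realType) (p : bool -> bool -> R) a b a' b' :
  swap_weight p a b a' b' = swap_weight p a' b' a b.
Proof. by rewrite /swap_weight; case: a; case: b; case: a'; case: b'. Qed.

Lemma swap_weight_ge0 (R : realType) (p : bool -> bool -> R) a b a' b' :
  assoc_law p -> 0 <= swap_weight p a b a' b'.
Proof.
move=> [[p0 _] _ _]; rewrite /swap_weight; case: ifP => // _.
by case: ifP => _; rewrite divr_ge0 ?sqrtr_ge0.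
Qed.

Lemma assoc_lawE (R : realType) (p : bool -> bool -> R) : assoc_law p ->
  exists P0 P1 b A : R, [/\ p false false = P0, p true true = P1,
    p false true = b /\ p true false = b, Num.sqrt (p false false * p true true) = A &
    [/\ 0 <= P0, 0 <= P1, 0 <= b, b <= A & A ^+ 2 = P0 * P1 /\ P0 + P1 = 1 - 2 * b]].
Proof.
move=> [[p0 p1] pC pA].
exists (p false false), (p true true), (p false true), (Num.sqrt (p false false * p true true)).
split=> //; split=> //; first by rewrite -[leLHS]ger0_norm // -sqrtr_sqr ler_wsqrtr.
rewrite sqr_sqrtr ?mulr_ge0 //; split=> //.
move: p1; rewrite big_bool2 pC; clear; lra.
Qed.

Lemma sgap_bounds (R : realType) (p : bool -> bool -> R) : assoc_law p ->
  0 <= sgap p /\ sgap p ^+ 2 <= 4^-1.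
Proof.
move=> /assoc_lawE[P0 [P1 [b [A [e0 e1 [eb eb'] eA [P00 P10 b0 bA [AE PE]]]]]]].
rewrite /sgap eA eb; have A0 : 0 <= A by apply: le_trans bA.
have h : A <= 2^-1.
  rewrite -[leLHS]ger0_norm // -sqrtr_sqr -[2^-1]ger0_norm // -sqrtr_sqr ler_wsqrtr //.
  rewrite AE; have := sqr_ge0 (P0 - P1).
  have : (P0 + P1) ^+ 2 <= 1 by rewrite PE; have := b0; clear -b0 PE P00 P10; nra.
  clear; nra.
rewrite subr_ge0; split=> //.
have h1 : 0 <= A - b by rewrite subr_ge0.
have h2 : A - b <= 2^-1 by clear -h b0; lra.
by have := ler_pM h1 h1 h2 h2; rewrite -expr2 -invfM -natrM.
Qed.

Lemma swap_ratios (R : realType) (p : bool -> bool -> R) : assoc_law p ->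
  exists P0 P1 b A z z' : R, [/\ p = (fun a c => if a then (if c then P1 else b) else if c then b else P0),
    Num.sqrt (p false false * p true true) = A,
    A ^+ 2 = P0 * P1 /\ P0 + P1 = 1 - 2 * b,
    swap_weight p = (fun a c a' c' => if (a != a') && (c != c') then if a == c then z else z' else 1) &
    [/\ P0 * P1 * z = A * b, P0 * P1 * z ^+ 2 = b ^+ 2, b ^+ 2 * z' = A * b,
       b ^+ 2 * z' ^+ 2 <= A ^+ 2 & [\/ [/\ b = 0, z = 0 & z' = 0] |
         [/\ 0 < b, b <= A, z = b / A & z' = A / b]]]].
Proof.
move=> pp; have [P0 [P1 [b [A [e0 e1 [eb eb'] eA [P00 P10 b0 bA [AE PE]]]]]]] := assoc_lawE pp.
exists P0, P1, b, A, (b / A), (A / b); split=> //.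
- by apply/funext => -[]; apply/funext => -[].
- by rewrite /swap_weight eA eb; apply/funext => a; apply/funext => c; apply/funext => a'; apply/funext => c'.
have [b0'|bn] := eqVneq b 0.
  rewrite b0' invr0 !mulr0 !mul0r expr0n /= mulr0 mul0r sqr_ge0; split=> //.
  by left.
have {}b0 : 0 < b by rewrite lt_def bn.
have A0 : 0 < A by apply: lt_le_trans bA.
rewrite -AE; split; try by field; rewrite !gt_eqF.
  by rewrite -exprMn mulrC divfK.
by right.
Qed.

Lemma mean2_swap (R : realType) (p : bool -> bool -> R) : assoc_law p ->
  mean2 p (swap_weight p) = 1 - 2 * sgap p ^+ 2.
Proof.
move=> /swap_ratios[P0 [P1 [b [A [z [z' [eP eA [AE PE] -> [f1 f2 f3 f4 _]]]]]]]].
rewrite /mean2 /sgap eA !big_bool2 eP /=.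
transitivity ((P0 + P1 + 2 * b) ^+ 2 - 2 * (P0 * P1) - 2 * b ^+ 2 + 2 * (P0 * P1 * z) + 2 * (b ^+ 2 * z')); first by ring.
by rewrite f1 f3 -AE PE; ring.
Qed.

Lemma mean2_swap_sqr (R : realType) (p : bool -> bool -> R) : assoc_law p ->
  mean2 p (fun a b a' b' => swap_weight p a b a' b' ^+ 2) <= 1.
Proof.
move=> /swap_ratios[P0 [P1 [b [A [z [z' [eP eA [AE PE] -> [f1 f2 f3 f4 _]]]]]]]].
rewrite /mean2 !big_bool2 eP /= expr1n.
apply: (@le_trans _ _ ((P0 + P1 + 2 * b) ^+ 2 - 2 * (P0 * P1) - 2 * b ^+ 2 + 2 * (P0 * P1 * z ^+ 2) + 2 * (b ^+ 2 * z' ^+ 2))).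
  by rewrite le_eqVlt; apply/orP; left; apply/eqP; ring.
by rewrite f2 -AE PE; move: f4; move: (b ^+ 2 * _) => t; clear; lra.
Qed.

(** The three edge bits are cyclically permuted by the product of the two
    transpositions, so this is the trace of the cube of a matrix with trace [1]
    and determinant [sgap p ^+ 2]. *)
Lemma mean3_swap (R : realType) (p : bool -> bool -> R) : assoc_law p ->
  mean3 p (fun a b a' b' a'' b'' => swap_weight p a b a' b' * swap_weight p a b a'' b'')
  = 1 - 3 * sgap p ^+ 2.
Proof.
move=> pp; transitivity (\sum_a \sum_b p a b *
    (\sum_a' \sum_b' p a' b' * swap_weight p a b a' b') ^+ 2).
  rewrite /mean3; apply: eq_bigr => a _; apply: eq_bigr => b _ /=; congr (p a b * _).
  rewrite expr2 mulr_suml; apply: eq_bigr => a' _; rewrite mulr_suml; apply: eq_bigr => b' _.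
  rewrite -mulrA; congr (p a' b' * _); rewrite mulr_sumr; apply: eq_bigr => a'' _.
  by rewrite mulr_sumr; apply: eq_bigr => b'' _; ring.
have [P0 [P1 [b [A [z [z' [eP eA [AE PE] -> [f1 f2 f3 f4 bz]]]]]]]] := swap_ratios pp.
have f5 : b ^+ 3 * z' ^+ 2 = b * A ^+ 2.
  by case: bz => [[-> _ ->]|[b0 _ _ ->]]; [ring|field; rewrite gt_eqF].
rewrite /sgap eA !big_bool2 eP /=.
have s1 : P1 * 1 + b * 1 + (b * 1 + P0 * z) = 1 - P0 + P0 * z by clear -PE; lra.
have s2 : P1 * z + b * 1 + (b * 1 + P0 * 1) = 1 - P1 + P1 * z by clear -PE; lra.
have s3 : P1 * 1 + b * 1 + (b * z' + P0 * 1) = 1 - b + b * z' by clear -PE; lra.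
have s4 : P1 * 1 + b * z' + (b * 1 + P0 * 1) = 1 - b + b * z' by clear -PE; lra.
rewrite s1 s2 s3 s4.
transitivity ((P0 + P1) - 4 * (P0 * P1) + (P0 * P1) * (P0 + P1) + 2 * b * (1 - b) ^+ 2 +
  2 * (2 - (P0 + P1)) * (P0 * P1 * z) + (P0 + P1) * (P0 * P1 * z ^+ 2) +
  4 * (1 - b) * (b ^+ 2 * z') + 2 * (b ^+ 3 * z' ^+ 2)); first by ring.
by rewrite f1 f2 f3 f5 -AE PE; ring.
Qed.

(** The square of the weight is the exact ratio unless a denominator vanishes,
    and the weight is then zero. *)
Lemma swap_weight_ratio (R : realType) (p : bool -> bool -> R) a b a' b' : assoc_law p ->
  p a b * p a' b' * swap_weight p a b a' b' ^+ 2 <= p a' b * p a b'.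
Proof.
move=> /swap_ratios[P0 [P1 [c [A [z [z' [eP eA [AE PE] -> [f1 f2 f3 f4 _]]]]]]]].
rewrite eP; rewrite AE in f4.
by case: a; case: b; case: a'; case: b'; rewrite /= ?expr1n; clear -f2 f4; lra.
Qed.

(** The weight is the tilting that makes the two signs of the displacement
    equally likely, so its logarithm has tilted mean zero. *)
Lemma mean2_swap_ln (R : realType) (p : bool -> bool -> R) : assoc_law p ->
  mean2 p (fun a b a' b' => swap_weight p a b a' b' * ln (swap_weight p a b a' b')) = 0.
Proof.
move=> /swap_ratios[P0 [P1 [b [A [z [z' [eP eA [AE PE] -> [f1 f2 f3 f4 bz]]]]]]]].
rewrite /mean2 !big_bool2 eP /= ln1.
transitivity (2 * (P0 * P1 * z) * ln z + 2 * (b ^+ 2 * z') * ln z'); first by ring.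
rewrite f1 f3; case: bz => [[-> _ _]|[b0 bA -> ->]]; first by ring.
have A0 := lt_le_trans b0 bA.
by rewrite !ln_div ?posrE //; ring.
Qed.

Lemma mean2_swap_ln_sqr (R : realType) (p : bool -> bool -> R) : assoc_law p ->
  mean2 p (fun a b a' b' => swap_weight p a b a' b' * ln (swap_weight p a b a' b') ^+ 2)
  <= 16 * sgap p ^+ 2.
Proof.
move=> /swap_ratios[P0 [P1 [b [A [z [z' [eP eA [AE PE] -> [f1 f2 f3 f4 bz]]]]]]]].
rewrite /mean2 /sgap eA !big_bool2 eP /= ln1.
have -> : P1 * (P1 * (1 * 0 ^+ 2) + b * (1 * 0 ^+ 2) + (b * (1 * 0 ^+ 2) + P0 * (z * ln z ^+ 2))) +
  b * (P1 * (1 * 0 ^+ 2) + b * (1 * 0 ^+ 2) + (b * (z' * ln z' ^+ 2) + P0 * (1 * 0 ^+ 2))) +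
  (b * (P1 * (1 * 0 ^+ 2) + b * (z' * ln z' ^+ 2) + (b * (1 * 0 ^+ 2) + P0 * (1 * 0 ^+ 2))) +
   P0 * (P1 * (z * ln z ^+ 2) + b * (1 * 0 ^+ 2) + (b * (1 * 0 ^+ 2) + P0 * (1 * 0 ^+ 2)))) =
  2 * (P0 * P1 * z) * ln z ^+ 2 + 2 * (b ^+ 2 * z') * ln z' ^+ 2 by ring.
rewrite f1 f3; case: bz => [[-> _ _]|[b0 bA -> ->]].
  by rewrite !mulr0 !mul0r addr0 mulr_ge0 ?sqr_ge0.
have A0 := lt_le_trans b0 bA.
have -> : ln (A / b) = - ln (b / A) by rewrite !ln_div ?posrE // opprB.
set s := Num.sqrt (b / A); have s0 : 0 < s by rewrite sqrtr_gt0 divr_gt0.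
have sE : b / A = s ^+ 2 by rewrite sqr_sqrtr // divr_ge0 // ltW.
have bE : b = A * s ^+ 2 by rewrite -sE mulrC divfK // gt_eqF.
have s1 : s <= 1 by rewrite -sqrtr1 ler_wsqrtr // ler_pdivrMr // mul1r.
rewrite sE lnXn // sqrrN.
have l0 : ln s <= 0 by rewrite ln_le0.
have l1 : 1 - s^-1 <= ln s by apply: ln_ge1BV.
have l2 : (s * ln s) ^+ 2 <= (1 - s) ^+ 2.
  have h : - (s * ln s) <= 1 - s.
    have := ler_wpM2l (ltW s0) l1; rewrite mulrBr mulfV ?gt_eqF //; clear; lra.
  have h0 : 0 <= - (s * ln s) by rewrite -mulrN mulr_ge0 ?oppr_ge0 // ltW.
  by rewrite -sqrrN ler_sqr ?nnegrE // subr_ge0.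
have l3 : (1 - s) ^+ 2 <= (1 - s ^+ 2) ^+ 2.
  rewrite ler_sqr ?nnegrE; [|by clear -s1; lra|]; clear -s0 s1; nra.
apply: (@le_trans _ _ (16 * A ^+ 2 * (s * ln s) ^+ 2)).
  rewrite le_eqVlt; apply/orP; left; apply/eqP; rewrite {1 2}bE -mulr_natl; ring.
have -> : (A - b) ^+ 2 = A ^+ 2 * (1 - s ^+ 2) ^+ 2 by rewrite bE; ring.
rewrite -[16 * A ^+ 2 * _]mulrA ler_wpM2l // ler_wpM2l ?sqr_ge0 //; exact: le_trans l3.
Qed.

(** * Products over the common neighbours of exchanged vertices *)

(** Leaving out the edges inside [V] makes the stars of distinct vertices of [V]
    disjoint, so that functions of these stars are independent. *)
Definition star (n : nat) (V : {set 'I_n}) (v : 'I_n) : {pred vpair n} :=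
  [pred e : vpair n | ((val e).1 == v) && ((val e).2 \notin V) ||
                      ((val e).2 == v) && ((val e).1 \notin V)].

Lemma mean_prod_star (R : realType) (n : nat) (p : bool -> bool -> R) (V : {set 'I_n})
    (h : 'I_n -> adjvec n -> adjvec n -> R) :
  law p -> (forall v, v \in V -> depends_on (star V v) (h v)) ->
  mean p (fun x y => \prod_(v in V) h v x y) = \prod_(v in V) mean p (h v).
Proof.
move=> lp hV; rewrite -big_enum /=.
rewrite -(@mean_prod_blocks _ _ _ p (enum V) (star V)) ?enum_uniq //.
- by apply: eq_mean => x y; rewrite big_enum.
- by move=> v; rewrite mem_enum; apply: hV.
move=> v w; rewrite !mem_enum => vV wV vw e; rewrite !inE negb_or !negb_and !negbK.
by case/orP => /andP[/eqP -> _]; rewrite vw vV ?orbT.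
Qed.

Lemma adj_ext (n : nat) (C : {pred vpair n}) (x y x' y' : adjvec n) (i j : 'I_n) :
  (forall e, e \in C -> x e = x' e /\ y e = y' e) ->
  (forall e, oedge i j = Some e -> e \in C) ->
  adj x i j = adj x' i j /\ adj y i j = adj y' i j.
Proof.
move=> xx ij; rewrite !adj_oedge; move: ij; case: (oedge i j) => [e /(_ e erefl)/xx|] //=.
Qed.

Lemma oedge_star (n : nat) (V : {set 'I_n}) (i v : 'I_n) (e : vpair n) :
  i \notin V -> oedge i v = Some e -> e \in star V v.
Proof. by move=> iV /oedge_eq[] ev; rewrite inE ev /= eqxx iV ?orbT. Qed.

Lemma mean_adj2 (R : realType) (n : nat) (p : bool -> bool -> R) (i j v : 'I_n) k :
  law p -> i != j -> i != v -> j != v ->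
  mean p (fun x y : adjvec n => k (adj x i v) (adj y i v) (adj x j v) (adj y j v)) = mean2 p k.
Proof.
move=> lp ij iv jv.
have [e ei ve] := oedgeP iv; have [f fj vf] := oedgeP jv.
have ef : e != f.
  apply: contraNneq ij => ef; apply/eqP.
  by move: ve vf; rewrite ef => -[] -> [] [] *; congruence.
rewrite /mean2 -(mean_coord2 k lp ef); apply: eq_mean => x y.
by rewrite !adj_oedge ei fj.
Qed.

Lemma mean_adj3 (R : realType) (n : nat) (p : bool -> bool -> R) (i j l v : 'I_n) k :
  law p -> i != j -> i != l -> j != l -> i != v -> j != v -> l != v ->
  mean p (fun x y : adjvec n => k (adj x i v) (adj y i v) (adj x j v) (adj y j v)
     (adj x l v) (adj y l v)) = mean3 p k.
Proof.
move=> lp ij il jl iv jv lv.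
have [e ei ve] := oedgeP iv; have [f fj vf] := oedgeP jv; have [g gl vg] := oedgeP lv.
have ne (a b : 'I_n) (r s : vpair n) : a != b -> a != v -> b != v ->
    val r = (a, v) \/ val r = (v, a) -> val s = (b, v) \/ val s = (v, b) -> r != s.
  move=> ab av bv hr hs; apply: contraNneq ab => rs; apply/eqP.
  by move: hr hs; rewrite rs => -[] -> [] [] *; congruence.
rewrite /mean3 -(mean_coord3 k lp (ne _ _ _ _ ij iv jv ve vf) (ne _ _ _ _ il iv lv ve vg) (ne _ _ _ _ jl jv lv vf vg)).
by apply: eq_mean => x y; rewrite !adj_oedge ei fj gl.
Qed.

Lemma mean2_ge0 (R : realType) (p : bool -> bool -> R) k :
  law p -> (forall a b a' b', 0 <= k a b a' b') -> 0 <= mean2 p k.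
Proof.
move=> [p0 _] k0; apply: sumr_ge0 => a _; apply: sumr_ge0 => b _; apply: mulr_ge0 => //.
by apply: sumr_ge0 => a' _; apply: sumr_ge0 => b' _; apply: mulr_ge0.
Qed.

Lemma eq_mean2 (R : realType) (p : bool -> bool -> R) k k' :
  (forall a b a' b', k a b a' b' = k' a b a' b') -> mean2 p k = mean2 p k'.
Proof.
move=> kk; apply: eq_bigr => a _; apply: eq_bigr => b _; congr (_ * _).
by apply: eq_bigr => a' _; apply: eq_bigr => b' _; rewrite kk.
Qed.

Definition swap_at (R : realType) (p : bool -> bool -> R) (n : nat) (i j : 'I_n)
    (v : 'I_n) (x y : adjvec n) : R :=
  swap_weight p (adj x i v) (adj y i v) (adj x j v) (adj y j v).

Definition swap_prod (R : realType) (p : bool -> bool -> R) (n : nat) (V : {set 'I_n})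
    (i j : 'I_n) (x y : adjvec n) : R := \prod_(v in V) swap_at p i j v x y.

Definition swap_log (R : realType) (p : bool -> bool -> R) (n : nat) (V : {set 'I_n})
    (i j : 'I_n) (x y : adjvec n) : R := \sum_(v in V) ln (swap_at p i j v x y).

Lemma swap_atC (R : realType) (p : bool -> bool -> R) (n : nat) (i j v : 'I_n) (x y : adjvec n) :
  swap_at p i j v x y = swap_at p j i v x y.
Proof. exact: swap_weightC. Qed.

Lemma mean_prod_pair (R : realType) (n : nat) (p : bool -> bool -> R) (V : {set 'I_n})
    (i j : 'I_n) (k : 'I_n -> bool -> bool -> bool -> bool -> R) :
  law p -> i != j -> i \notin V -> j \notin V ->
  mean p (fun x y : adjvec n =>
    \prod_(v in V) k v (adj x i v) (adj y i v) (adj x j v) (adj y j v)) =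
  \prod_(v in V) mean2 p (k v).
Proof.
move=> lp ij iV jV; rewrite mean_prod_star //.
  apply: eq_bigr => v vV; apply: mean_adj2 => //; first by apply: contraNneq iV => ->.
  by apply: contraNneq jV => ->.
move=> v vV x y x' y' xx.
have [-> ->] := adj_ext xx (fun e => @oedge_star n V i v e iV).
by have [-> ->] := adj_ext xx (fun e => @oedge_star n V j v e jV).
Qed.

Lemma mean_prod_triple (R : realType) (n : nat) (p : bool -> bool -> R) (V : {set 'I_n})
    (i j l : 'I_n) (k : bool -> bool -> bool -> bool -> bool -> bool -> R) :
  law p -> i != j -> i != l -> j != l -> i \notin V -> j \notin V -> l \notin V ->
  mean p (fun x y : adjvec n =>
    \prod_(v in V) k (adj x i v) (adj y i v) (adj x j v) (adj y j v) (adj x l v) (adj y l v)) =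
  mean3 p k ^+ #|V|.
Proof.
move=> lp ij il jl iV jV lV; rewrite mean_prod_star.
- rewrite (eq_bigr (fun=> mean3 p k)) ?prodr_const // => v vV.
  by apply: mean_adj3 => //; [apply: contraNneq iV|apply: contraNneq jV|apply: contraNneq lV] => ->.
- exact: lp.
move=> v vV x y x' y' xx.
have [-> ->] := adj_ext xx (fun e => @oedge_star n V i v e iV).
have [-> ->] := adj_ext xx (fun e => @oedge_star n V j v e jV).
by have [-> ->] := adj_ext xx (fun e => @oedge_star n V l v e lV).
Qed.

Lemma mean_swap_prod (R : realType) (n : nat) (p : bool -> bool -> R) (V : {set 'I_n}) (i j : 'I_n) :
  assoc_law p -> i != j -> i \notin V -> j \notin V ->
  mean p (swap_prod p V i j) = (1 - 2 * sgap p ^+ 2) ^+ #|V|.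
Proof.
move=> pp ij iV jV; have [lp _ _] := pp.
rewrite (mean_prod_pair (fun=> swap_weight p)) // mean2_swap //.
by rewrite prodr_const.
Qed.

Lemma mean_swap_prod_sqr (R : realType) (n : nat) (p : bool -> bool -> R) (V : {set 'I_n}) (i j : 'I_n) :
  assoc_law p -> i != j -> i \notin V -> j \notin V ->
  mean p (fun x y => swap_prod p V i j x y ^+ 2) <= 1.
Proof.
move=> pp ij iV jV; have [lp _ _] := pp.
have -> : mean p (fun x y => swap_prod p V i j x y ^+ 2) =
    \prod_(v in V) mean2 p (fun a b a' b' => swap_weight p a b a' b' ^+ 2).
  rewrite -(mean_prod_pair (fun _ a b a' b' => swap_weight p a b a' b' ^+ 2) lp ij iV jV).
  by apply: eq_mean => x y; rewrite /swap_prod -prodrXl.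
rewrite prodr_const; apply: exprn_ile1; last exact: mean2_swap_sqr.
by apply: mean2_ge0 => // *; exact: sqr_ge0.
Qed.

(** Second moment under the tilted measure: the cross terms vanish because the
    tilted mean of each logarithm is zero. *)
Lemma mean_swap_prod_log (R : realType) (n : nat) (p : bool -> bool -> R) (V : {set 'I_n}) (i j : 'I_n) :
  assoc_law p -> i != j -> i \notin V -> j \notin V ->
  mean p (fun x y => swap_prod p V i j x y * swap_log p V i j x y ^+ 2) <=
  32 * sgap p ^+ 2 * #|V|%:R * (1 - 2 * sgap p ^+ 2) ^+ #|V|.
Proof.
move=> pp ij iV jV; have [lp _ _] := pp; have [s0 s4] := sgap_bounds pp.
pose lnw a b a' b' := ln (swap_weight p a b a' b').
pose k (v w u : 'I_n) a b a' b' := swap_weight p a b a' b' *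
  ((if u == v then lnw a b a' b' else 1) * (if u == w then lnw a b a' b' else 1)).
have -> : mean p (fun x y => swap_prod p V i j x y * swap_log p V i j x y ^+ 2) =
    \sum_(v in V) \sum_(w in V) \prod_(u in V) mean2 p (k v w u).

  under [RHS]eq_bigr => v vV do under eq_bigr => w wV do rewrite -(mean_prod_pair (k v w) lp ij iV jV).
  under [RHS]eq_bigr => v vV do rewrite -mean_sum.
  rewrite -mean_sum; apply: eq_mean => x y.
  rewrite expr2 big_distrl /= mulr_sumr; apply: eq_bigr => v vV.
  rewrite mulr_sumr mulr_sumr; apply: eq_bigr => w wV.
  rewrite /k !big_split /=; congr (_ * (_ * _)).
    by rewrite [RHS](bigD1 v) //= eqxx big1 ?mulr1 // => u /andP[_ /negPf ->].
  by rewrite [RHS](bigD1 w) //= eqxx big1 ?mulr1 // => u /andP[_ /negPf ->].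
set Q := sgap p ^+ 2 in s4 *.
have q2 : 2^-1 <= 1 - 2 * Q by clear -s4; lra.
have diag v : v \in V -> \sum_(w in V) \prod_(u in V) mean2 p (k v w u) <=
    32 * Q * (1 - 2 * Q) ^+ #|V|.
  move=> vV; rewrite (bigD1 v) //= [X in _ + X]big1 ?addr0 => [|w /andP[wV wv]].
    rewrite (bigD1 v) //= (_ : mean2 p (k v v v) = mean2 p (fun a b a' b' =>
       swap_weight p a b a' b' * ln (swap_weight p a b a' b') ^+ 2)); last first.
      by apply: eq_mean2 => *; rewrite /k eqxx.
    rewrite (eq_bigr (fun=> 1 - 2 * Q)) => [|u /andP[uV uv]]; last first.
      by rewrite -mean2_swap //; apply: eq_mean2 => *; rewrite /k (negPf uv) !mulr1.
    have -> : \prod_(u in V | u != v) (1 - 2 * Q) = (1 - 2 * Q) ^+ #|V|.-1.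
      rewrite [in RHS](cardD1 v) vV /= big_const -Monoid.iteropE; congr (_ ^+ _).
      by apply: eq_card => u; rewrite !inE andbC.
    have -> : (1 - 2 * Q) ^+ #|V| = (1 - 2 * Q) * (1 - 2 * Q) ^+ #|V|.-1.
      by rewrite -exprS prednK //; apply/card_gt0P; exists v.
    rewrite [leRHS]mulrA ler_wpM2r ?exprn_ge0 //; first by clear -q2; lra.
    apply: le_trans (mean2_swap_ln_sqr pp) _.
    have : 0 <= Q by rewrite sqr_ge0.
    rewrite -/Q; clear -q2; nra.
  rewrite (bigD1 v) //= (_ : mean2 p (k v w v) = 0) ?mul0r //.
  by rewrite -(mean2_swap_ln pp); apply: eq_mean2 => *; rewrite /k eqxx [v == w]eq_sym (negPf wv) mulr1.
apply: le_trans (ler_sum _ diag) _.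
rewrite sumr_const -mulr_natr le_eqVlt; apply/orP; left; apply/eqP; ring.
Qed.
Lemma swap_weight_same (R : realType) (p : bool -> bool -> R) a b a' b' :
  a = a' \/ b = b' -> swap_weight p a b a' b' = 1.
Proof. by rewrite /swap_weight => -[] ->; rewrite eqxx ?andbF. Qed.

Lemma swap_prod_ge0 (R : realType) (p : bool -> bool -> R) (n : nat) (V : {set 'I_n})
    (i j : 'I_n) (x y : adjvec n) : assoc_law p -> 0 <= swap_prod p V i j x y.
Proof. by move=> pp; apply: prodr_ge0 => v _; exact: swap_weight_ge0. Qed.

(** Squaring the mass of the relabelled pair and reindexing one factor by the
    transposition compares the two masses edge by edge. *)
Lemma mass_tperm_ge (R : realType) (p : bool -> bool -> R) (n : nat) (i j : 'I_n)
    (x y : adjvec n) : assoc_law p -> i != j ->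
  mass p x y * swap_prod p (~: [set i; j])%SET i j x y ^+ 2 <=
  mass p (relabel (tperm i j) x) y.
Proof.
move=> pp ij; have [[p0 _] _ _] := pp.
set tau := tperm i j; set P := swap_prod p _ i j x y.
have P0 : 0 <= P by exact: swap_prod_ge0.
have tauK e : eperm tau (eperm tau e) = e.
  have h (z : adjvec n) : z (eperm tau (eperm tau e)) = z e.
    by rewrite -!relabelE relabelM tperm2 relabel1.
  by apply/eqP; have := h [ffun f => f == e]; rewrite !ffunE eqxx.
pose S := \prod_(e : vpair n) swap_weight p (x e) (y e) (x (eperm tau e)) (y (eperm tau e)).
have S0 : 0 <= S by apply: prodr_ge0 => e _; exact: swap_weight_ge0.
have SP : S = P ^+ 2.
  pose f a b := swap_weight p (adj x a b) (adj y a b) (adj x (tau a) (tau b)) (adj y (tau a) (tau b)).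
  have fC a b : f a b = f b a by rewrite /f !(adjC _ a) !(adjC _ (tau a)).
  have := big_ordered_pairs *%R fC; rewrite /=.
  have -> : \prod_(e : vpair n) f (val e).1 (val e).2 = S.
    apply: eq_bigr => e _; rewrite /f -!adj_relabel ?vpair_neq // !adjE.
    by rewrite !relabelE.
  have tD b : b != i -> b != j -> tau b = b by move=> bi bj; rewrite tpermD // eq_sym.
  have Pij a : a \notin [set i; j]%SET -> [/\ a != i, a != j & tau a = a].
    by rewrite !inE negb_or => /andP[ai aj]; rewrite tD.
  have row a : a \notin [set i; j]%SET -> \prod_(b | b != a) f a b = swap_at p i j a x y ^+ 2.
    move=> /Pij[ai aj ta]; rewrite (bigD1 i) 1?eq_sym //= (bigD1 j) /=; last by rewrite eq_sym aj eq_sym.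
    rewrite big1 => [|b /andP[/andP[ba bi] bj]].
      by rewrite mulr1 /f ta tpermL tpermR !(adjC _ a) expr2 [X in _ * X]swap_weightC.
    by rewrite /f ta tD // swap_weight_same //; left.
  have rowi : \prod_(b | b != i) f i b = P.
    rewrite (bigD1 j) 1?eq_sym //= {1}/f tpermL tpermR swap_weight_same ?mul1r; last by left; rewrite adjC.
    apply: eq_big => [b|b /andP[bi bj]]; first by rewrite !inE negb_or.
    by rewrite /f tpermL tD.
  have rowj : \prod_(b | b != j) f j b = P.
    rewrite (bigD1 i) //= {1}/f tpermL tpermR swap_weight_same ?mul1r; last by left; rewrite adjC.
    apply: eq_big => [b|b /andP[bi bj]]; first by rewrite !inE negb_or andbC.
    by rewrite /f tpermR tD // swap_weightC.
  rewrite (bigD1 i) //= rowi (bigD1 j) 1?eq_sym //= rowj.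
  rewrite (eq_big (mem (~: [set i; j])%SET) (fun a => swap_at p i j a x y ^+ 2)); first last.
  - by move=> a aij; apply: row; rewrite !inE negb_or.
  - by move=> a; rewrite !inE negb_or.
  rewrite prodrXl -/P -/(swap_prod _ _ _ _ _ _) -/P => h.
  have : (P ^+ 2) ^+ 2 = S ^+ 2 by rewrite [S ^+ 2]expr2 -h; ring.
  by move/eqP; rewrite eqrXn2 ?sqr_ge0 // => /eqP.
have m0 := mass_ge0 (E := vpair n).
rewrite -ler_sqr ?nnegrE ?mulr_ge0 ?m0 ?sqr_ge0 // exprMn -SP.
have -> : mass p (relabel tau x) y ^+ 2 = \prod_e (p (x (eperm tau e)) (y e) * p (x e) (y (eperm tau e))).
  rewrite expr2 {2}/mass (reindex_inj (@perm_inj _ (eperm tau))) /= /mass -big_split /=.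
  by apply: eq_bigr => e _; rewrite !relabelE tauK.
have -> : mass p x y ^+ 2 = \prod_e (p (x e) (y e) * p (x (eperm tau e)) (y (eperm tau e))).
  by rewrite expr2 {2}/mass (reindex_inj (@perm_inj _ (eperm tau))) /= /mass -big_split.
rewrite -prodrXl -big_split /=; apply: ler_prod => e _.
apply/andP; split; last exact: swap_weight_ratio.
by apply: mulr_ge0; [exact: mulr_ge0|exact: sqr_ge0].
Qed.

(** * Abundance of cheap transpositions *)

(** The weight is not degenerate and its logarithm stays within the typical
    tilted fluctuations. *)
Definition tame (R : realType) (p : bool -> bool -> R) (n : nat) (V : {set 'I_n}) (t : R)
    (i j : 'I_n) (x y : adjvec n) : bool :=
  (0 < swap_prod p V i j x y) && (`|swap_log p V i j x y| <= t).

Lemma tameC (R : realType) (p : bool -> bool -> R) (n : nat) (V : {set 'I_n}) (t : R)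
    (i j : 'I_n) (x y : adjvec n) : tame p V t i j x y = tame p V t j i x y.
Proof.
rewrite /tame; have -> : swap_prod p V i j x y = swap_prod p V j i x y.
  by apply: eq_bigr => v _; rewrite swap_atC.
have -> // : swap_log p V i j x y = swap_log p V j i x y.
by apply: eq_bigr => v _; rewrite swap_atC.
Qed.

Lemma swap_prodE (R : realType) (p : bool -> bool -> R) (n : nat) (V : {set 'I_n})
    (i j : 'I_n) (x y : adjvec n) : assoc_law p -> 0 < swap_prod p V i j x y ->
  swap_prod p V i j x y = expR (swap_log p V i j x y).
Proof.
move=> pp; rewrite lt_def => /andP[/prodf_neq0 h _]; rewrite /swap_log expR_sum.
apply: eq_bigr => v vV; rewrite lnK // posrE lt_def h //; exact: swap_weight_ge0.
Qed.

Lemma tame_bounds (R : realType) (p : bool -> bool -> R) (n : nat) (V : {set 'I_n}) (t : R)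
    (i j : 'I_n) (x y : adjvec n) : assoc_law p -> tame p V t i j x y ->
  expR (- t) <= swap_prod p V i j x y <= expR t.
Proof.
by move=> pp /andP[F0]; rewrite (swap_prodE pp F0) !ler_expR ler_norml.
Qed.

(** The weight has mean [(1 - 2 Q) ^ #|V|], and Chebyshev's inequality under the
    measure tilted by the weight keeps half of that mean on the event where the
    logarithm of the weight is at most [t]; there the weight is at most [expR t]. *)
Lemma tame_prob_ge (R : realType) (p : bool -> bool -> R) (n : nat) (V : {set 'I_n}) (t : R)
    (i j : 'I_n) : assoc_law p -> i != j -> i \notin V -> j \notin V -> 0 < t ->
  64 * sgap p ^+ 2 * #|V|%:R <= t ^+ 2 ->
  expR (- t) * ((1 - 2 * sgap p ^+ 2) ^+ #|V| / 2) <=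
  mean p (fun x y => (tame p V t i j x y)%:R).
Proof.
move=> pp ij iV jV t0 ht; have [lp _ _] := pp; have [s0 s4] := sgap_bounds pp.
rewrite expRN ler_pdivrMl ?expR_gt0 // -meanZ.
have t2 : 0 < t ^+ 2 by rewrite exprn_gt0.
apply: (@le_trans _ _ (mean p (fun x y => swap_prod p V i j x y +
   (- (t ^+ 2)^-1) * (swap_prod p V i j x y * swap_log p V i j x y ^+ 2)))).
  rewrite meanD meanZ mean_swap_prod //.
  have := mean_swap_prod_log pp ij iV jV; set c := _ ^+ #|V|.
  have c0 : 0 <= c by rewrite exprn_ge0 //; clear -s4; lra.
  set q := sgap p ^+ 2 in ht *; set N := #|V|%:R in ht *; move: (mean _ _) => S hS.
  have : (t ^+ 2)^-1 * S <= c / 2.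
    rewrite ler_pdivrMl //; apply: le_trans hS _.
    rewrite -subr_ge0; have -> : t ^+ 2 * (c / 2) - 32 * q * N * c = (t ^+ 2 - 64 * q * N) * c / 2 by field.
    by rewrite divr_ge0 // mulr_ge0 // subr_ge0.
  by rewrite mulNr; move: (_ * S) => u; clear; lra.
apply: ler_mean => // x y.
have := swap_prod_ge0 V i j x y pp; rewrite le_eqVlt => /orP[/eqP <-|F0].
  by rewrite mul0r mulr0 addr0 mulr_ge0 ?expR_ge0.
rewrite /tame F0 (swap_prodE pp F0) /=; set H := swap_log _ _ _ _ _ _.
have E0 := expR_ge0 H.
have [h|h] := leP `|H| t.
  rewrite mulr1; apply: (@le_trans _ _ (expR H)).
    rewrite gerDl mulNr oppr_le0; apply: mulr_ge0; first by rewrite invr_ge0 ltW.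
    by rewrite mulr_ge0 ?sqr_ge0.
  by rewrite ler_expR (le_trans (ler_norm _)).
rewrite mulr0 -{1}[expR H]mulr1 mulrCA -mulrDr mulr_ge0_le0 // mulNr subr_le0 ler_pdivlMl // mulr1.
by rewrite -[leRHS]real_normK ?num_real // ler_sqr ?nnegrE // ltW // (lt_trans t0).
Qed.

(** Transpositions sharing a vertex are positively correlated, but only up to
    the trace of a cube: [3 Q] instead of the [4 Q] of independent ones. *)
Lemma tame_pair_le (R : realType) (p : bool -> bool -> R) (n : nat) (V : {set 'I_n}) (t : R)
    (i j l : 'I_n) : assoc_law p -> i != j -> i != l -> j != l ->
  i \notin V -> j \notin V -> l \notin V ->
  mean p (fun x y => (tame p V t i j x y)%:R * (tame p V t i l x y)%:R) <=
  expR (2 * t) * (1 - 3 * sgap p ^+ 2) ^+ #|V|.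
Proof.
move=> pp ij il jl iV jV lV; have [lp _ _] := pp.
rewrite -mean3_swap // -(mean_prod_triple _ lp ij il jl iV jV lV) -meanZ.
apply: ler_mean => // x y; rewrite big_split /= -/(swap_prod p V i j x y) -/(swap_prod p V i l x y).
have F1 := swap_prod_ge0 V i j x y pp; have F2 := swap_prod_ge0 V i l x y pp.
case h1 : (tame p V t i j x y); last by rewrite mul0r !mulr_ge0 ?expR_ge0.
case h2 : (tame p V t i l x y); last by rewrite mulr0 !mulr_ge0 ?expR_ge0.
have /andP[b1 _] := tame_bounds pp h1; have /andP[b2 _] := tame_bounds pp h2.
rewrite mulr1; have := ler_pM (expR_ge0 _) (expR_ge0 _) b1 b2.
move=> /(ler_wpM2l (expR_ge0 (2 * t))); rewrite -!expRD.
have -> : 2 * t + (- t - t) = 0 by ring.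
by rewrite expR0.
Qed.

(** The second moment of the product is at most [1], and its mean is at least
    [1 - 2 * sgap p ^+ 2 * #|W|]; this bounds the mean square distance to [1]. *)
Lemma swap_prod_small_le (R : realType) (p : bool -> bool -> R) (n : nat) (W : {set 'I_n})
    (i j : 'I_n) : assoc_law p -> i != j -> i \notin W -> j \notin W ->
  mean p (fun x y => ((swap_prod p W i j x y < 2^-1)%R)%:R) <= 16 * sgap p ^+ 2 * #|W|%:R.
Proof.
move=> pp ij iW jW; have [lp _ _] := pp; have [s0 s4] := sgap_bounds pp.
apply: (@le_trans _ _ (mean p (fun x y => 4 + ((- 8) * swap_prod p W i j x y + 4 * swap_prod p W i j x y ^+ 2)))).
  apply: ler_mean => // x y; have := swap_prod_ge0 W i j x y pp; move: (swap_prod _ _ _ _ _ _) => F F0.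
  have := sqr_ge0 (1 - F); case: (ltP F) => h /=; last by clear; nra.
  by clear -h F0; nra.
rewrite meanD mean_cst // meanD !meanZ mean_swap_prod //.
have := mean_swap_prod_sqr pp ij iW jW; move: (mean _ _) => S S1.
set q := sgap p ^+ 2 in s4 *.
have q0 : 0 <= q by rewrite sqr_ge0.
suff : 1 - 2 * q * #|W|%:R <= (1 - 2 * q) ^+ #|W| by clear -S1; lra.
elim: #|W| => [|k IH]; first by rewrite mulr0 expr0 subr0.
rewrite exprS -natr1; have := ler_wpM2l (_ : 0 <= 1 - 2 * q) IH.
have q2 : 0 <= 1 - 2 * q by clear -s4; lra.
move=> /(_ q2); apply: le_trans.
have : 0 <= q * q * k%:R by rewrite !mulr_ge0.
clear; lra.
Qed.

Definition pair_edges (n : nat) (V : {set 'I_n}) (i j : 'I_n) : {pred vpair n} :=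
  [pred e : vpair n | ((val e).1 \in pred2 i j) && ((val e).2 \in V) ||
                      ((val e).2 \in pred2 i j) && ((val e).1 \in V)].

Lemma swap_at_ext (R : realType) (p : bool -> bool -> R) (n : nat) (V : {set 'I_n})
    (i j v : 'I_n) (x y x' y' : adjvec n) :
  (forall e, e \in pair_edges V i j -> x e = x' e /\ y e = y' e) -> v \in V ->
  swap_at p i j v x y = swap_at p i j v x' y'.
Proof.
move=> xx vV; rewrite /swap_at.
have [|-> ->] := adj_ext (i := i) (j := v) xx.
  by move=> e /oedge_eq[] ev; rewrite !inE ev /= vV eqxx ?orbT.
have [|-> ->] // := adj_ext (i := j) (j := v) xx.
by move=> e /oedge_eq[] ev; rewrite !inE ev /= vV eqxx ?orbT.
Qed.

Lemma tame_depends (R : realType) (p : bool -> bool -> R) (n : nat) (V : {set 'I_n}) (t : R) (i j : 'I_n) :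
  @depends_on R _ (pair_edges V i j) (fun x y => (tame p V t i j x y)%:R).
Proof.
move=> x y x' y' xx; rewrite /tame.
have -> : swap_prod p V i j x y = swap_prod p V i j x' y'.
  by apply: eq_bigr => v vV; rewrite (swap_at_ext p xx vV).
have -> // : swap_log p V i j x y = swap_log p V i j x' y'.
by apply: eq_bigr => v vV; rewrite (swap_at_ext p xx vV).
Qed.

Lemma small_depends (R : realType) (p : bool -> bool -> R) (n : nat) (V : {set 'I_n}) (i j : 'I_n) :
  @depends_on R _ (pair_edges V i j) (fun x y => ((swap_prod p V i j x y < 2^-1)%R)%:R).
Proof.
move=> x y x' y' xx; have -> // : swap_prod p V i j x y = swap_prod p V i j x' y'.
by apply: eq_bigr => v vV; rewrite (swap_at_ext p xx vV).
Qed.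
Definition cheap (R : realType) (p : bool -> bool -> R) (n : nat) (c : R) (x y : adjvec n) :
  {set 'S_n} := [set tau : 'S_n | c * mass p x y <= mass p (relabel tau x) y]%SET.

Lemma mem_pair_edges (n : nat) (V : {set 'I_n}) (i j : 'I_n) (e : vpair n) :
  (e \in pair_edges V i j) = ((val e).1 \in pred2 i j) && ((val e).2 \in V) ||
                             ((val e).2 \in pred2 i j) && ((val e).1 \in V).
Proof. by []. Qed.

Lemma pair_edges_disjoint (n : nat) (V : {set 'I_n}) (i j k l : 'I_n) (e : vpair n) :
  i \notin V -> j \notin V -> k \notin V -> l \notin V ->
  i != k -> i != l -> j != k -> j != l ->
  e \in pair_edges V i j -> e \notin pair_edges V k l.
Proof.
move=> iV jV kV lV ik il jk jl; have mem (a : 'I_n) : a \in V -> (a \in pred2 k l) = false.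
  by move=> aV; apply/negP; rewrite inE => /orP[] /eqP ae; rewrite -ae aV in kV lV.
have ne (a : 'I_n) : a \in pred2 i j -> (a \in pred2 k l) = false.
  by rewrite !inE => /orP[] /eqP ->; rewrite (negPf ik, negPf jk) (negPf il, negPf jl).
by rewrite !mem_pair_edges => /orP[] /andP[h1 h2]; rewrite (mem _ h2) (ne _ h1).
Qed.

Lemma pair_edges_disjoint_sets (n : nat) (V W : {set 'I_n}) (i j : 'I_n) (e : vpair n) :
  i \notin V -> j \notin V -> [disjoint V & W]%B ->
  e \in pair_edges V i j -> e \notin pair_edges W i j.
Proof.
move=> iV jV VW; have mem (a : 'I_n) : a \in V -> (a \in pred2 i j) = false.
  by move=> aV; apply/negP; rewrite inE => /orP[] /eqP ae; rewrite -ae aV in iV jV.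
have ne (a : 'I_n) : a \in V -> (a \in W) = false by move=> aV; exact: disjointFr VW aV.
by rewrite !mem_pair_edges => /orP[] /andP[h1 h2]; rewrite (mem _ h2) (ne _ h2) ?andbF.
Qed.

(** A tame transposition whose weight on the other vertices is not small costs at
    most the constant factor shown in likelihood. *)
Lemma tame_cheap (R : realType) (p : bool -> bool -> R) (n : nat) (V W : {set 'I_n}) (t : R)
    (i j : 'I_n) (x y : adjvec n) :
  assoc_law p -> i != j -> [disjoint V & W]%B -> (V :|: W)%SET = (~: [set i; j])%SET ->
  tame p V t i j x y -> ~~ (swap_prod p W i j x y < 2^-1)%R ->
  tperm i j \in cheap p (expR (- (2 * t)) / 4) x y.
Proof.
move=> pp ij VW VWE hT; rewrite -leNgt => hW; rewrite inE.
apply: le_trans (mass_tperm_ge x y pp ij).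
have [[p0 _] _ _] := pp.
rewrite mulrC ler_wpM2l ?mass_ge0 // -VWE.
have -> : swap_prod p (V :|: W)%SET i j x y = swap_prod p V i j x y * swap_prod p W i j x y.
  by rewrite /swap_prod -bigU //; apply: eq_bigl => v; rewrite !inE.
have /andP[h1 _] := tame_bounds pp hT.
have h20 : 0 <= 2^-1 :> R by rewrite invr_ge0.
have h := ler_pM (expR_ge0 _) h20 h1 hW.
have -> : expR (- (2 * t)) / 4 = (expR (- t) * 2^-1) ^+ 2.
  by rewrite exprMn -expRM_natl exprVn -natrX mulrN.
rewrite ler_sqr ?nnegrE ?mulr_ge0 ?expR_ge0 ?swap_prod_ge0 // h //.
Qed.

(** Chebyshev's inequality for the number of tame transpositions, whose
    indicators are independent for disjoint transpositions, and Markov's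
    inequality for the number of tame ones spoiled by the remaining vertices. *)
Lemma few_cheap_le (R : realType) (p : bool -> bool -> R) (n m : nat) (L1 L2 : {set 'I_n}) (t : R)
    (V := (~: (L1 :|: L2))%SET) (q := sgap p ^+ 2)
    (g0 := expR (- t) * ((1 - 2 * q) ^+ #|V| / 2)) (h := expR (2 * t) * (1 - 3 * q) ^+ #|V|) :
  assoc_law p -> [disjoint L1 & L2]%B -> #|L1| = m -> #|L2| = m -> (0 < m)%N -> 0 < t ->
  64 * q * #|V|%:R <= t ^+ 2 ->
  mean p (fun x y : adjvec n =>
    ((#|cheap p (expR (- (2 * t)) / 4) x y|%:R < m%:R ^+ 2 * g0 / 4)%R)%:R) <=
  4 / (m%:R ^+ 2 * g0) + 8 * h / (m%:R * g0 ^+ 2) + 128 * q * m%:R.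
Proof.
move=> pp L12 cL1 cL2 m0 t0 ht; have [lp _ _] := pp; have [s0 s4] := sgap_bounds pp.
rewrite -/q in s4.
have q0 : 0 <= q by rewrite sqr_ge0.
pose A := finset.setX L1 L2.
pose W (u : 'I_n * 'I_n) := ((L1 :|: L2) :\: [set u.1; u.2])%SET.
pose T (u : 'I_n * 'I_n) x y : R := (tame p V t u.1 u.2 x y)%:R.
pose S (u : 'I_n * 'I_n) x y : R := ((swap_prod p (W u) u.1 u.2 x y < 2^-1)%R)%:R.
pose g u := mean p (T u).
pose M := \sum_(u in A) g u.
have cA : #|A| = (m * m)%N by rewrite cardsX cL1 cL2.
have Aprop u : u \in A -> [/\ u.1 \in L1, u.2 \in L2, u.1 != u.2, u.1 \notin V & u.2 \notin V].
  case: u => i j /finset.setXP[/= i1 j2]; split=> //.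
  - by apply: contraTneq j2 => <-; rewrite (disjointFr L12 i1).
  - by rewrite !inE i1.
  - by rewrite !inE j2 orbT.
have gg u : u \in A -> g0 <= g u.
  by move=> /Aprop[_ _ ij iV jV]; apply: tame_prob_ge.
have g0pos : 0 < g0 by rewrite mulr_gt0 ?expR_gt0 // divr_gt0 // exprn_gt0 //; clear -s4; lra.
have h0 : 0 <= h by rewrite mulr_ge0 ?expR_ge0 // exprn_ge0 //; clear -s4; lra.
have gge0 u : 0 <= g u by apply: mean_ge0 => // x y; rewrite ler0n.
have M_ge : m%:R ^+ 2 * g0 <= M.
  rewrite -natrX -mulnn -cA mulr_natl -sumr_const; exact: ler_sum.
have m2g : 0 < m%:R ^+ 2 * g0 by rewrite mulr_gt0 // exprn_gt0 // ltr0n.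
have M0 : 0 < M by apply: lt_le_trans M_ge.
have TT01 u x y : T u x y * T u x y = T u x y by rewrite /T; case: tame; rewrite ?mulr1 ?mulr0.
have cov u v : u \in A -> v \in A -> mean p (fun x y => T u x y * T v x y) <=
    g u * g v + ((u == v)%:R * g u + ((u.1 == v.1)%:R * h + (u.2 == v.2)%:R * h)).
  move=> uA vA; have [u1 u2 uu u1V u2V] := Aprop u uA; have [v1 v2 vv v1V v2V] := Aprop v vA.
  have nn : 0 <= g u * g v by rewrite mulr_ge0.
  have bh (b : bool) : 0 <= b%:R * h by rewrite mulr_ge0 ?ler0n.
  have ne12 (a b : 'I_n) : a \in L1 -> b \in L2 -> a != b.
    by move=> a1 b2; apply: contraTneq b2 => <-; rewrite (disjointFr L12 a1).
  case: (eqVneq u v) => [<-|uv].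
    rewrite (eq_mean p (TT01 u)) -/(g u) mul1r addrCA lerDl.
    by apply: addr_ge0; [exact: mulr_ge0|apply: addr_ge0; exact: bh].
  rewrite mulr0n mul0r add0r; have [e1|e1] := eqVneq u.1 v.1.
    have e2 : u.2 != v.2.
      by apply: contraNneq uv => e2; apply/eqP; move: e1 e2; case: (u) (v) => a b [c d] /= -> ->.
    rewrite mul1r (negPf e2) mulr0n mul0r addr0; apply: le_trans (_ : h <= _); last by rewrite lerDr.
    have := @tame_pair_le R p n V t u.1 u.2 v.2 pp uu _ e2 u1V u2V v2V.
    by rewrite /T -e1; apply; rewrite e1.
  have [e2|e2] := eqVneq u.2 v.2.
    rewrite mulr0n mul0r add0r mul1r; apply: le_trans (_ : h <= _); last by rewrite lerDr.
    have := @tame_pair_le R p n V t u.2 u.1 v.1 pp _ _ e1 u2V u1V v1V.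
    rewrite eq_sym => /(_ uu); rewrite {1}e2 eq_sym => /(_ vv).
    apply: le_trans; rewrite le_eqVlt; apply/orP; left; apply/eqP; apply: eq_mean => x y.
    by rewrite /T -e2 [tame p V t u.1 u.2 x y]tameC [tame p V t v.1 u.2 x y]tameC.
  rewrite !mulr0n !mul0r !addr0 /g -(@mean_indep _ _ _ (pair_edges V u.1 u.2) (pair_edges V v.1 v.2)) //.
  - exact: tame_depends.
  - exact: tame_depends.
  - move=> e; apply: pair_edges_disjoint => //; first exact: ne12.
    by rewrite eq_sym; apply: ne12.
pose NG x y := \sum_(u in A) T u x y.
pose NB x y := \sum_(u in A) T u x y * S u x y.
have var : mean p (fun x y => (NG x y - M) ^+ 2) <= M + 2 * m%:R ^+ 3 * h.
  have -> : mean p (fun x y => (NG x y - M) ^+ 2) =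
      \sum_(u in A) \sum_(v in A) mean p (fun x y => T u x y * T v x y) - M ^+ 2.
    transitivity (mean p (fun x y => \sum_(u in A) \sum_(v in A) T u x y * T v x y +
       ((- 2 * M) * NG x y + M ^+ 2))).
      by apply: eq_mean => x y; rewrite -big_distrlr /= -/(NG x y); ring.
    rewrite meanD meanD meanZ mean_cst // mean_sum.
    have -> : mean p NG = M by rewrite mean_sum.
    under eq_bigr => u _ do rewrite mean_sum.
    by ring.
  apply: (@le_trans _ _ (\sum_(u in A) \sum_(v in A) (g u * g v + ((u == v)%:R * g u +
      ((u.1 == v.1)%:R * h + (u.2 == v.2)%:R * h))) - M ^+ 2)).
    by rewrite lerD2r; apply: ler_sum => u uA; apply: ler_sum => v vA; exact: cov.
  under eq_bigr => u uA do rewrite !big_split /=.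
  rewrite !big_split /= -big_distrlr /= -/M -expr2 [leLHS]addrC addKr.
  have e1 : \sum_(u in A) \sum_(v in A) (u == v)%:R * g u = M.
    apply: eq_bigr => u uA; rewrite (bigD1 u) //= eqxx mul1r big1 ?addr0 // => v /andP[_ vu].
    by rewrite eq_sym (negPf vu) mul0r.
  have AE F : \sum_(u in A) F u = \sum_(i in L1) \sum_(j in L2) F (i, j) :> R.
    by rewrite pair_big /=; apply: eq_big => [[i j]|[i j] _] //=; rewrite !inE.
  have e2 : \sum_(u in A) \sum_(v in A) (u.1 == v.1)%:R * h = m%:R ^+ 3 * h.
    have in2 u : u \in A -> \sum_(v in A) (u.1 == v.1)%:R * h = m%:R * h.
      move=> uA; have [u1 u2 _ _ _] := Aprop u uA.
      rewrite AE (bigD1 u.1) //= [X in _ + X]big1 ?addr0 => [|i /andP[_ iu]]; last first.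
        by rewrite big1 // => j _; rewrite eq_sym (negPf iu) mul0r.
      by rewrite eqxx mul1r sumr_const cL2 mulr_natl.
    rewrite (eq_bigr _ in2) sumr_const cA -[LHS]mulr_natl natrM; ring.
  have e3 : \sum_(u in A) \sum_(v in A) (u.2 == v.2)%:R * h = m%:R ^+ 3 * h.
    have in2 u : u \in A -> \sum_(v in A) (u.2 == v.2)%:R * h = m%:R * h.
      move=> uA; have [u1 u2 _ _ _] := Aprop u uA.
      rewrite AE exchange_big (bigD1 u.2) //= [X in _ + X]big1 ?addr0 => [|i /andP[_ iu]]; last first.
        by rewrite big1 // => j _; rewrite eq_sym (negPf iu) mul0r.
      by rewrite eqxx mul1r sumr_const cL1 mulr_natl.
    rewrite (eq_bigr _ in2) sumr_const cA -[LHS]mulr_natl natrM; ring.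
  rewrite e1 e2 e3 le_eqVlt; apply/orP; left; apply/eqP; ring.
have WV u : u \in A -> [/\ u.1 \notin W u, u.2 \notin W u, [disjoint V & W u]%B,
    (V :|: W u)%SET = (~: [set u.1; u.2])%SET & (#|W u| <= m + m)%N].
  move=> uA; have [u1 u2 uu u1V u2V] := Aprop u uA; split.
  - by rewrite !inE eqxx.
  - by rewrite !inE eqxx orbT.
  - rewrite disjoint_subset; apply/fintype.subsetP => a; rewrite !inE => /negPf ->.
    by rewrite andbF.
  - apply/setP => a; rewrite !inE.
    case: (eqVneq a u.1) => [->|_]; first by rewrite u1.
    case: (eqVneq a u.2) => [->|_]; first by rewrite u2 orbT.
    by case: (a \in L1); case: (a \in L2).
  - apply: leq_trans (subset_leq_card (finset.subsetDl _ _)) _.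
    by rewrite cardsU cL1 cL2 leq_subr.
have spoiled : mean p NB <= 32 * q * m%:R * M.
  rewrite mean_sum mulr_sumr; apply: ler_sum => u uA.
  have [u1 u2 uu u1V u2V] := Aprop u uA; have [w1 w2 VW _ cW] := WV u uA.
  rewrite (@mean_indep _ _ _ (pair_edges V u.1 u.2) (pair_edges (W u) u.1 u.2)) //.
  - rewrite mulrC (ler_wpM2r (gge0 u)) //; apply: le_trans (swap_prod_small_le pp uu w1 w2) _.
    rewrite -/q; have : #|W u|%:R <= m%:R + m%:R :> R by rewrite -natrD ler_nat.
    by move=> /(ler_wpM2l q0); clear; lra.
  - exact: tame_depends.
  - exact: small_depends.
  - by move=> e; apply: pair_edges_disjoint_sets.
have count x y : NG x y - NB x y <= #|cheap p (expR (- (2 * t)) / 4) x y|%:R.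
  pose good u := tame p V t u.1 u.2 x y && ~~ (swap_prod p (W u) u.1 u.2 x y < 2^-1)%R.
  have -> : NG x y - NB x y = #|[set u in A | good u]%SET|%:R.
    rewrite /NG /NB -sumrB -sum1dep_card natr_sum big_mkcondr /=.
    apply: eq_bigr => u _; rewrite /T /S /good; case: tame; case: (_ < _)%R;
      by rewrite /= ?mul0r ?mulr0 ?mulr1 ?subr0 ?subrr.
  rewrite ler_nat -(card_in_imset (f := fun u => tperm u.1 u.2)).
    apply: subset_leq_card; apply/fintype.subsetP => tau /imsetP[u]; rewrite inE => /andP[uA /andP[hT hS]] ->.
    have [u1 u2 uu u1V u2V] := Aprop u uA; have [_ _ VW VWE _] := WV u uA.
    exact: tame_cheap VWE hT hS.
  move=> u v; rewrite inE => /andP[/Aprop[u1 u2 uu _ _] _]; rewrite inE => /andP[/Aprop[v1 v2 vv _ _] _].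
  have ne12 (a b : 'I_n) : a \in L1 -> b \in L2 -> a != b.
    by move=> a1 b2; apply: contraTneq b2 => <-; rewrite (disjointFr L12 a1).
  move=> /permP tE; have := tE u.1; rewrite tpermL.
  case: tpermP => [e1 e2|e1|_ _ e2].
  - by move: e1 e2; case: (u) (v) => a b [c d] /= -> ->.
  - by have := ne12 _ _ u1 v2; rewrite e1 eqxx.
  - by move: uu; rewrite e2 eqxx.
apply: (@le_trans _ _ (mean p (fun x y => 4 / M ^+ 2 * (NG x y - M) ^+ 2 + 4 / M * NB x y))).
  apply: ler_mean => // x y; have := count x y; move: #|_|%:R => c hc.
  have NB0 : 0 <= NB x y.
    by apply: sumr_ge0 => u _; rewrite mulr_ge0 // /T /S ?ler0n.
  have a1 : 0 <= 4 / M * NB x y by rewrite mulr_ge0 // divr_ge0 // ltW.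
  have a2 : 0 <= 4 / M ^+ 2 * (NG x y - M) ^+ 2 by rewrite mulr_ge0 ?sqr_ge0 // divr_ge0 // sqr_ge0.
  case: ltP => /= hm; last by rewrite addr_ge0.
  have [hB|hB] := leP (M / 4) (NB x y).
    have : 1 <= 4 / M * NB x y.
      by rewrite mulrAC ler_pdivlMr //; clear -hB; lra.
    by clear -a2; lra.
  have : 1 <= 4 / M ^+ 2 * (NG x y - M) ^+ 2.
    rewrite mulrAC ler_pdivlMr ?exprn_gt0 // mul1r.
    have : M / 2 <= M - NG x y by clear -hB hm M_ge hc; lra.
    clear -M0; nra.
  by clear -a1; lra.
rewrite meanD !meanZ.
have M2 : 0 < M ^+ 2 by rewrite exprn_gt0.
have b1 : 4 / M * mean p NB <= 128 * q * m%:R.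
  rewrite mulrAC ler_pdivrMr //; move: spoiled; clear; lra.
have b2 : 4 / M ^+ 2 * mean p (fun x y => (NG x y - M) ^+ 2) <=
    4 / (m%:R ^+ 2 * g0) + 8 * h / (m%:R * g0 ^+ 2).
  apply: (@le_trans _ _ (4 / M ^+ 2 * (M + 2 * m%:R ^+ 3 * h))).
    by rewrite ler_wpM2l // divr_ge0 // ltW.
  rewrite mulrDr; apply: lerD.
    have -> : 4 / M ^+ 2 * M = 4 / M by field; rewrite gt_eqF.
    by rewrite ler_pM2l // lef_pV2 ?posrE.
  have mm : 0 < m%:R :> R by rewrite ltr0n.
  have -> : 8 * h / (m%:R * g0 ^+ 2) = 8 * m%:R ^+ 3 * h / (m%:R ^+ 2 * g0) ^+ 2.
    by field; rewrite !gt_eqF.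
  have -> : 4 / M ^+ 2 * (2 * m%:R ^+ 3 * h) = 8 * m%:R ^+ 3 * h / M ^+ 2.
    by field; rewrite gt_eqF.
  have k0 : 0 <= 8 * m%:R ^+ 3 * h by apply: mulr_ge0 => //; rewrite mulr_ge0 // exprn_ge0 // ltW.
  rewrite (ler_wpM2l k0) // lef_pV2 ?posrE ?exprn_gt0 //.
  by rewrite ler_sqr ?nnegrE // ltW.
exact: lerD b2 b1.
Qed.

(** * Converse *)

(** The probability that an estimator is exactly right, as a finite sum: for each
    observed pair [(a, b)] only the latent permutation [hat a b] counts. *)
Definition success (R : realType) (p : bool -> bool -> R) (n : nat) (hat : estimator n) : R :=
  (n`!%:R)^-1 * \sum_a \sum_b mass p (relabel (hat a b) a) b.

Lemma relabel_bij (n : nat) (s : 'S_n) : {on predT, bijective (@relabel n s)}.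
Proof.
by exists (relabel s^-1%g) => x _; [exact: relabelK|exact: relabelVK].
Qed.

Lemma sum_relabel (R : realType) (n : nat) (s : 'S_n) (F : adjvec n -> R) :
  \sum_a F (relabel s a) = \sum_x F x.
Proof. by rewrite [RHS](reindex (@relabel n s)) //; apply: relabel_bij. Qed.

(** Given the latent permutation, the aligned pair has the law [mass p] whatever
    the permutation is; averaging over the permutation removes it. *)
Lemma mean_averaged (R : realType) (p : bool -> bool -> R) (n : nat) (F : adjvec n -> adjvec n -> R) :
  (n`!%:R)^-1 * (\sum_a \sum_b \sum_(s : 'S_n) mass p (relabel s a) b * F (relabel s a) b) = mean p F.
Proof.
have -> : \sum_a \sum_b \sum_(s : 'S_n) mass p (relabel s a) b * F (relabel s a) b =
    \sum_(s : 'S_n) mean p F.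
  under eq_bigr => a _ do rewrite exchange_big /=.
  rewrite exchange_big /=; apply: eq_bigr => s _.
  exact: (sum_relabel s (fun x => \sum_b mass p x b * F x b)).
rewrite sumr_const -[#|_|]/(#|'S_n|) card_Sn -[mean p F *+ _]mulr_natl mulrA mulVf ?mul1r //.
Qed.

(** A posterior mass that is matched up to the factor [c] by [K] others is at
    most [(c * K)^-1]. *)
Lemma success_le (R : realType) (p : bool -> bool -> R) (n : nat) (hat : estimator n) (c K : R) :
  law p -> 0 < c -> 0 < K ->
  success p hat <= mean p (fun x y : adjvec n => ((#|cheap p c x y|%:R < K)%R)%:R) + (c * K)^-1.
Proof.
move=> lp c0 K0; have [p0 _] := lp.
pose Z := fun a b : adjvec n => \sum_(s : 'S_n) mass p (relabel s a) b.
pose few := fun x y : adjvec n => ((#|cheap p c x y|%:R < K)%R)%:R : R.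
have m0 (x y : adjvec n) : 0 <= mass p x y by exact: mass_ge0.
have Z0 a b : 0 <= Z a b by apply: sumr_ge0.
have f0 (n1 : nat) : 0 <= n1%:R :> R by exact: ler0n.
have nf : 0 < (n`!%:R)^-1 :> R by rewrite invr_gt0 ltr0n fact_gt0.
have Zmean : (n`!%:R)^-1 * \sum_a \sum_b Z a b = 1.
  rewrite -[RHS](mean_cst (vpair n) 1 lp) -mean_averaged; congr (_ * _).
  by apply: eq_bigr => a _; apply: eq_bigr => b _; apply: eq_bigr => s _; rewrite mulr1.
rewrite /success -[mean p _]/(mean p few) -[X in _ <= _ + X]mulr1 -[X in _ <= _ + _ * X]Zmean -(mean_averaged p few) [(c * K)^-1 * _]mulrCA -mulrDr ler_wpM2l ?(ltW nf) //.
rewrite mulr_sumr -big_split; apply: ler_sum => a _ /=.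
rewrite mulr_sumr -big_split; apply: ler_sum => b _ /=.
set x := relabel (hat a b) a.
have fewS : 0 <= \sum_(s : 'S_n) mass p (relabel s a) b * few (relabel s a) b.
  by apply: sumr_ge0 => s _; rewrite mulr_ge0.
have cK : 0 < c * K by rewrite mulr_gt0.
have [h|h] := ltP #|cheap p c x b|%:R K.
  rewrite (bigD1 (hat a b)) //= -/x /few h mulr1 -addrA lerDl addr_ge0 //.
    by apply: sumr_ge0 => s _; rewrite mulr_ge0.
  by rewrite mulr_ge0 // invr_ge0 ltW.
apply: le_trans (_ : (c * K)^-1 * Z a b <= _); last by rewrite lerDr.
rewrite mulrC ler_pdivlMr // mulrC.
apply: (@le_trans _ _ (\sum_(tau in cheap p c x b) mass p (relabel tau x) b)).
  apply: (@le_trans _ _ (\sum_(tau in cheap p c x b) c * mass p x b)).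
    rewrite sumr_const -[leRHS]mulr_natr mulrAC ler_wpM2l // mulr_ge0 // ltW //.
  by apply: ler_sum => tau; rewrite inE.
apply: (@le_trans _ _ (\sum_(tau : 'S_n) mass p (relabel tau x) b)).
  by rewrite [leRHS](bigID (mem (cheap p c x b))) /= lerDl; apply: sumr_ge0.
rewrite /Z [leRHS](reindex_inj (mulIg (hat a b))) /= le_eqVlt; apply/orP; left; apply/eqP.
by apply: eq_bigr => tau _; rewrite /x relabelM.
Qed.

Lemma card_ord_lt (n m : nat) : (m <= n)%N -> #|[set i : 'I_n | (i < m)%N]%SET| = m.
Proof.
move=> mn; rewrite -sum1dep_card (big_ord_narrow mn) /= sum_nat_const card_ord muln1 //.
Qed.

Lemma expR_le_pow (R : realType) (q : R) (k : nat) : 0 <= q <= 4^-1 ->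
  expR (- (2 * q * (1 + 4 * q)) * k%:R) <= (1 - 2 * q) ^+ k.
Proof.
move=> /andP[q0 q4]; have q2 : 0 < 1 - 2 * q by lra.
rewrite mulrC expRM_natl lerXn2r ?nnegrE ?expR_ge0 // ?(ltW q2) //.
rewrite -ler_ln ?posrE ?expR_gt0 // expRK.
apply: le_trans (ln_ge1BV q2).
rewrite -subr_ge0; have -> : 1 - (1 - 2 * q)^-1 - - (2 * q * (1 + 4 * q)) =
   4 * q ^+ 2 * (1 - 4 * q) / (1 - 2 * q) by field; rewrite gt_eqF.
rewrite divr_ge0 ?(ltW q2) // mulr_ge0 ?subr_ge0 ?mulr_ge0 ?sqr_ge0 //; lra.
Qed.
(** The number of cheap transpositions is typically [m ^ 2 * n ^ (-2 (1 - eps))], the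
    loss [expR t] being subpolynomial. It exceeds the loss in likelihood, and the
    pairs sharing a vertex contribute at most a fraction [n ^ (1 - eps) / m] to the
    relative variance; the last term is the probability that the [2 * m] set-aside
    vertices spoil a transposition. *)
Lemma success_bound (R : realType) (p : bool -> bool -> R) (n m : nat) (hat : estimator n) (t L eps : R)
    (q := sgap p ^+ 2) :
  assoc_law p -> (2 * m <= n)%N -> (0 < m)%N -> 0 < t -> 64 * q * n%:R <= t ^+ 2 ->
  n%:R * q <= (1 - eps) * L -> 16 * n%:R * q ^+ 2 <= 1 ->
  success p hat <= 200 * expR (3 * t + 1 + 2 * (1 - eps) * L) / m%:R ^+ 2 +
    32 * expR (4 * t + 1 + (1 - eps) * L) / m%:R + 128 * q * m%:R.
Proof.
move=> pp mn m0 t0 ht hq hq2; have [lp _ _] := pp; have [s0 s4] := sgap_bounds pp.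
rewrite -/q in s4; have q0 : 0 <= q by rewrite sqr_ge0.
pose L1 := [set i : 'I_n | (i < m)%N]%SET.
pose L2 := ([set i : 'I_n | (i < 2 * m)%N] :\: L1)%SET.
have cL1 : #|L1| = m by rewrite card_ord_lt //; lia.
have L1s : L1 \subset [set i : 'I_n | (i < 2 * m)%N]%SET.
  by apply/fintype.subsetP => i; rewrite !inE; lia.
have cL2 : #|L2| = m.
  by rewrite cardsD (finset.setIidPr L1s) cL1 card_ord_lt //; lia.
have L12 : [disjoint L1 & L2]%B.
  by rewrite disjoint_subset; apply/fintype.subsetP => i iL; rewrite !inE in iL *; rewrite iL.
pose V := (~: (L1 :|: L2))%SET.
have VN : #|V|%:R <= n%:R :> R by rewrite ler_nat; have := max_card (mem V); rewrite card_ord.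
have htV : 64 * q * #|V|%:R <= t ^+ 2 by apply: le_trans ht; rewrite ler_wpM2l // mulr_ge0.
have := few_cheap_le pp L12 cL1 cL2 m0 t0 htV.
rewrite -/q -/V; set g0 := expR (- t) * _; set h := expR (2 * t) * _ => few.
have mm : 0 < m%:R :> R by rewrite ltr0n.
have m2 : 0 < m%:R ^+ 2 :> R by rewrite exprn_gt0.
set N := #|V|%:R in VN htV.
pose G := expR (- (t + 2 * (1 - eps) * L + 1)) / 2.
have N0 : 0 <= N by rewrite ler0n.
have nq2 : 0 <= 16 * n%:R * q ^+ 2 by rewrite mulr_ge0 ?sqr_ge0 // mulr_ge0.
have q04 : 0 <= q <= 4^-1 by rewrite q0.
have gG : G <= g0.
  rewrite /G /g0 mulrA ler_pM2r ?invr_gt0 //.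
  apply: le_trans (ler_wpM2l (expR_ge0 _) (expR_le_pow #|V| q04)).
  rewrite -expRD ler_expR -/N.
  have a1 : q * N <= n%:R * q by rewrite mulrC ler_wpM2r.
  have a2 : q ^+ 2 * N <= n%:R * q ^+ 2 by rewrite mulrC ler_wpM2r ?sqr_ge0.
  clear -a1 a2 hq hq2; lra.
have G0 : 0 < G by rewrite divr_gt0 ?expR_gt0.
have g00 : 0 < g0 by apply: lt_le_trans gG.
have hg : h / g0 ^+ 2 <= 4 * expR (4 * t + 1 + (1 - eps) * L).
  have u0 : 0 < 1 - 2 * q by clear -s4; lra.
  have P0 : 0 < (1 - 2 * q) ^+ #|V| by rewrite exprn_gt0.
  rewrite ler_pdivrMr ?exprn_gt0 // /h /g0 exprMn expr_div_n.
  have e3 : 0 <= 1 - 3 * q by clear -s4; lra.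
  have h3 : (1 - 3 * q) ^+ #|V| <= expR (- 3 * q * N).
    rewrite [_ * N]mulrC expRM_natl lerXn2r ?nnegrE ?expR_ge0 //.
    by apply: le_trans (expR_ge1Dx _); clear; lra.
  have h4 : expR (- (2 * q * (1 + 4 * q)) * N) ^+ 2 <= ((1 - 2 * q) ^+ #|V|) ^+ 2.
    by rewrite lerXn2r ?nnegrE ?expR_ge0 ?(ltW P0) // expR_le_pow.
  apply: le_trans (ler_wpM2l (expR_ge0 _) h3) _.
  set E := expR (4 * t + 1 + _); set D := ((1 - 2 * q) ^+ #|V|) ^+ 2 in h4 *.
  have -> : 4 * E * (expR (- t) ^+ 2 * (D / 2 ^+ 2)) = E * expR (- t) ^+ 2 * D by field.
  apply: le_trans (ler_wpM2l _ h4); last by rewrite mulr_ge0 ?exprn_ge0 ?expR_ge0.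
  rewrite -!expRM_natl -!expRD ler_expR.
  have a1 : q * N <= n%:R * q by rewrite mulrC ler_wpM2r.
  have a2 : q ^+ 2 * N <= n%:R * q ^+ 2 by rewrite mulrC ler_wpM2r ?sqr_ge0.
  clear -a1 a2 hq hq2; lra.
have b1 : 4 / (m%:R ^+ 2 * g0) <= 8 * expR (t + 2 * (1 - eps) * L + 1) / m%:R ^+ 2.
  have -> : 8 * expR (t + 2 * (1 - eps) * L + 1) / m%:R ^+ 2 = 4 / (m%:R ^+ 2 * G).
    rewrite /G expRN; field; by rewrite !gt_eqF ?expR_gt0.
  have k1 : 0 < m%:R ^+ 2 * G by exact: mulr_gt0.
  have k2 : 0 < m%:R ^+ 2 * g0 by exact: mulr_gt0.
  by rewrite ler_pM2l // lef_pV2 ?posrE // (ler_pM2l m2).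
have b2 : 8 * h / (m%:R * g0 ^+ 2) <= 32 * expR (4 * t + 1 + (1 - eps) * L) / m%:R.
  have -> : 8 * h / (m%:R * g0 ^+ 2) = 8 / m%:R * (h / g0 ^+ 2) by field; rewrite !gt_eqF.
  have -> : 32 * expR (4 * t + 1 + (1 - eps) * L) / m%:R =
    8 / m%:R * (4 * expR (4 * t + 1 + (1 - eps) * L)) by field; rewrite gt_eqF.
  by rewrite ler_wpM2l // divr_ge0 // ltW.
have c0 : 0 < expR (- (2 * t)) / 4 by rewrite divr_gt0 ?expR_gt0.
have K0 : 0 < m%:R ^+ 2 * g0 / 4 by rewrite divr_gt0 // mulr_gt0.
have := success_le hat lp c0 K0 => suc.
have b3 : (expR (- (2 * t)) / 4 * (m%:R ^+ 2 * g0 / 4))^-1 <=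
    32 * expR (3 * t + 1 + 2 * (1 - eps) * L) / m%:R ^+ 2.
  have -> : 3 * t + 1 + 2 * (1 - eps) * L = 2 * t + (t + 2 * (1 - eps) * L + 1) by ring.
  have -> : 32 * expR (2 * t + (t + 2 * (1 - eps) * L + 1)) / m%:R ^+ 2 =
     (expR (- (2 * t)) / 4 * (m%:R ^+ 2 * G / 4))^-1.
    rewrite /G; move: (t + 2 * (1 - eps) * L + 1) => a.
    by rewrite !expRN expRD; field; rewrite !gt_eqF ?expR_gt0.
  have K0' : 0 < m%:R ^+ 2 * G / 4 by rewrite divr_gt0 // mulr_gt0.
  rewrite lef_pV2 ?posrE; [|exact: mulr_gt0|exact: mulr_gt0].
  by rewrite (ler_pM2l c0) ler_pM2r ?invr_gt0 // (ler_pM2l m2).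
have b4 : expR (t + 2 * (1 - eps) * L + 1) <= expR (3 * t + 1 + 2 * (1 - eps) * L).
  by rewrite ler_expR; clear -t0; lra.
have b5 : 8 * expR (t + 2 * (1 - eps) * L + 1) / m%:R ^+ 2 <=
    8 * expR (3 * t + 1 + 2 * (1 - eps) * L) / m%:R ^+ 2.
  by rewrite ler_pM2r ?invr_gt0 // ler_pM2l.
have b6 : 0 <= expR (3 * t + 1 + 2 * (1 - eps) * L) / m%:R ^+ 2.
  by rewrite divr_ge0 ?expR_ge0 // ltW.
apply: le_trans suc _; apply: le_trans (lerD few b3) _.
apply: le_trans (lerD (lerD (lerD (le_trans b1 b5) b2) (lexx _)) (lexx _)) _.
clear -b6; lra.
Qed.

(** Taking [m] close to [n ^ (1 - eps / 4)] makes [n ^ (1 - eps) / m] and [m / n]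
    both polynomially small, and [t] of order [Num.sqrt (ln n)] covers the tilted
    standard deviation while [expR t] stays subpolynomial. *)
Lemma success_asymptotic (R : realType) (eps : R) : 0 < eps <= 1 ->
  exists C n0 : R, [/\ 0 < C, 0 < n0 & forall (n : nat) (p : bool -> bool -> R) (hat : estimator n),
    n0 <= ln n%:R -> 16 * ln n%:R ^+ 2 <= n%:R :> R -> assoc_law p ->
    n%:R * sgap p ^+ 2 <= (1 - eps) * ln n%:R ->
    success p hat <= C * expR (- (eps / 8 * ln n%:R))].
Proof.
move=> /andP[eps0 eps1].
pose n0 := 4 / eps + (64 * 16 / eps) ^+ 2.
have n00 : 0 < n0 by rewrite /n0 addr_gt0 ?exprn_gt0 ?divr_gt0 ?mulr_gt0.
exists (5 * 32 * 32 / eps), n0; split => //; first by rewrite divr_gt0 // !mulr_gt0.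
move=> n p hat; set L := ln n%:R => nL Ln pp hq.
have L0 : 0 < L by apply: lt_le_trans nL.
have eL : 4 <= eps * L.
  by rewrite mulrC -ler_pdivrMr //; apply: le_trans nL; rewrite lerDl sqr_ge0.
have n_gt0 : (0 < n)%N.
  rewrite lt0n; apply: contraTneq L0 => nz.
  by rewrite /L nz ln0 ?ltxx.
have nE : n%:R = expR L :> R by rewrite /L lnK // posrE ltr0n.
set q := sgap p ^+ 2 in hq *.
have q0 : 0 <= q by rewrite sqr_ge0.
have nn0 : 0 < n%:R :> R by rewrite ltr0n.
have nqL : n%:R * q <= L.
  apply: le_trans hq _; rewrite ler_piMl ?(ltW L0) //; clear -eps0; lra.
pose s := Num.sqrt L; have sE : s ^+ 2 = L by rewrite sqr_sqrtr // ltW.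
have s0 : 0 < s by rewrite sqrtr_gt0.
pose t := 8 * s; have t0 : 0 < t by rewrite mulr_gt0.
have tL : 16 * t * 8 <= eps * L.
  have : 64 * 16 / eps <= s.
    rewrite -ler_sqr ?nnegrE ?(ltW s0) ?divr_ge0 ?mulr_ge0 ?(ltW eps0) // sE.
    by apply: le_trans nL; rewrite lerDr divr_ge0 // ltW.
  rewrite ler_pdivrMr // => h; rewrite -sE /t.
  have := ler_wpM2r (ltW s0) h; clear; lra.
pose u := expR ((1 - eps / 4) * L).
pose m := Num.truncn u.
have u0 : 0 < u by exact: expR_gt0.
have u1 : 1 <= u by rewrite -expR0 ler_expR mulr_ge0 ?(ltW L0) //; clear -eps1; lra.
have m1 : m%:R <= u by rewrite truncn_le ltW.
have m2 : u < m%:R + 1 by rewrite natr1 truncnS_gt.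
have m0 : (0 < m)%N by rewrite truncn_gt0.
have mm : 0 < m%:R :> R by rewrite ltr0n.
have m3 : u / 2 <= m%:R.
  have : 1 <= m%:R :> R by rewrite ler1n.
  by clear -m2; lra.
have un : u * expR (eps / 4 * L) = n%:R by rewrite -expRD nE; congr expR; ring.
have mn : (2 * m <= n)%N.
  rewrite -(ler_nat R) natrM -un.
  have : 2 <= expR (eps / 4 * L) by apply: le_trans (expR_ge1Dx _); clear -eL; lra.
  move=> h; have := ler_wpM2l (ltW u0) h; clear -m1; lra.
have ht : 64 * q * n%:R <= t ^+ 2.
  by rewrite /t exprMn sE; clear -nqL; lra.
have hq2 : 16 * n%:R * q ^+ 2 <= 1.
  have : 16 * (n%:R * q * (n%:R * q)) <= n%:R.
    apply: le_trans Ln; rewrite ler_pM2l // expr2 ler_pM // mulr_ge0 // ltW.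
  have -> : 16 * (n%:R * q * (n%:R * q)) = (16 * n%:R * q ^+ 2) * n%:R by ring.
  by rewrite ger_pMl.
have := success_bound hat pp mn m0 t0 ht hq hq2; rewrite -/q => bound.
set v := expR (- (eps / 8 * L)).
have v0 : 0 < v by exact: expR_gt0.
have e1 : expR 1 <= 4 :> R.
  have h : expR 2^-1 <= 1 + 2^-1 + 2 * 2^-1 ^+ 2 :> R by apply: expR_le_quad.
  have : expR 1 = expR 2^-1 * expR 2^-1 :> R by rewrite -expRD; congr expR; field.
  move=> ->; have := ler_pM (expR_ge0 _) (expR_ge0 _) h h; clear; lra.
have b1 : 200 * expR (3 * t + 1 + 2 * (1 - eps) * L) / m%:R ^+ 2 <= 3200 * v.
  have u2 : u ^+ 2 / 4 <= m%:R ^+ 2.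
    have -> : u ^+ 2 / 4 = (u / 2) ^+ 2 by field.
    by rewrite lerXn2r ?nnegrE ?(ltW mm) // divr_ge0 // ltW.
  rewrite ler_pdivrMr ?exprn_gt0 //.
  have h1 : expR (3 * t + 1 + 2 * (1 - eps) * L) <= 4 * (v * u ^+ 2).
    have -> : 3 * t + 1 + 2 * (1 - eps) * L = 1 + (3 * t + 2 * (1 - eps) * L) by ring.
    rewrite expRD ler_pM ?expR_ge0 // /v /u -expRM_natl -expRD ler_expR.
    by clear -tL t0 L0 eps0; have := mulr_gt0 eps0 L0; lra.
  have := ler_wpM2l (ltW v0) u2; clear -h1; lra.
have b2 : 32 * expR (4 * t + 1 + (1 - eps) * L) / m%:R <= 256 * v.
  rewrite ler_pdivrMr //.
  have h1 : expR (4 * t + 1 + (1 - eps) * L) <= 4 * (v * u).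
    have -> : 4 * t + 1 + (1 - eps) * L = 1 + (4 * t + (1 - eps) * L) by ring.
    rewrite expRD ler_pM ?expR_ge0 // /v /u -expRD ler_expR.
    by clear -tL t0 L0 eps0; have := mulr_gt0 eps0 L0; lra.
  have := ler_wpM2l (ltW v0) m3; clear -h1; lra.
have b3 : 128 * q * m%:R <= 1024 / eps * v.
  have h1 : q * m%:R <= L * expR (- (eps / 4 * L)).
    apply: (@le_trans _ _ (q * u)); first by rewrite ler_wpM2l.
    have -> : u = n%:R * expR (- (eps / 4 * L)) by rewrite -un -mulrA -expRD subrr expR0 mulr1.
    by rewrite mulrA [q * _]mulrC ler_wpM2r ?expR_ge0.
  have h2 : eps * L <= 8 * expR (eps / 8 * L).
    by have := expR_ge1Dx (eps / 8 * L); clear; lra.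
  have h3 : expR (- (eps / 4 * L)) = v * v by rewrite /v -expRD; congr expR; field.
  have h4 : expR (eps / 8 * L) * v = 1 by rewrite /v -expRD subrr expR0.
  have h5 : eps * (L * (v * v)) <= 8 * v.
    have := ler_wpM2r (ltW (mulr_gt0 v0 v0)) h2.
    have -> : 8 * expR (eps / 8 * L) * (v * v) = 8 * v * (expR (eps / 8 * L) * v) by ring.
    by rewrite h4; clear; lra.
  have -> : 1024 / eps * v = 128 * (8 * v / eps) by field; rewrite gt_eqF.
  rewrite -mulrA ler_pM2l // ler_pdivlMr // mulrC.
  by apply: le_trans (ler_wpM2l (ltW eps0) h1) _; rewrite h3.
have h6 : v <= eps^-1 * v by rewrite ler_peMl ?(ltW v0) // invf_ge1.
apply: le_trans bound _; apply: le_trans (lerD (lerD b1 b2) b3) _.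
clear -h6 v0; lra.
Qed.

(** * From the probability space to the edge bits *)

Lemma prob_recovered (R : realType) (d : measure_display) (Omega : measurableType d)
    (P : probability Omega R) (n : nat) (p : bool -> bool -> R)
    (pi : Omega -> 'S_n) (A B : Omega -> adjvec n) (hat : estimator n) :
  correlated_graphs P p pi A B -> (0 < n)%N ->
  P [set w | overlap R (hat (A w) (B w)) (pi w) = 1] = (success p hat)%:E.
Proof.
move=> [mpi mA mB unif iid] n0.
have eq1 s t : overlap R s t = 1 <-> t = s :> 'S_n.
  rewrite /overlap; split=> [h|->]; last first.
    have -> : [set i : 'I_n | s i == s i]%SET = [set: 'I_n]%SET by apply/setP => i; rewrite !inE eqxx.
    by rewrite cardsT card_ord divff // pnatr_eq0 -lt0n.
  have : #|[set i : 'I_n | s i == t i]%SET| = n.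
    apply/eqP; rewrite -(eqr_nat R); apply/eqP.
    by move/(congr1 (fun z => z * n%:R)): h; rewrite divfK ?mul1r // pnatr_eq0 -lt0n.
  move=> c; apply/permP => i; apply/esym/eqP.
  have : [set i : 'I_n | s i == t i]%SET == [set: 'I_n]%SET.
    by rewrite eqEcard finset.subsetT cardsT card_ord c leqnn.
  by move/eqP/setP/(_ i); rewrite !inE.
pose F (u : adjvec n * adjvec n) : set Omega :=
  [set w | [/\ pi w = hat u.1 u.2, A w = u.1 & B w = u.2]].
have mF u : measurable (F u).
  rewrite (_ : F u = pi @^-1` [set hat u.1 u.2] `&` (A @^-1` [set u.1] `&` B @^-1` [set u.2])).
    by apply: measurableI => //; apply: measurableI.
  by apply/seteqP; split => w /=; [case|case=> ? []].
have PF u : P (F u) = ((n`!%:R)^-1 * mass p (relabel (hat u.1 u.2) u.1) u.2)%:E.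
  rewrite EFinM -(unif (hat u.1 u.2)) -iid; congr (P _).
  apply/seteqP; split => w /= [h1 h2 h3]; split=> //; first by rewrite h1 h2.
  by apply: (can_inj (@relabelK n (hat u.1 u.2))); rewrite -h2 h1.
have -> : [set w | overlap R (hat (A w) (B w)) (pi w) = 1] = \bigcup_(u in setT) F u.
  apply/seteqP; split => w /=; first by move/eq1 => h; exists (A w, B w).
  by case=> u _ [h1 h2 h3]; apply/eq1; rewrite h1 h2 h3.
rewrite measure_fin_bigcup //=; first last.
- by move=> u v _ _ [w [[_ h2 h3] [_ h2' h3']]]; rewrite [u]surjective_pairing [v]surjective_pairing -h2 -h3 h2' h3'.
have -> : [set: adjvec n * adjvec n] = [set` index_enum (adjvec n * adjvec n)%type].
  by apply/seteqP; split => u //= _; rewrite mem_index_enum.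
rewrite -fsbig_seq ?index_enum_uniq //.
under eq_bigr => u _ do rewrite PF.
rewrite sumEFin; congr EFin; rewrite /success pair_bigA mulr_sumr.
by apply: eq_bigr.
Qed.

(** If another permutation is latent, the estimator differs from it by a
    relabelling that does at least as well on the aligned pair. *)
Lemma success_ge (R : realType) (p : bool -> bool -> R) (n : nat) (hat : estimator n) :
  law p -> is_MLE hat ->
  1 - mean p (fun x y : adjvec n => (beaten x y)%:R) <= success p hat <= 1.
Proof.
move=> lp mle; have [p0 _] := lp.
have m0 (x y : adjvec n) : 0 <= mass p x y by exact: mass_ge0.
have nf : 0 <= (n`!%:R)^-1 :> R by rewrite invr_ge0 ler0n.
have one : (n`!%:R)^-1 * \sum_a \sum_b \sum_(s : 'S_n) mass p (relabel s a) b = 1.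
  rewrite -[RHS](mean_cst (vpair n) 1 lp) -mean_averaged; congr (_ * _).
  by apply: eq_bigr => a _; apply: eq_bigr => b _; apply: eq_bigr => s _; rewrite mulr1.
apply/andP; split; last first.
  rewrite -[leRHS]one /success ler_wpM2l //; apply: ler_sum => a _; apply: ler_sum => b _.
  by rewrite (bigD1 (hat a b)) //= lerDl sumr_ge0.
rewrite lerBlDr -[leLHS]one -mean_averaged /success -mulrDr ler_wpM2l //.
rewrite -big_split; apply: ler_sum => a _ /=; rewrite -big_split; apply: ler_sum => b _ /=.
rewrite (bigD1 (hat a b)) //= lerD2l [leRHS](bigD1 (hat a b)) //= -[leLHS]add0r lerD //.
  by rewrite mulr_ge0.
apply: ler_sum => s sh; suff -> : beaten (relabel s a) b by rewrite mulr1.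
apply/existsP; exists (hat a b * s^-1)%g; rewrite relabelM mulgKV mle andbT.
by apply: contra_neq sh => /(congr1 (fun z => (z * s)%g)); rewrite mulgKV mul1g.
Qed.

Lemma assoc_law_subsampling (R : realType) (p s : R) :
  0 < p <= 1 -> 0 < s <= 1 -> assoc_law (subsampling p s).
Proof.
move=> /andP[p0 p1] /andP[s0 s1]; rewrite /assoc_law /law big_bool2 /=.
have ps : 0 <= p * s by rewrite mulr_ge0 // ltW.
have s1' : 0 <= 1 - s by rewrite subr_ge0.
have q0 : 0 <= 1 - 2 * p * s + p * s ^+ 2.
  have : p ^+ 2 * s ^+ 2 <= p * s ^+ 2.
    by rewrite ler_wpM2r ?sqr_ge0 // expr2 ler_piMl // ltW.
  by have := sqr_ge0 (1 - p * s); clear; lra.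
split=> //; first split.
- by case=> [] [] //=; rewrite mulr_ge0 ?sqr_ge0 // ltW.
- by ring.
- rewrite -subr_ge0.
  have -> : (1 - 2 * p * s + p * s ^+ 2) * (p * s ^+ 2) - (p * s * (1 - s)) ^+ 2 = p * s ^+ 2 * (1 - p) by ring.
  apply: mulr_ge0; last by rewrite subr_ge0.
  by rewrite mulr_ge0 ?sqr_ge0 // ltW.
Qed.

Lemma subsampling_corr_law (R : realType) (p s : R) :
  0 < p < 1 -> 0 < s <= 1 ->
  [/\ 0 < p * s < 1, 0 < s * (1 - p) / (1 - p * s) <= 1 &
      subsampling p s = corr_law (p * s) (s * (1 - p) / (1 - p * s))].
Proof.
move=> /andP[p0 p1] /andP[s0 s1].
have ps0 : 0 < p * s by rewrite mulr_gt0.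
have ps1 : p * s < 1 by apply: le_lt_trans p1; rewrite ler_piMr // ltW.
have d0 : 0 < 1 - p * s by rewrite subr_gt0.
have qq : 0 < p * s < 1 by rewrite ps0.
split=> //.
  rewrite divr_gt0 ?mulr_gt0 ?subr_gt0 //= ler_pdivrMr // mul1r.
  by clear -s1; lra.
have [h1 h2 h3 h4] := kernE (s * (1 - p) / (1 - p * s)) qq.
apply/funext => a; apply/funext => b; rewrite /corr_law.
by case: a; case: b; rewrite ?h1 ?h2 ?h3 ?h4 /=; field; rewrite ?gt_eqF.
Qed.

Lemma ln_nat_growth (R : realType) (K : R) (n : nat) : 1 <= K -> 432 <= ln n%:R :> R ->
  27 * (K + 1) <= ln n%:R -> 16 * ln n%:R ^+ 2 <= n%:R :> R /\ K * ln n%:R <= n.-1%:R :> R.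
Proof.
move=> K1; set L := ln n%:R => h1 h2.
have n0 : (0 < n)%N.
  rewrite lt0n; apply: contraTneq h1 => nz.
  by rewrite -ltNge /L nz ln0 // ltr0n.
have nE : n%:R = expR (L / 3) ^+ 3 :> R.
  rewrite -expRM_natl mulrC divfK ?pnatr_eq0 // /L lnK // posrE ltr0n //.
have L0 : 0 < L by lra.
have cube : L ^+ 3 / 27 <= n%:R.
  rewrite nE; have -> : L ^+ 3 / 27 = (L / 3) ^+ 3 by field.
  rewrite lerXn2r ?nnegrE ?expR_ge0 //; first by rewrite divr_ge0 // ltW.
  by apply: le_trans (expR_ge1Dx _); rewrite lerDr.
have L2 := sqr_ge0 L.
split.
  apply: le_trans cube; rewrite ler_pdivlMr // exprS.
  by have := ler_wpM2r L2 h1; clear; lra.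
have nm : n%:R = n.-1%:R + 1 :> R by rewrite natr1 prednK.
have : (K + 1) * L <= L ^+ 3 / 27.
  rewrite ler_pdivlMr //; have l1 : 1 <= L by lra.
  have : 27 * (K + 1) * L <= L * L by rewrite ler_wpM2r // ltW.
  have : L * L <= L * L * L by rewrite ler_peMr // mulr_ge0 // ltW.
  by clear; lra.
move: cube; rewrite nm; clear -h1; lra.
Qed.

Lemma ln_nat_cvgy (R : realType) (K : R) : \forall n \near \oo, K <= ln n%:R.
Proof.
exists (Num.truncn (expR K)).+1 => // n /= hn.
have hK : expR K < n%:R.
  apply: lt_le_trans (truncnS_gt _) _; by rewrite ler_nat.
rewrite -[leLHS]expRK ler_ln ?posrE ?expR_gt0 // ?(ltW hK) //.
exact: lt_trans (expR_gt0 _) hK.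
Qed.
Lemma small_exp_ln (R : realType) (C a e : R) : 0 < C -> 0 < a -> 0 < e ->
  \forall n \near \oo, C * expR (- (a * ln n%:R)) <= e.
Proof.
move=> C0 a0 e0; have := ln_nat_cvgy (C / (e * a)); apply: filterS => n h.
rewrite expRN ler_pdivrMr ?expR_gt0 //.
have : C <= e * (a * ln n%:R) by rewrite mulrA mulrC -ler_pdivrMr // mulr_gt0.
move/le_trans; apply; rewrite ler_pM2l //.
by apply: le_trans (expR_ge1Dx _); rewrite lerDr.
Qed.

(** * The sharp threshold *)

Theorem theorem4 (R : realType) (eps : R) (heps : 0 < eps)
    (p s : nat -> R)
    (hp : forall n, 0 < p n <= 1) (hs : forall n, 0 < s n <= 1)
    (d : nat -> measure_display) (Omega : forall n, measurableType (d n))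
    (P : forall n, probability (Omega n) R)
    (pi : forall n, Omega n -> 'S_n) (A B : forall n, Omega n -> adjvec n)
    (hmodel : forall n, correlated_graphs (P n) (subsampling (p n) (s n))
                          (pi n) (A n) (B n)) :
  let p00 n := subsampling (p n) (s n) false false in
  let p01 n := subsampling (p n) (s n) false true in
  let p10 n := subsampling (p n) (s n) true false in
  let p11 n := subsampling (p n) (s n) true true in
  let thr n := n%:R * (Num.sqrt (p00 n * p11 n) - Num.sqrt (p01 n * p10 n)) ^+ 2 in
  let recovered (hatpi : forall n, estimator n) n :=
    [set w : Omega n |
      overlap R (hatpi n (A n w) (B n w)) (pi n w) = 1] in
  ((\forall n \near \oo, (1 + eps) * ln n%:R <= thr n) ->
     forall hatpi : forall n, estimator n, (forall n, is_MLE (hatpi n)) ->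
       P n (recovered hatpi n) @[n --> \oo] --> 1%:E)
  /\
  ((\forall n \near \oo, thr n <= (1 - eps) * ln n%:R) ->
     forall hatpi : forall n, estimator n,
       P n (recovered hatpi n) @[n --> \oo] --> 0%:E).
Proof.
move=> p00 p01 p10 p11 thr recovered.
pose sub n := subsampling (p n) (s n).
pose eps1 := Num.min eps 1.
have eps1P : 0 < eps1 <= 1 by rewrite lt_min heps ltr01 ge_min lexx orbT.
have eps1_le : eps1 <= eps by rewrite ge_min lexx.
have thrE n : thr n = n%:R * sgap (sub n) ^+ 2.
  have [[q0 _] pC _] := assoc_law_subsampling (hp n) (hs n).
  by rewrite /thr /sgap /p01 /p10 pC -expr2 sqrtr_sqr ger0_norm.
have prob hatpi n : (0 < n)%N -> P n (recovered hatpi n) = (success (sub n) (hatpi n))%:E.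
  by move=> n0; apply: prob_recovered.
have fin hatpi : \forall n \near \oo, P n (recovered hatpi n) \is a fin_num.
  by exists 1%N => // n /= n0; rewrite prob.
split=> hthr hatpi.
  move=> mle; have [n0 n00 bound] := mean_beaten_asymptotic eps1P.
  apply: cvg_EFin; first exact: fin.
  have a0 : 0 < eps1 / 4 by rewrite divr_gt0 //; case/andP: eps1P.
  apply/cvgrPdist_le => e e0; near=> n.
  have n1 : (0 < n)%N by near: n; exists 1%N.
  have nn0 : n0 <= ln n%:R by near: n; exact: ln_nat_cvgy.
  have n432 : 432 <= ln n%:R :> R by near: n; exact: ln_nat_cvgy.
  have n27 : 27 * (n0 + 1 + 1) <= ln n%:R by near: n; exact: ln_nat_cvgy.
  have nt : (1 + eps) * ln n%:R <= thr n by near: n; exact: hthr.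
  have ne : 7 * expR (- (eps1 / 4 * ln n%:R)) <= e.
    by near: n; apply: small_exp_ln.
  have L0 : 0 < ln n%:R :> R by lra.
  have K1 : 1 <= n0 + 1 by lra.
  have [_ ng] := ln_nat_growth K1 n432 n27.
  rewrite /= prob //=.
  have lp : law (sub n) by have [] := assoc_law_subsampling (hp n) (hs n).
  have /andP[low up] := success_ge lp (mle n).
  rewrite ger0_norm ?subr_ge0 //; rewrite lerBlDl -lerBlDr.
  apply: le_trans low; rewrite lerD2l lerN2; apply: le_trans ne.
  have tpos : 0 < thr n by apply: lt_le_trans nt; rewrite mulr_gt0 // addr_gt0.
  have pn1 : p n < 1.
    rewrite lt_neqAle; have /andP[_ ->] := hp n; rewrite andbT.
    apply: contraTneq tpos => pn; rewrite thrE /sgap /sub /subsampling pn.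
    have -> : (1 - 2 * 1 * s n + 1 * s n ^+ 2) * (1 * s n ^+ 2) = (1 * s n * (1 - s n)) ^+ 2 by ring.
    have /andP[s0 s1] := hs n.
    rewrite sqrtr_sqr ger0_norm; last by rewrite mulr_ge0 ?subr_ge0 // mul1r ltW.
    by rewrite subrr expr0n mulr0 ltxx.
  have pn : 0 < p n < 1 by rewrite pn1; case/andP: (hp n) => ->.
  have [qq rr subE] := subsampling_corr_law pn (hs n).
  rewrite /sub subE; apply: bound => //.
    by apply: le_trans ng; rewrite ler_wpM2r ?(ltW L0) // lerDl.
  have rr' : 0 <= s n * (1 - p n) / (1 - p n * s n) <= 1.
    by case/andP: rr => r0 ->; rewrite ltW.
  rewrite -corr_law_gap // -/(sgap _) -subE -thrE.
  by apply: le_trans nt; rewrite ler_wpM2r ?(ltW L0) // lerD2l.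
have [C [n0 [C0 n00 bound]]] := success_asymptotic eps1P.
apply: cvg_EFin; first exact: fin.
have eps10 : 0 < eps1 by case/andP: eps1P.
have a0 : 0 < eps1 / 8 by rewrite divr_gt0.
apply/cvgrPdist_le => e e0; near=> n.
have n1 : (0 < n)%N by near: n; exists 1%N.
have nn0 : n0 <= ln n%:R by near: n; exact: ln_nat_cvgy.
have n432 : 432 <= ln n%:R :> R by near: n; exact: ln_nat_cvgy.
have n27 : 27 * (1 + 1) <= ln n%:R :> R by near: n; exact: ln_nat_cvgy.
have nt : thr n <= (1 - eps) * ln n%:R by near: n; exact: hthr.
have ne : C * expR (- (eps1 / 8 * ln n%:R)) <= e.
  by near: n; apply: small_exp_ln.
have L0 : 0 < ln n%:R :> R by lra.
have [ng _] := ln_nat_growth (lexx 1) n432 n27.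
rewrite /= prob //= sub0r normrN.
have pp := assoc_law_subsampling (hp n) (hs n).
have [[q0 _] _ _] := pp.
rewrite ger0_norm; last first.
  apply: mulr_ge0; first by rewrite invr_ge0 ler0n.
  by apply: sumr_ge0 => a _; apply: sumr_ge0 => b _; apply: mass_ge0.
apply: le_trans ne; apply: bound => //.
rewrite -thrE; apply: le_trans nt _.
by rewrite ler_wpM2r ?(ltW L0) // lerD2l lerN2.
Unshelve. all: by end_near.
Qed.
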